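(* Let $(\mathcal{E},\mathcal{D}(\mathcal{E}))$ be a regular, irreducible, transient Dirichlet form on $L^2(E;m)$, and let $\mu$ be a positive smooth Radon measure on $E$ such that the form $\mathcal{E}^\mu(u,v)=\mathcal{E}(u,v)-\int_E uv\,d\mu$ on $\mathcal{D}(\mathcal{E})\cap C_0(E)$ is positive semi-definite and closable in $L^2(E;m)$, with closure $(\mathcal{E}^\mu,\mathcal{D}(\mathcal{E}^\mu))$. Then: (i) $(\mathcal{E}^\mu,\mathcal{D}(\mathcal{E}^\mu))$ is subcritical if and only if there exists $h\in\mathcal{H}^+(\mu)$ such that $(\mathcal{E}^{\mu,h},\mathcal{D}(\mathcal{E}^{\mu,h}))$ is transient. (ii) $(\mathcal{E}^\mu,\mathcal{D}(\mathcal{E}^\mu))$ is critical if and only if there exists $h\in\mathcal{H}^+(\mu)$ such that $(\mathcal{E}^{\mu,h},\mathcal{D}(\mathcal{E}^{\mu,h}))$ is recurrent.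
   Context: $E$ is a locally compact separable metric space, $m$ a positive Radon measure on $E$ with full topological support, $C_0(E)$ the continuous functions with compact support. For a symmetric form $a$ write $a(u)=a(u,u)$. Irreducible: if a measurable $A\subset E$ satisfies $T_t(1_Af)=1_AT_tf$ $m$-a.e. for all $f\in L^2(E;m)$, $t>0$ ($T_t$ the semigroup of $\mathcal{E}$), then $m(A)=0$ or $m(A^c)=0$. A positive Borel measure is smooth if it charges no set of zero capacity and there are increasing closed sets $F_n$ with $\mu(F_n)<\infty$ and $\lim_n\mathrm{Cap}(K\setminus F_n)=0$ for every compact $K$ (Cap is the 1-capacity of $\mathcal{E}$). Functions in $\mathcal D(\mathcal{E})$ are represented by quasi-continuous versions. Transience/recurrence: for a Dirichlet form $(\mathcal{A},\mathcal{D}(\mathcal{A}))$ on $L^2(E;n)$, the extended Dirichlet space $\mathcal{D}_e(\mathcal{A})$ is the set of measurable $u$ with $|u|<\infty$ a.e. for which there is an $\mathcal{A}$-Cauchy sequence $u_k\in\mathcal{D}(\mathcal{A})$ with $u_k\to u$ a.e.; $\mathcal{A}(u)=\lim_k\mathcal{A}(u_k)$. $\mathcal{A}$ is transient if there is a bounded $g\in L^1(E;n)$, $g>0$ a.e., with $\int_E|u|g\,dn\le\sqrt{\mathcal{A}(u)}$ for all $u\in\mathcal{D}(\mathcal{A})$; it is recurrent if $1\in\mathcal{D}_e(\mathcal{A})$ and $\mathcal{A}(1)=0$. Extended Schrödinger space: $\mathcal{D}_e(\mathcal{E}^\mu)$ is the set of $m$-measurable $u$ with $|u|<\infty$ $m$-a.e.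 for which there is an $\mathcal{E}^\mu$-Cauchy sequence $u_n\in\mathcal{D}(\mathcal{E}^\mu)$ (approximating sequence) with $u_n\to u$ $m$-a.e.; $\mathcal{E}^\mu(u)=\lim_n\mathcal{E}^\mu(u_n)$ (well defined, since $\mathcal{E}^\mu$ is positivity preserving and so has the Fatou property). Subcritical: there is a bounded $g\in L^1(E;m)$, $g>0$ $m$-a.e., with $\int_E|u|g\,dm\le\sqrt{\mathcal{E}^\mu(u)}$ for all $u\in\mathcal{D}_e(\mathcal{E}^\mu)$. Critical: there is $\phi\in\mathcal{D}_e(\mathcal{E}^\mu)$, $\phi>0$ $m$-a.e., with $\mathcal{E}^\mu(\phi)=0$ ($\phi$ is called the ground state). $\{T^\mu_t\}$ is the strongly continuous symmetric $L^2(E;m)$-semigroup of $(\mathcal{E}^\mu,\mathcal{D}(\mathcal{E}^\mu))$; it is positivity preserving and is extended to non-negative measurable functions (by monotone limits). $\mathcal{H}^+(\mu)=\{h: 0<h<\infty\ m\text{-a.e.},\ T^\mu_th\le h\ m\text{-a.e. for all }t>0\}$. For $h\in\mathcal{H}^+(\mu)$, the Dirichlet form $(\mathcal{E}^{\mu,h},\mathcal{D}(\mathcal{E}^{\mu,h}))$ on $L^2(E;h^2m)$ is $\mathcal{E}^{\mu,h}(u,v)=\mathcal{E}^\mu(hu,hv)$, $\mathcal{D}(\mathcal{E}^{\mu,h})=\{u\in L^2(E;h^2m): hu\in\mathcal{D}(\mathcal{E}^\mu)\}$. *)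

(* Defs.v *)
From HB Require Import structures.
From mathcomp Require Import all_boot all_order all_algebra.
From mathcomp Require Import all_classical all_reals all_analysis.
From mathcomp Require Import measurable_realfun.

Set Implicit Arguments.
Unset Strict Implicit.
Unset Printing Implicit Defensive.

Import Order.TTheory GRing.Theory Num.Theory.
Import numFieldNormedType.Exports.

Local Open Scope classical_set_scope.
Local Open Scope ring_scope.

(* Elements of L^2 and of the domains of forms are represented by measurable
   real-valued functions; domains are stable under a.e. equality
   (see [symmetric_form]). *)

Record real_form (T : Type) (R : realType) := RealForm {
  dom : set (T -> R) ;
  bil :> (T -> R) -> (T -> R) -> R }.

Definition quad T (R : realType) (a : real_form T R) (u : T -> R) : R :=
  a u u.

Definition form_cauchy T (R : realType) (a : real_form T R)
    (u_ : nat -> T -> R) :=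
  forall e : R, 0 < e -> exists N : nat, forall j k : nat,
    (N <= j)%N -> (N <= k)%N -> quad a (u_ j \- u_ k) < e.

Section forms_on_L2.
Context {R : realType} {d : measure_display} {T : measurableType d}.
Variable n : {measure set T -> \bar R}.
Implicit Types (a : real_form T R) (u v w f g : T -> R).

Definition L2 : set (T -> R) := [set f | f \in Lfun n 2%:E].

Definition ip (f g : T -> R) : R := \int[n]_x (f x * g x).

Definition L2norm (f : T -> R) : \bar R := 'N[n]_(2%:E) [EFin \o f]%E.

Definition L2cvg (f_ : nat -> T -> R) f :=
  L2norm (f_ k \- f) @[k --> \oo] --> 0%E.

Definition form1 a : real_form T R :=
  RealForm (dom a) (fun u v => a u v + ip u v).

Record symmetric_form a : Prop := SymmetricForm {
  sform_L2 : dom a `<=` L2 ;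
  sform_dom_ae : forall u v, dom a u -> measurable_fun [set: T] v ->
    {ae n, forall x, u x = v x} -> dom a v ;
  sform_ae : forall u v w, dom a u -> dom a v -> dom a w ->
    {ae n, forall x, u x = v x} -> a u w = a v w ;
  sform_dom0 : dom a (cst 0) ;
  sform_dom_lin : forall (c : R) u v, dom a u -> dom a v ->
    dom a (fun x => c * u x + v x) ;
  sform_lin : forall (c : R) u v w, dom a u -> dom a v -> dom a w ->
    a (fun x => c * u x + v x) w = c * a u w + a v w ;
  sform_sym : forall u v, dom a u -> dom a v -> a u v = a v u ;
  sform_ge0 : forall u, dom a u -> 0 <= quad a u ;
  sform_dense : forall f, L2 f -> exists u_ : nat -> T -> R,
    (forall k, dom a (u_ k)) /\ L2cvg u_ f }.

Definition closed_form a := symmetric_form a /\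
  forall u_ : nat -> T -> R, (forall k, dom a (u_ k)) ->
    form_cauchy (form1 a) u_ ->
    exists2 u, dom a u & quad (form1 a) (u_ k \- u) @[k --> \oo] --> (0 : R).

Definition dirichlet_form a := closed_form a /\
  forall u, dom a u ->
    let v := fun x => Num.min (Num.max (u x) 0) 1 in
    dom a v /\ quad a v <= quad a u.

Definition reference_function g :=
  [/\ g \in Lfun n 1%E, (exists M : R, forall x, `|g x| <= M) &
      {ae n, forall x, 0 < g x}].

Definition transient a := exists2 g, reference_function g &
  forall u, dom a u ->
    (\int[n]_x (`|u x| * g x)%:E <= (Num.sqrt (quad a u))%:E)%E.

Definition approximating a (u_ : nat -> T -> R) u :=
  [/\ forall k, dom a (u_ k), form_cauchy a u_ &
      {ae n, forall x, u_ k x @[k --> \oo] --> u x}].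

Definition ext_dom a : set (T -> R) :=
  [set u | measurable_fun [set: T] u /\ exists u_ : nat -> T -> R, approximating a u_ u].

(* [ext_quad a u r] states that the extension of [quad a] to [ext_dom a] takes
   the value [r] at [u]; it is functional in [r] as soon as [a] has the Fatou
   property. *)
Definition ext_quad a u (r : R) :=
  exists2 u_ : nat -> T -> R, approximating a u_ u & quad a (u_ k) @[k --> \oo] --> r.

Definition recurrent a := ext_dom a (cst 1) /\ ext_quad a (cst 1) 0.

Definition subcritical a := exists2 g, reference_function g &
  forall u r, ext_dom a u -> ext_quad a u r ->
    (\int[n]_x (`|u x| * g x)%:E <= (Num.sqrt r)%:E)%E.

Definition critical a := exists phi,
  [/\ ext_dom a phi, {ae n, forall x, 0 < phi x} & ext_quad a phi 0].

Definition positive_semidefinite a := forall u, dom a u -> 0 <= quad a u.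

Definition closable a := forall u_ : nat -> T -> R,
  (forall k, dom a (u_ k)) -> form_cauchy a u_ -> L2cvg u_ (cst 0) ->
  quad a (u_ k) @[k --> \oo] --> (0 : R).

Definition L2_approximating a (u_ : nat -> T -> R) u :=
  [/\ forall k, dom a (u_ k), form_cauchy a u_ & L2cvg u_ u].

(* The limits below exist and do not depend on the approximating sequences
   when [a] is symmetric, bilinear, positive semidefinite and closable. *)
Definition form_closure a : real_form T R := RealForm
  [set u | L2 u /\ exists u_ : nat -> T -> R, L2_approximating a u_ u]
  (fun u v => get [set r : R | exists u_ v_ : nat -> T -> R,
     [/\ L2_approximating a u_ u, L2_approximating a v_ v &
         a (u_ k) (v_ k) @[k --> \oo] --> r]]).

Record symmetric_semigroup (S : R -> (T -> R) -> (T -> R)) : Prop :=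
  SymmetricSemigroup {
  sg_L2 : forall t f, 0 < t -> L2 f -> L2 (S t f) ;
  sg_ae : forall t f g, 0 < t -> L2 f -> L2 g ->
    {ae n, forall x, f x = g x} -> {ae n, forall x, S t f x = S t g x} ;
  sg_lin : forall t (c : R) f g, 0 < t -> L2 f -> L2 g ->
    {ae n, forall x, S t (fun y => c * f y + g y) x = c * S t f x + S t g x} ;
  sg_sym : forall t f g, 0 < t -> L2 f -> L2 g -> ip (S t f) g = ip f (S t g) ;
  sg_contraction : forall t f, 0 < t -> L2 f ->
    (L2norm (S t f) <= L2norm f)%E ;
  sg_add : forall s t f, 0 < s -> 0 < t -> L2 f ->
    {ae n, forall x, S (s + t) f x = S s (S t f) x} ;
  sg_cont : forall f, L2 f -> L2norm (S t f \- f) @[t --> 0^'+] --> 0%E }.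

Definition generator (S : R -> (T -> R) -> (T -> R)) u f :=
  L2norm (fun x => t^-1 * (S t u x - u x) - f x) @[t --> 0^'+] --> 0%E.

(* The generator of the semigroup is the self-adjoint operator A of the form:
   u \in D(A) and A u = f iff a(u, v) = - (f, v) for all v in the domain. *)
Definition semigroup_of a (S : R -> (T -> R) -> (T -> R)) :=
  symmetric_semigroup S /\
  forall u f, L2 u -> L2 f ->
    (generator S u f <->
     dom a u /\ forall v, dom a v -> a u v = - ip f v).

Definition irreducible (S : R -> (T -> R) -> (T -> R)) :=
  forall A : set T, measurable A ->
    (forall f t, L2 f -> 0 < t ->
       {ae n, forall x, S t (fun y => \1_A y * f y) x = \1_A x * S t f x}) ->
    n A = 0%E \/ n (~` A) = 0%E.

(* [g] is the value at [f >= 0] of the extension by monotone limits of the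
   positivity preserving operator [P] on L^2. *)
Definition monotone_ext (P : (T -> R) -> (T -> R)) (f g : T -> \bar R) :=
  exists f_ : nat -> T -> R,
    [/\ forall k, L2 (f_ k),
        {ae n, forall x, (forall k, 0 <= f_ k x <= f_ k.+1 x) /\
                         (f_ k x)%:E @[k --> \oo] --> f x} &
        {ae n, forall x, (P (f_ k) x)%:E @[k --> \oo] --> g x}].

(* Being finite a.e., an excessive function has a real-valued version. *)
Definition Hplus (S : R -> (T -> R) -> (T -> R)) : set {mfun T >-> R} :=
  [set h | {ae n, forall x, 0 < h x} /\
    forall t, 0 < t -> exists2 g, monotone_ext (S t) (EFin \o h) g &
      {ae n, forall x, (g x <= (h x)%:E)%E}].

End forms_on_L2.

Section square_density.
Context {R : realType} {d : measure_display} {T : measurableType d}.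
Variables (n : {measure set T -> \bar R}) (h : {mfun T >-> R}).

Definition sqr_density (A : set T) : \bar R :=
  (\int[n]_(x in A) (h x ^+ 2)%:E)%E.

Let sqr_density0 : sqr_density set0 = 0%E.
Proof. by rewrite /sqr_density integral_set0. Qed.

Let sqr_density_ge0 A : (0 <= sqr_density A)%E.
Proof. by apply: integral_ge0 => x _; rewrite lee_fin sqr_ge0. Qed.

Let sqr_density_sigma_additive : semi_sigma_additive sqr_density.
Proof.
move=> F mF tF mUF; rewrite /sqr_density; apply: cvg_toP.
  apply: ereal_nondecreasing_is_cvgn => i j ij.
  apply: lee_sum_nneg_natr => // k _ _.
  by apply: integral_ge0 => x _; rewrite lee_fin sqr_ge0.
rewrite ge0_integral_bigcup//=; last first.
  by move=> x _; rewrite lee_fin sqr_ge0.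
apply/measurable_EFinP; apply: measurable_funX => /=.
exact: measurable_funS (measurable_funPT h).
Qed.

HB.instance Definition _ := isMeasure.Build _ _ _ sqr_density
  sqr_density0 sqr_density_ge0 sqr_density_sigma_additive.

Definition h_transform (a : real_form T R) : real_form T R := RealForm
  [set u | L2 sqr_density u /\ dom a (fun x => h x * u x)]
  (fun u v => a (fun x => h x * u x) (fun x => h x * v x)).

End square_density.

(* The library's measurable types are pointed; this only excludes the empty
   space. *)
#[short(type="pmetricType")]
HB.structure Definition PointedMetric (K : numDomainType) :=
  { M of Metric K M & isPointed M }.

Definition borel (E : ptopologicalType) := g_sigma_algebraType (@open E).

Definition separable (E : topologicalType) :=
  exists2 D : set E, countable D & dense D.

Section forms_on_spaces.
Context {R : realType} {E : pmetricType R}.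
Implicit Types (m mu : {measure set (borel E) -> \bar R}).
Implicit Types (a : real_form (borel E) R).

(* On a locally compact separable metric space, finiteness on compact sets
   implies inner and outer regularity. *)
Definition radon m := forall K : set E, compact K -> (m K < +oo)%E.

Definition full_support m :=
  forall U : set E, open U -> U !=set0 -> (0 < m U)%E.

Definition C0 : set (E -> R) :=
  [set u | continuous u /\ compact (closure [set x | u x != 0])].

Definition core a : set (E -> R) := dom a `&` C0.

Definition regular m a :=
  (forall u, dom a u -> forall e : R, 0 < e ->
     exists2 v, core a v & quad (form1 m a) (v \- u) < e) /\
  (forall f, C0 f -> forall e : R, 0 < e ->
     exists2 v, core a v & forall x, `|v x - f x| < e).

Definition cap_open m a (U : set E) : \bar R :=
  ereal_inf [set (quad (form1 m a) u)%:E | u in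
    [set u | dom a u /\ {ae m, forall x, U x -> 1 <= u x}]].

Definition cap m a (A : set E) : \bar R :=
  ereal_inf [set cap_open m a U | U in [set U | open U /\ A `<=` U]].

Definition smooth m a mu :=
  (forall A : set (borel E), measurable A -> cap m a A = 0%E -> mu A = 0%E) /\
  exists F : nat -> set E,
    [/\ forall k, closed (F k), forall k, F k `<=` F k.+1,
        forall k, (mu (F k) < +oo)%E &
        forall K : set E, compact K ->
          cap m a (K `\` F k) @[k --> \oo] --> 0%E].

Definition schrodinger_core a mu : real_form (borel E) R := RealForm (core a)
  (fun u v => a u v - \int[mu]_x (u x * v x)).

Definition schrodinger m a mu : real_form (borel E) R :=
  form_closure m (schrodinger_core a mu).

End forms_on_spaces.

(* Main.v *)
(* Write [b] for the closure of [E - mu] and [S_t] for its semigroup. The map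
   [u |-> h u] carries the [h]-transform on [L2(h^2 m)] to [b] on [L2(m)], so the
   implications from right to left amount to rewriting the definitions along it
   (with Fatou's lemma for (i)). The content of the converses is the existence
   of an excessive [h].

   (i) If [int |v| g <= sqrt (b v)], the resolvents [G_alpha g] increase, as
   [alpha] decreases to 0, to a function [h] with [int h g <= 1], and
   [S_t G_alpha g <= e^(alpha t) G_alpha g] makes [h] excessive.

   (ii) Let [u_k] approximate the ground state [phi], with [b u_k --> 0]. Since
   [|S_t v - v|^2 <= t b(v) / 2], the functions [|u_k|] are asymptotically
   invariant, hence [phi], the increasing limit of their tail infima, is
   excessive.

   Both use that [b(|u|) <= b(u)], which extends from the core by lower
   semicontinuity; the properties of [S_t] come from differentiating
   [|psi(S_t f - v)|^2], where [psi] is the identity or the positive part. *)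

From HB Require Import structures.
Require Import Defs.
From mathcomp Require Import all_boot all_order all_algebra.
From mathcomp Require Import all_classical all_reals all_analysis.
From mathcomp Require Import measurable_realfun ring lra.

Set Implicit Arguments.
Unset Strict Implicit.
Unset Printing Implicit Defensive.

Import Order.TTheory GRing.Theory Num.Theory.
Import numFieldNormedType.Exports.

Local Open Scope classical_set_scope.
Local Open Scope ring_scope.

(** * Forms as pre-Hilbert spaces *)

(** Subtracting [mu] destroys the unit contraction: [min (u, 1)] lowers [a], but also the integral
    that is subtracted. The absolute value keeps [u^2], hence the integral, so the closed form is
    only known to preserve positivity. The constant 1 is then no candidate for an excessive
    function, and [h] has to be constructed.

    Neither the limit of the resolvents nor the ground state has to lie in L2, so [S_t h] has no
    direct meaning: the estimates are made along L2 functions increasing to [h].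

    The semigroup is given only by its laws and its generator. No spectral calculus and no Laplace
    transform is used: positivity, the inequality for resolvents and the rate [t b(v) / 2] all come
    from one differential inequality, integrated by an Euler scheme. In the same spirit, minimising
    sequences and the parallelogram identity stand in for Riesz representation. The transience of
    [a] provides a strictly positive integrable function, on which completeness of L2 and the bounds
    on reference functions rest. *)

Record prehilbert (T : Type) (R : realType) (a : real_form T R) : Prop :=
  Prehilbert {
  ph_dom0 : dom a (cst 0) ;
  ph_dom_lin : forall (c : R) u v, dom a u -> dom a v ->
    dom a (fun x => c * u x + v x) ;
  ph_lin : forall (c : R) u v w, dom a u -> dom a v -> dom a w ->
    a (fun x => c * u x + v x) w = c * a u w + a v w ;
  ph_sym : forall u v, dom a u -> dom a v -> a u v = a v u ;
  ph_ge0 : forall u, dom a u -> 0 <= quad a u }.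

(** * Limits of real sequences *)

Section real_sequences.
Context {R : realType}.
Implicit Types u v : nat -> R.

Lemma cvg_ext u v (l : R) : (forall k, u k = v k) -> u @ \oo --> l -> v @ \oo --> l.
Proof. by move=> /funext ->. Qed.

Lemma squeeze0 u v : (forall k, 0 <= u k <= v k) ->
  v @ \oo --> (0 : R) -> u @ \oo --> (0 : R).
Proof.
move=> uv; apply: (@squeeze_cvgr _ _ _ _ (cst 0)) => //; last exact: cvg_cst.
exact: nearW.
Qed.

Lemma sqr_cvg0 u : u k ^+ 2 @[k --> \oo] --> (0 : R) -> u @ \oo --> (0 : R).
Proof.
move=> /cvgrPdist_lt u2; apply/cvgrPdist_lt => e e0.
have [|N _ NP] := u2 (e ^+ 2); first by rewrite exprn_gt0.
exists N => // k /NP /=; rewrite !sub0r !normrN normrX.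
by rewrite ltr_pXn2r ?nnegrE// ltW.
Qed.

Lemma cvg0P u : (forall e, 0 < e -> exists N, forall k, (N <= k)%N -> `|u k| < e) <->
  u @ \oo --> (0 : R).
Proof.
split=> [H|/cvgrPdist_lt H e e0].
  apply/cvgrPdist_lt => e /H[N NP]; exists N => // k /NP.
  by rewrite sub0r normrN.
have [N _ NP] := H e e0; exists N => k /NP; by rewrite sub0r normrN.
Qed.

Lemma cauchy_real_cvg u :
  (forall e, 0 < e -> exists N, forall j k, (N <= j)%N -> (N <= k)%N ->
    `|u j - u k| < e) -> cvgn u.
Proof.
move=> H; apply: cauchy_cvg; apply/cauchy_exP => e /H[N NP].
by exists (u N); exists N => // k Nk; exact: NP.
Qed.

Lemma cvg_le u (l M : R) : u @ \oo --> l -> (forall k, u k <= M) -> l <= M.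
Proof.
move=> ul uM; rewrite -(cvg_lim _ ul)//.
by apply: limr_le; [apply/cvg_ex; exists l|exact: nearW].
Qed.

Lemma cvg_ge u (l M : R) : u @ \oo --> l -> (forall k, M <= u k) -> M <= l.
Proof.
move=> ul uM; rewrite -(cvg_lim _ ul)//.
by apply: limr_ge; [apply/cvg_ex; exists l|exact: nearW].
Qed.

Lemma cvg_invS : k.+1%:R^-1 @[k --> \oo] --> (0 : R).
Proof. exact: cvg_harmonic. Qed.

Lemma cvg_cmul (c l : R) u : u @ \oo --> l -> c * u k @[k --> \oo] --> c * l.
Proof. by move=> ul; apply: cvgM => //; exact: cvg_cst. Qed.

Lemma cvg_add (l l' : R) u v : u @ \oo --> l -> v @ \oo --> l' ->
  u k + v k @[k --> \oo] --> l + l'.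
Proof. by move=> ul vl; exact: cvgD. Qed.

Lemma cvg_dist0 (l : R) u : u @ \oo --> l -> u k - l @[k --> \oo] --> (0 : R).
Proof. by move=> /subr_cvg0. Qed.

Lemma cvg_uniq u (l l' : R) : u @ \oo --> l -> u @ \oo --> l' -> l = l'.
Proof. by move=> /(cvg_lim (@Rhausdorff R)) <- /(cvg_lim (@Rhausdorff R)) <-. Qed.

End real_sequences.

Section prehilbert_theory.
Context {T : Type} {R : realType} (a : real_form T R).
Hypothesis ha : prehilbert a.
Implicit Types u v w : T -> R.

Lemma ph_domB u v : dom a u -> dom a v -> dom a (u \- v).
Proof.
move=> du dv; have := ph_dom_lin ha (-1) dv du.
by congr (dom a _); apply/funext => x /=; ring.
Qed.

Lemma ph_domD u v : dom a u -> dom a v -> dom a (u \+ v).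
Proof.
move=> du dv; have := ph_dom_lin ha 1 du dv.
by congr (dom a _); apply/funext => x /=; ring.
Qed.

Lemma ph_domZ c u : dom a u -> dom a (fun x => c * u x).
Proof.
move=> du; have := ph_dom_lin ha c du (ph_dom0 ha).
by congr (dom a _); apply/funext => x /=; ring.
Qed.

Lemma ph0l w : dom a w -> a (cst 0) w = 0.
Proof.
move=> dw; have /= := ph_lin ha 1 (ph_dom0 ha) (ph_dom0 ha) dw.
have -> : (fun x : T => 1 * 0 + 0) = cst 0 :> (T -> R).
  by apply/funext => x /=; ring.
by move=> H; lra.
Qed.

Lemma phZl c u w : dom a u -> dom a w -> a (fun x => c * u x) w = c * a u w.
Proof.
move=> du dw; have := ph_lin ha c du (ph_dom0 ha) dw.
rewrite ph0l// addr0 => <-; congr (a _ _); apply/funext => x /=; ring.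
Qed.

Lemma phBl u v w : dom a u -> dom a v -> dom a w ->
  a (u \- v) w = a u w - a v w.
Proof.
move=> du dv dw; have := ph_lin ha (-1) dv du dw.
rewrite mulN1r addrC => <-; congr (a _ _); apply/funext => x /=; ring.
Qed.

Lemma phDl u v w : dom a u -> dom a v -> dom a w ->
  a (u \+ v) w = a u w + a v w.
Proof.
move=> du dv dw; have := ph_lin ha 1 du dv dw.
rewrite mul1r => <-; congr (a _ _); apply/funext => x /=; ring.
Qed.

Lemma phZr c u w : dom a u -> dom a w -> a w (fun x => c * u x) = c * a w u.
Proof.
by move=> du dw; rewrite ph_sym ?phZl// ?(ph_sym ha du)//; exact: ph_domZ.
Qed.

Lemma phBr u v w : dom a u -> dom a v -> dom a w ->
  a w (u \- v) = a w u - a w v.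
Proof.
move=> du dv dw; rewrite ph_sym// ?phBl// ?(ph_sym ha du)// ?(ph_sym ha dv)//.
exact: ph_domB.
Qed.

Lemma phDr u v w : dom a u -> dom a v -> dom a w ->
  a w (u \+ v) = a w u + a w v.
Proof.
move=> du dv dw; rewrite ph_sym// ?phDl// ?(ph_sym ha du)// ?(ph_sym ha dv)//.
exact: ph_domD.
Qed.

Lemma quadB u v : dom a u -> dom a v ->
  quad a (u \- v) = quad a u - 2 * a u v + quad a v.
Proof.
move=> du dv; have dB := ph_domB du dv.
by rewrite /quad phBl// !phBr// (ph_sym ha dv du); ring.
Qed.

Lemma quadD u v : dom a u -> dom a v ->
  quad a (u \+ v) = quad a u + 2 * a u v + quad a v.
Proof.
move=> du dv; have dB := ph_domD du dv.
by rewrite /quad phDl// !phDr// (ph_sym ha dv du); ring.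
Qed.

Lemma quadZ c u : dom a u -> quad a (fun x => c * u x) = c ^+ 2 * quad a u.
Proof.
by move=> du; rewrite /quad phZl ?phZr//; [ring|exact: ph_domZ].
Qed.

Lemma quad_sym u v : dom a u -> dom a v -> quad a (u \- v) = quad a (v \- u).
Proof. by move=> du dv; rewrite !quadB// (ph_sym ha du dv); ring. Qed.

Lemma quad0 : quad a (cst 0) = 0.
Proof. by rewrite /quad ph0l//; exact: ph_dom0. Qed.

Lemma parallelogram u v : dom a u -> dom a v ->
  quad a (u \- v) + quad a (u \+ v) = 2 * quad a u + 2 * quad a v.
Proof. by move=> du dv; rewrite quadB// quadD//; ring. Qed.

Lemma quadD_le u v : dom a u -> dom a v ->
  quad a (u \+ v) <= 2 * quad a u + 2 * quad a v.
Proof.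
move=> du dv; rewrite -parallelogram// lerDr; apply: ph_ge0 => //.
exact: ph_domB.
Qed.

Lemma quadB_le u v : dom a u -> dom a v ->
  quad a (u \- v) <= 2 * quad a u + 2 * quad a v.
Proof.
move=> du dv; rewrite -parallelogram// lerDl; apply: ph_ge0 => //.
exact: ph_domD.
Qed.

Lemma quad_chain v u w : dom a u -> dom a v -> dom a w ->
  quad a (u \- w) <= 2 * quad a (u \- v) + 2 * quad a (v \- w).
Proof.
move=> du dv dw; have := quadD_le (ph_domB du dv) (ph_domB dv dw).
by congr (quad a _ <= _); apply/funext => x /=; ring.
Qed.

Lemma cauchy_schwarz u v : dom a u -> dom a v ->
  a u v ^+ 2 <= quad a u * quad a v.
Proof.
move=> du dv.
have poly t : 0 <= quad a v - 2 * t * a u v + t ^+ 2 * quad a u.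
  have dtu := ph_domZ t du.
  have := ph_ge0 ha (ph_domB dv dtu).
  by rewrite quadB// quadZ// phZr// (ph_sym ha dv du) mulrA.
have qu := ph_ge0 ha du; have qv := ph_ge0 ha dv.
have [q0|q0] := eqVneq (quad a u) 0; last first.
  have qpos : 0 < quad a u by rewrite lt_neqAle eq_sym q0.
  have := poly (a u v / quad a u).
  have -> : quad a v - 2 * (a u v / quad a u) * a u v +
     (a u v / quad a u) ^+ 2 * quad a u = quad a v - a u v ^+ 2 / quad a u.
    by field.
  by rewrite subr_ge0 ler_pdivrMr// mulrC.
(* The polynomial is now affine in [t]; if its slope were nonzero, it would take the value -1 at
   this point. *)
rewrite q0 mul0r; have := poly ((quad a v + 1) / (2 * a u v)).
rewrite q0 mulr0 addr0; have [->|e0] := eqVneq (a u v) 0.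
  by rewrite expr0n.
have -> : quad a v - 2 * ((quad a v + 1) / (2 * a u v)) * a u v = - 1.
  by field.
by rewrite oppr_ge0 ler10.
Qed.

Lemma young u v : dom a u -> dom a v ->
  2 * a u v <= quad a u + quad a v.
Proof.
move=> du dv; have := ph_ge0 ha (ph_domB du dv).
by rewrite quadB// => H; lra.
Qed.

Lemma cauchy_schwarz_sqrt u v : dom a u -> dom a v ->
  a u v <= Num.sqrt (quad a u) * Num.sqrt (quad a v).
Proof.
move=> du dv; apply: le_trans (ler_norm _) _.
rewrite -sqrtrM; last exact: ph_ge0.
by rewrite -sqrtr_sqr; apply: ler_wsqrtr; exact: cauchy_schwarz.
Qed.

Lemma sqrt_quadD_le u v : dom a u -> dom a v ->
  Num.sqrt (quad a (u \+ v)) <= Num.sqrt (quad a u) + Num.sqrt (quad a v).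
Proof.
move=> du dv.
rewrite -[leRHS]ger0_norm; last by rewrite addr_ge0 ?sqrtr_ge0.
rewrite -sqrtr_sqr; apply: ler_wsqrtr.
rewrite quadD// sqrrD !sqr_sqrtr; try exact: ph_ge0.
have := cauchy_schwarz_sqrt du dv; move=> H; rewrite lerD2r lerD2l.
by rewrite mulrC mulr_natr lerMn2r.
Qed.

Lemma sqrt_quadB_le u v : dom a u -> dom a v ->
  `|Num.sqrt (quad a u) - Num.sqrt (quad a v)| <= Num.sqrt (quad a (u \- v)).
Proof.
move=> du dv.
have sub x y : dom a x -> dom a y ->
    Num.sqrt (quad a x) <= Num.sqrt (quad a (x \- y)) + Num.sqrt (quad a y).
  move=> dx dy; have := sqrt_quadD_le (ph_domB dx dy) dy.
  by congr (Num.sqrt (quad a _) <= _); apply/funext => t /=; ring.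
have := sub _ _ du dv; have := sub _ _ dv du; rewrite (quad_sym dv du) => ? ?.
by rewrite ler_norml; apply/andP; split; lra.
Qed.

Section convergence.
Variables (u_ v_ : nat -> T -> R) (u v : T -> R).
Hypotheses (du_ : forall k, dom a (u_ k)) (dv_ : forall k, dom a (v_ k)).
Hypotheses (du : dom a u) (dv : dom a v).

Lemma form_cvgl : quad a (u_ k \- u) @[k --> \oo] --> (0 : R) ->
  a (u_ k) v @[k --> \oo] --> a u v.
Proof.
move=> Hu; apply/subr_cvg0/sqr_cvg0.
apply: (@squeeze0 _ _ (fun k => quad a (u_ k \- u) * quad a v)); last first.
  by rewrite -(mul0r (quad a v)); apply: cvgM => //; exact: cvg_cst.
move=> k; rewrite sqr_ge0/= -phBl//; apply: cauchy_schwarz => //.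
exact: ph_domB.
Qed.

Lemma form_cvg : quad a (u_ k \- u) @[k --> \oo] --> (0 : R) ->
  quad a (v_ k \- v) @[k --> \oo] --> (0 : R) ->
  a (u_ k) (v_ k) @[k --> \oo] --> a u v.
Proof.
move=> Hu Hv.
have H1 : a (u_ k) v @[k --> \oo] --> a u v by exact: form_cvgl.
apply/subr_cvg0.
have -> : (fun k => a (u_ k) (v_ k) - a u v) =
   (fun k => a (u_ k \- u) (v_ k \- v) + (a (v_ k) u - a v u) +
             (a (u_ k) v - a u v)).
  apply/funext => k; rewrite phBl ?phBr//; try exact: ph_domB.
  by rewrite (ph_sym ha (dv_ k)) // (ph_sym ha dv du); ring.
have -> : 0 = 0 + 0 + 0 :> R by rewrite !addr0.
apply: cvgD; last exact/subr_cvg0.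
apply: cvgD; last first.
  apply/subr_cvg0/subr_cvg0/sqr_cvg0.
  apply: (@squeeze0 _ _ (fun k => quad a (v_ k \- v) * quad a u)); last first.
    by rewrite -(mul0r (quad a u)); apply: cvgM => //; exact: cvg_cst.
  move=> k; rewrite sqr_ge0/= -phBl//; apply: cauchy_schwarz => //.
  exact: ph_domB.
apply/sqr_cvg0.
apply: (@squeeze0 _ _ (fun k => quad a (u_ k \- u) * quad a (v_ k \- v))).
  move=> k; rewrite sqr_ge0/=; apply: cauchy_schwarz => //; exact: ph_domB.
by rewrite -[in X in _ --> X](mulr0 0); exact: cvgM.
Qed.

End convergence.

Lemma quad_cvg (u_ : nat -> T -> R) u : (forall k, dom a (u_ k)) -> dom a u ->
  quad a (u_ k \- u) @[k --> \oo] --> (0 : R) ->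
  quad a (u_ k) @[k --> \oo] --> quad a u.
Proof. by move=> du_ du Hu; exact: form_cvg. Qed.

Lemma quad_cvg_cauchy (u_ : nat -> T -> R) u : (forall k, dom a (u_ k)) -> dom a u ->
  quad a (u_ k \- u) @[k --> \oo] --> (0 : R) -> form_cauchy a u_.
Proof.
move=> du_ du /cvg0P Hu e e0.
have [|N NP] := Hu (e / 4); first by lra.
exists N => j k /NP + /NP; have := quad_chain (du_ j) du (du_ k).
rewrite (quad_sym du (du_ k)) => H H1 H2.
have := ler_norm (quad a (u_ j \- u)).
have := ler_norm (quad a (u_ k \- u)).
by move=> ? ?; lra.
Qed.

Lemma quad_cvg0_cauchy (u_ : nat -> T -> R) : (forall k, dom a (u_ k)) ->
  quad a (u_ k) @[k --> \oo] --> (0 : R) -> form_cauchy a u_.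
Proof.
move=> du_ Hu; apply: (quad_cvg_cauchy du_ (ph_dom0 ha)).
apply: cvg_ext Hu => k.
by congr quad; apply/funext => x /=; rewrite subr0.
Qed.

Lemma cauchyD (u_ v_ : nat -> T -> R) : (forall k, dom a (u_ k)) -> (forall k, dom a (v_ k)) ->
  form_cauchy a u_ -> form_cauchy a v_ -> form_cauchy a (fun k => u_ k \+ v_ k).
Proof.
move=> du dv Hu Hv e e0.
have [|N NP] := Hu (e / 4); first by lra.
have [|M MP] := Hv (e / 4); first by lra.
exists (maxn N M) => j k; rewrite !geq_max => /andP[jN jM] /andP[kN kM].
have := NP _ _ jN kN; have := MP _ _ jM kM.
have := quadD_le (ph_domB (du j) (du k)) (ph_domB (dv j) (dv k)).
have -> : (u_ j \+ v_ j) \- (u_ k \+ v_ k) = (u_ j \- u_ k) \+ (v_ j \- v_ k).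
  by apply/funext => x /=; ring.
by move=> *; lra.
Qed.

Lemma cauchyZ c (u_ : nat -> T -> R) : (forall k, dom a (u_ k)) ->
  form_cauchy a u_ -> form_cauchy a (fun k x => c * u_ k x).
Proof.
move=> du Hu e e0.
have [|N NP] := Hu (e / (c ^+ 2 + 1)).
  by rewrite divr_gt0// ltr_wpDl// sqr_ge0.
exists N => j k jN kN; have := NP _ _ jN kN.
have -> : (fun x => c * u_ j x) \- (fun x => c * u_ k x) =
   (fun x => c * (u_ j \- u_ k) x) by apply/funext => x /=; ring.
rewrite quadZ; last exact: ph_domB.
have c0 := sqr_ge0 c; have := ph_ge0 ha (ph_domB (du j) (du k)).
rewrite ltr_pdivlMr; last by lra.
by nra.
Qed.

(** The square root of [quad a] is a seminorm, hence 1-Lipschitz for itself; this makes the roots a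
    Cauchy sequence of reals, and the limit is then squared. *)
Lemma cauchy_quad_cvg (u_ : nat -> T -> R) : (forall k, dom a (u_ k)) -> form_cauchy a u_ ->
  exists r : R, quad a (u_ k) @[k --> \oo] --> r.
Proof.
move=> du_ Hu.
have : cvgn (fun k => Num.sqrt (quad a (u_ k))).
  apply: cauchy_real_cvg => e e0.
  have [|N NP] := Hu (e ^+ 2); first by rewrite exprn_gt0.
  exists N => j k jN kN; apply: le_lt_trans (sqrt_quadB_le _ _) _ => //.
  rewrite -(ger0_norm (ltW e0)) -sqrtr_sqr ltr_sqrt ?exprn_gt0//.
  exact: NP.
move=> /cvg_ex[l Hl]; exists (l * l).
apply: cvg_ext (cvgM Hl Hl) => k /=.
by rewrite -expr2 sqr_sqrtr//; exact: ph_ge0.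
Qed.

Lemma polarization u v : dom a u -> dom a v ->
  a u v = (quad a (u \+ v) - quad a (u \- v)) / 4.
Proof. by move=> du dv; rewrite quadB// quadD//; field. Qed.

Lemma cauchy_form_cvg (u_ v_ : nat -> T -> R) : (forall k, dom a (u_ k)) ->
  (forall k, dom a (v_ k)) -> form_cauchy a u_ -> form_cauchy a v_ ->
  exists r : R, a (u_ k) (v_ k) @[k --> \oo] --> r.
Proof.
move=> du dv Hu Hv.
have [r1 Hr1] := cauchy_quad_cvg (fun k => ph_domD (du k) (dv k))
  (cauchyD du dv Hu Hv).
have := cauchyD du (fun k => ph_domZ (-1) (dv k)) Hu (cauchyZ (-1) dv Hv).
have -> : (fun k => u_ k \+ (fun x => -1 * v_ k x)) = (fun k => u_ k \- v_ k).
  by apply/funext => k; apply/funext => x /=; ring.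
move=> /(cauchy_quad_cvg (fun k => ph_domB (du k) (dv k)))[r2 Hr2].
exists ((r1 - r2) / 4).
apply: cvg_ext (cvgM (cvgB Hr1 Hr2) (cvg_cst (4^-1 : R))) => k /=.
by rewrite polarization.
Qed.

End prehilbert_theory.

(** * The space L2 *)

Definition L2_form (d : measure_display) (T : measurableType d) (R : realType)
    (n : {measure set T -> \bar R}) : real_form T R := RealForm (L2 n) (ip n).

Section L2_theory.
Context {R : realType} {d : measure_display} {T : measurableType d}.
Variable n : {measure set T -> \bar R}.
Implicit Types f g u v w : T -> R.

Lemma measurable_limn_einf (F : nat -> T -> \bar R) :
  (forall k, measurable_fun [set: T] (F k)) ->
  measurable_fun [set: T] (fun x => limn_einf (F^~ x)).
Proof.
move=> mF; rewrite (_ : (fun x => _) = (fun x => - limn_esup (fun k => - F k x)))%E.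
  apply: measurableT_comp => //; apply: measurable_fun_limn_esup => k.
  by apply: (@measurableT_comp _ _ _ _ _ _ (@oppe R)) => //; exact: mF.
apply/funext => x; rewrite -limn_einfN; congr limn_einf.
by apply/funext => k; rewrite /= oppeK.
Qed.

(** The limit [F] is replaced by the pointwise lower limit, which is measurable and equals it a.e.
    The bounds may depend on [k], as energies do along an approximating sequence. *)
Lemma fatou_ae (F_ : nat -> T -> R) (F : T -> R) (c_ : nat -> R) (c : R) :
  (forall k, measurable_fun [set: T] (F_ k)) -> measurable_fun [set: T] F ->
  (forall k x, 0 <= F_ k x) -> (forall x, 0 <= F x) ->
  {ae n, forall x, F_ k x @[k --> \oo] --> F x} ->
  (forall k, (\int[n]_x (F_ k x)%:E <= (c_ k)%:E)%E) -> c_ @ \oo --> c ->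
  (\int[n]_x (F x)%:E <= c%:E)%E.
Proof.
move=> mF_ mF F_0 F0 F_F Fc cc.
have mEF_ k : measurable_fun [set: T] (EFin \o F_ k) by apply/measurable_EFinP.
rewrite (@ge0_ae_eq_integral _ _ _ n _ _
    (fun x => limn_einf (fun k => (F_ k x)%:E))) => //.
- apply: le_trans (fatou n measurableT mEF_ _) _.
    by move=> k x _; rewrite lee_fin.
  have cE : (fun k => (c_ k)%:E) @ \oo --> c%:E by apply/cvg_EFin => //; exact: nearW.
  have [<- _] := cvg_limn_einf_sup cE.
  rewrite !limn_einf_lim; apply: lee_lim; try exact: is_cvg_einfs.
  apply: nearW => k /=; apply: le_ereal_inf_tmp => _ [j /= kj <-].
  by apply: le_trans (Fc j); apply: ereal_inf_lbound; exists j.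
- exact/measurable_EFinP.
- exact: (measurable_limn_einf mEF_).
- by move=> x _; rewrite lee_fin.
- move=> x _; rewrite limn_einf_lim; apply: lime_ge; first exact: is_cvg_einfs.
  by apply: nearW => k; apply: le_ereal_inf_tmp => _ [j /= kj <-]; rewrite lee_fin.
- apply: filterS F_F => x Fx _.
  have cE : (fun k => (F_ k x)%:E) @ \oo --> (F x)%:E by apply/cvg_EFin => //; exact: nearW.
  by have [-> _] := cvg_limn_einf_sup cE.
Qed.

Lemma aeI (P Q : T -> Prop) : {ae n, forall x, P x} -> {ae n, forall x, Q x} ->
  {ae n, forall x, P x /\ Q x}.
Proof. by apply: filterS2. Qed.

Lemma L2_meas f : L2 n f -> measurable_fun [set: T] f.
Proof. by rewrite /L2/= inE => /andP[]; rewrite inE. Qed.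

Lemma L2_mul_int f g : L2 n f -> L2 n g ->
  n.-integrable [set: T] (EFin \o (fun x => f x * g x)).
Proof. by move=> Hf Hg; apply/Lfun1_integrable; exact: Lfun2_mul_Lfun1. Qed.

Lemma L2P f : measurable_fun [set: T] f ->
  L2 n f <-> (\int[n]_x (f x ^+ 2)%:E < +oo)%E.
Proof.
move=> mf; split.
  move=> Hf; have /integrableP[_] := L2_mul_int Hf Hf.
  by under eq_integral do rewrite /= ger0_norm ?sqr_ge0// -expr2.
move=> Hf; rewrite /L2/= inE; apply/andP; split; rewrite inE//=.
rewrite /finite_norm unlock; apply: poweR_lty.
by under eq_integral do rewrite /= powR_mulrn// real_normK ?num_real//.
Qed.

Lemma L2_ip_fin f g : L2 n f -> L2 n g -> (ip n f g)%:E = (\int[n]_x (f x * g x)%:E)%E.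
Proof.
move=> Hf Hg; rewrite /ip /Rintegral fineK//.
by apply: integrable_fin_num => //; exact: L2_mul_int.
Qed.

Lemma L2_quad_fin f : L2 n f -> (ip n f f)%:E = (\int[n]_x (f x ^+ 2)%:E)%E.
Proof. by move=> Hf; rewrite L2_ip_fin//; under eq_integral do rewrite -expr2. Qed.

Lemma L2_bound f (M : R) : measurable_fun [set: T] f ->
  (\int[n]_x (f x ^+ 2)%:E <= M%:E)%E -> L2 n f /\ ip n f f <= M.
Proof.
move=> mf H; have Hf : L2 n f by apply/L2P => //; exact: le_lt_trans H (ltry _).
by split => //; rewrite -lee_fin L2_quad_fin.
Qed.

Lemma L2_dominated f g : measurable_fun [set: T] f -> L2 n g ->
  {ae n, forall x, `|f x| <= `|g x|} -> L2 n f /\ ip n f f <= ip n g g.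
Proof.
move=> mf Hg fg; apply: L2_bound => //; rewrite L2_quad_fin//.
apply: ae_ge0_le_integral => //.
- by move=> x _; rewrite lee_fin sqr_ge0.
- by apply/measurable_EFinP; exact: measurable_funX.
- by move=> x _; rewrite lee_fin sqr_ge0.
- by apply/measurable_EFinP; apply: measurable_funX; exact: L2_meas.
- apply: filterS fg => x fgx _; rewrite lee_fin.
  rewrite -[f x ^+ 2]ger0_norm ?sqr_ge0// -[g x ^+ 2]ger0_norm ?sqr_ge0//.
  by rewrite !normrX lerXn2r ?nnegrE.
Qed.

Lemma L2_lin (c : R) u v : L2 n u -> L2 n v -> L2 n (fun x => c * u x + v x).
Proof.
move=> Hu Hv; have mu := L2_meas Hu; have mv := L2_meas Hv.
have mw : measurable_fun [set: T] (fun x => c * u x + v x).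
  by apply: measurable_funD => //; exact: measurable_funM.
apply/L2P => //.
apply: (@le_lt_trans _ _ (\int[n]_x ((2 * c ^+ 2) * (u x * u x) + 2 * (v x * v x))%:E)%E).
  apply: ge0_le_integral => //.
  - by move=> x _; rewrite lee_fin sqr_ge0.
  - by apply/measurable_EFinP; exact: measurable_funX.
  - apply/measurable_EFinP; apply: measurable_funD; apply: measurable_funM => //;
      exact: measurable_funM.
  - move=> x _; rewrite lee_fin.
    have := sqr_ge0 (c * u x - v x); rewrite sqrrB sqrrD exprMn => H.
    by rewrite -!expr2; nra.
under eq_integral do rewrite EFinD !EFinM -!EFinM.
rewrite integralD//=; last 2 first.
- by under eq_fun do rewrite EFinM; apply: integrableZl => //; exact: L2_mul_int.
- by under eq_fun do rewrite EFinM; apply: integrableZl => //; exact: L2_mul_int.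
rewrite lte_add_pinfty//.
- under eq_integral do rewrite EFinM; rewrite integralZl//; last exact: L2_mul_int.
  by rewrite -L2_ip_fin// -EFinM ltry.
- under eq_integral do rewrite EFinM; rewrite integralZl//; last exact: L2_mul_int.
  by rewrite -L2_ip_fin// -EFinM ltry.
Qed.

Lemma L2_0 : L2 n (cst 0).
Proof.
apply/L2P => //=; rewrite expr0n /=.
by rewrite integral0.
Qed.

Lemma L2_prehilbert : prehilbert (L2_form n).
Proof.
split => /=.
- exact: L2_0.
- by move=> c u v; exact: L2_lin.
- move=> c u v w Hu Hv Hw; rewrite /ip.
  rewrite -RintegralZl//; last exact: L2_mul_int.
  rewrite -RintegralD//; last 2 first.
  + have : L2 n (fun x => c * u x) by have := L2_lin c Hu L2_0;
      congr (L2 n _); apply/funext => x /=; rewrite addr0.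
    move=> /L2_mul_int/(_ Hw); congr (n.-integrable _ _); apply/funext => x /=.
    by rewrite mulrA.
  + exact: L2_mul_int.
  by apply: eq_Rintegral => x _; ring.
- by move=> u v Hu Hv; apply: eq_Rintegral => x _; rewrite mulrC.
- by move=> u Hu; apply: Rintegral_ge0 => x _; rewrite -expr2 sqr_ge0.
Qed.

Lemma L2B u v : L2 n u -> L2 n v -> L2 n (u \- v).
Proof. exact: (ph_domB L2_prehilbert). Qed.

Lemma L2D u v : L2 n u -> L2 n v -> L2 n (u \+ v).
Proof. exact: (ph_domD L2_prehilbert). Qed.

Lemma L2Z c u : L2 n u -> L2 n (fun x => c * u x).
Proof. exact: (ph_domZ L2_prehilbert). Qed.

Lemma ipBl u v w : L2 n u -> L2 n v -> L2 n w -> ip n (u \- v) w = ip n u w - ip n v w.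
Proof. exact: (phBl L2_prehilbert). Qed.

Lemma ipZl (c : R) u w : L2 n u -> L2 n w -> ip n (fun x => c * u x) w = c * ip n u w.
Proof. exact: (phZl L2_prehilbert). Qed.

Lemma ipDr u v w : L2 n u -> L2 n v -> L2 n w -> ip n w (u \+ v) = ip n w u + ip n w v.
Proof. exact: (phDr L2_prehilbert). Qed.

Lemma ipZr (c : R) u w : L2 n u -> L2 n w -> ip n w (fun x => c * u x) = c * ip n w u.
Proof. exact: (phZr L2_prehilbert). Qed.

Lemma ip_quadB u v : L2 n u -> L2 n v ->
  ip n (u \- v) (u \- v) = ip n u u - 2 * ip n u v + ip n v v.
Proof. exact: (quadB L2_prehilbert). Qed.

Lemma ip_quadD u v : L2 n u -> L2 n v ->
  ip n (u \+ v) (u \+ v) = ip n u u + 2 * ip n u v + ip n v v.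
Proof. exact: (quadD L2_prehilbert). Qed.

Lemma ip_quadZ (c : R) u : L2 n u ->
  ip n (fun x => c * u x) (fun x => c * u x) = c ^+ 2 * ip n u u.
Proof. exact: (quadZ L2_prehilbert). Qed.

Lemma ip_ge0 u : 0 <= ip n u u.
Proof. by apply: Rintegral_ge0 => x _; rewrite -expr2 sqr_ge0. Qed.

Lemma ip_sym u v : ip n u v = ip n v u.
Proof. by apply: eq_Rintegral => x _; rewrite mulrC. Qed.

Lemma L2_ae u v : L2 n u -> measurable_fun [set: T] v ->
  {ae n, forall x, u x = v x} -> L2 n v.
Proof.
move=> Hu mv uv; have [|//] := @L2_dominated v u mv Hu.
by apply: filterS uv => x ->.
Qed.

Lemma ip_ae u v w : L2 n u -> L2 n v -> L2 n w ->
  {ae n, forall x, u x = v x} -> ip n u w = ip n v w.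
Proof.
move=> Hu Hv Hw uv; rewrite /ip /Rintegral; congr fine.
apply: ae_eq_integral => //.
- by apply/measurable_EFinP; apply: measurable_funM; exact: L2_meas.
- by apply/measurable_EFinP; apply: measurable_funM; exact: L2_meas.
- by apply: filterS uv => x -> _.
Qed.

Lemma ip_quad_ae u v : L2 n u -> L2 n v ->
  {ae n, forall x, u x = v x} -> ip n u u = ip n v v.
Proof.
by move=> Hu Hv uv; rewrite (ip_ae Hu Hv Hu uv) ip_sym (ip_ae Hu Hv Hv uv).
Qed.

Lemma ip_eq0_ae u : L2 n u -> ip n u u = 0 -> {ae n, forall x, u x = 0}.
Proof.
move=> Hu u0; have mu := L2_meas Hu.
have : (\int[n]_x `| (u x ^+ 2)%:E | = 0)%E.
  under eq_integral do rewrite gee0_abs ?lee_fin ?sqr_ge0//.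
  by rewrite -L2_quad_fin// u0.
move/ae_eq_integral_abs => /(_ measurableT) H.
have {}H := H _; have /H : measurable_fun [set: T] (fun x => (u x ^+ 2)%:E).
  by apply/measurable_EFinP; exact: measurable_funX.
by apply: filterS => x /(_ I)/= [] /eqP; rewrite sqrf_eq0 => /eqP.
Qed.

Lemma ip_ge0_ae u v : L2 n u -> L2 n v -> {ae n, forall x, 0 <= u x} ->
  {ae n, forall x, 0 <= v x} -> 0 <= ip n u v.
Proof.
move=> Hu Hv u0 v0.
have -> : ip n u v = \int[n]_x `|u x * v x|.
  rewrite /ip /Rintegral; congr fine; apply: ae_eq_integral => //.
  - by apply/measurable_EFinP; apply: measurable_funM; exact: L2_meas.
  - apply/measurable_EFinP; apply: measurableT_comp => //.
    by apply: measurable_funM; exact: L2_meas.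
  - by apply: filterS2 u0 v0 => x u0 v0 _; rewrite ger0_norm// mulr_ge0.
exact: Rintegral_ge0.
Qed.

Lemma L2norm_ip u : L2 n u -> L2norm n u = (Num.sqrt (ip n u u))%:E.
Proof.
move=> Hu; rewrite /L2norm unlock.
under eq_integral do rewrite /= powR_mulrn// real_normK ?num_real//.
rewrite -L2_quad_fin// poweR_EFin; congr EFin.
by rewrite powR12_sqrt// ip_ge0.
Qed.

Lemma L2cvgP (u_ : nat -> T -> R) u : (forall k, L2 n (u_ k)) -> L2 n u ->
  L2cvg n u_ u <-> ip n (u_ k \- u) (u_ k \- u) @[k --> \oo] --> (0 : R).
Proof.
move=> Hu_ Hu; rewrite /L2cvg.
have -> : (fun k => L2norm n (u_ k \- u)) =
    (fun k => (Num.sqrt (ip n (u_ k \- u) (u_ k \- u)))%:E).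
  by apply/funext => k; rewrite L2norm_ip//; exact: L2B.
split=> [/fine_cvgP[_] H|H].
  rewrite -(mulr0 0); apply: cvg_ext (cvgM H H) => k /=.
  by rewrite -expr2 sqr_sqrtr// ip_ge0.
apply/fine_cvgP; split; first exact: nearW.
apply/sqr_cvg0; apply: cvg_ext H => k /=.
by rewrite sqr_sqrtr// ip_ge0.
Qed.

Lemma L2_fatou (u_ : nat -> T -> R) u (M_ : nat -> R) (M : R) :
  (forall k, measurable_fun [set: T] (u_ k)) ->
  measurable_fun [set: T] u ->
  {ae n, forall x, u_ k x @[k --> \oo] --> u x} ->
  (forall k, (\int[n]_x (u_ k x ^+ 2)%:E <= (M_ k)%:E)%E) -> M_ @ \oo --> M ->
  L2 n u /\ ip n u u <= M.
Proof.
move=> mu_ mu uu HM MM; apply: L2_bound => //.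
apply: (@fatou_ae (fun k x => u_ k x ^+ 2) _ M_) => //.
- by move=> k; exact: measurable_funX.
- exact: measurable_funX.
- by move=> k x; exact: sqr_ge0.
- by move=> x; exact: sqr_ge0.
- by apply: filterS uu => x ux; under eq_fun do rewrite expr2; exact: cvgM.
Qed.

(** The upper limit is measurable without any assumption of convergence, and [fine] makes it real
    everywhere; it is the limit wherever there is a finite one. *)
Definition flim (f_ : nat -> T -> R) x : R := fine (limn_esup (fun k => (f_ k x)%:E)).

Lemma flim_meas (f_ : nat -> T -> R) : (forall k, measurable_fun [set: T] (f_ k)) ->
  measurable_fun [set: T] (flim f_).
Proof.
move=> mf; apply: measurableT_comp => //.
by apply: measurable_fun_limn_esup => k; exact/measurable_EFinP.
Qed.

Lemma flimE (f_ : nat -> T -> R) x (l : R) : f_ k x @[k --> \oo] --> l -> flim f_ x = l.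
Proof.
move=> fl; rewrite /flim.
have cE : (fun k => (f_ k x)%:E) @ \oo --> l%:E by apply/cvg_EFin => //; exact: nearW.
by have [_ ->] := cvg_limn_einf_sup cE.
Qed.

Lemma flim_cvg (f_ : nat -> T -> R) x : cvgn (fun k => f_ k x) -> f_ k x @[k --> \oo] --> flim f_ x.
Proof. by move=> /cvg_ex[l fl]; rewrite (flimE fl). Qed.

Lemma L2_abs u : L2 n u -> L2 n (fun x => `|u x|).
Proof.
move=> Hu; have [| |//] := @L2_dominated (fun x => `|u x|) u _ Hu.
  by apply: measurableT_comp => //; exact: L2_meas.
by apply: aeW => x; rewrite normr_id.
Qed.

Lemma L2_pos u : L2 n u -> L2 n (fun x => Num.max (u x) 0).
Proof.
move=> Hu; have [| |//] := @L2_dominated (fun x => Num.max (u x) 0) u _ Hu.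
  by apply: measurable_maxr => //; exact: L2_meas.
apply: aeW => x; rewrite ger0_norm ?le_max ?lexx ?orbT//.
by rewrite ge_max ler_norm normr_ge0.
Qed.

Lemma reference_L2 g : reference_function n g -> L2 n g.
Proof.
move=> [g1 [M gM] g0]; have gi : n.-integrable [set: T] (EFin \o g) by apply/Lfun1_integrable.
have mg : measurable_fun [set: T] g by apply/measurable_EFinP; case/integrableP: gi.
apply/L2P => //; case/integrableP: gi => _ gi.
apply: (@le_lt_trans _ _ (\int[n]_x (M%:E * `|(g x)%:E|))%E).
  apply: ge0_le_integral => //.
  - by move=> x _; rewrite lee_fin sqr_ge0.
  - by apply/measurable_EFinP; exact: measurable_funX.
  - apply: emeasurable_funM => //; apply/measurable_EFinP; exact: measurableT_comp.
  - move=> x _; rewrite -[`|_|%E]/(`|g x|%:E) -EFinM lee_fin -[leLHS]ger0_norm ?sqr_ge0//.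
    by rewrite normrX expr2 ler_wpM2r.
rewrite ge0_integralZl//.
- by rewrite lte_mul_pinfty// ?lee_fin// (le_trans _ (gM point)).
- by apply/measurable_EFinP; exact: measurableT_comp.
- by rewrite lee_fin (le_trans _ (gM point)).
Qed.

(* [sum_k |f_(k+1) - f_k|] is finite almost everywhere because its integral
   against [g] is; this replaces Minkowski's inequality for series. *)
Lemma L2_fast_cauchy g (f_ : nat -> T -> R) : reference_function n g ->
  (forall k, L2 n (f_ k)) ->
  (forall k, ip n (f_ k.+1 \- f_ k) (f_ k.+1 \- f_ k) <= (4^-1) ^+ k) ->
  {ae n, forall x, cvgn (fun k => f_ k x)}.
Proof.
move=> gref Hf fast; have Hg := reference_L2 gref; have [g1 _ g0] := gref.
have HB k := L2B (Hf k.+1) (Hf k).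
pose F k x := (`|(f_ k.+1 \- f_ k) x| * `|g x|)%:E.
have mF k : measurable_fun [set: T] (F k).
  apply/measurable_EFinP; apply: measurable_funM; apply: measurableT_comp => //;
  exact: L2_meas.
have F0 k x : (0 <= F k x)%E by rewrite lee_fin mulr_ge0.
set c := Num.sqrt (ip n g g).
(* Cauchy-Schwarz against [g]: the rate [4^-k] of the squared norms becomes the summable rate
   [2^-k]. *)
have IF k : (\int[n]_x F k x <= (c / (2 ^ k)%:R)%:E)%E.
  rewrite -L2_ip_fin; [|exact: L2_abs|exact: L2_abs].
  rewrite lee_fin.
  have := cauchy_schwarz_sqrt L2_prehilbert (L2_abs (HB k)) (L2_abs Hg).
  move=> H; apply: le_trans H _; rewrite /quad /=.
  have E u : ip n (fun x => `|u x|) (fun x => `|u x|) = ip n u u.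
    by apply: eq_Rintegral => x _; rewrite -normrM ger0_norm// -expr2 sqr_ge0.
  rewrite !E mulrC ler_wpM2l ?sqrtr_ge0//.
  have p0 : 0 <= (2 ^ k)%:R^-1 :> R by rewrite invr_ge0.
  rewrite -[leRHS]ger0_norm// -sqrtr_sqr; apply: ler_wsqrtr.
  apply: le_trans (fast k) _.
  rewrite natrX -exprVn -exprM mulnC exprM.
  by rewrite (_ : 2^-1 ^+ 2 = 4^-1 :> R)//; field.
have SF : (\int[n]_x (\sum_(0 <= k <oo) F k x) < +oo)%E.
  rewrite integral_nneseries//.
  apply: (@le_lt_trans _ _ (\sum_(0 <= k <oo) (c / (2 ^ k)%:R)%:E)%E).
    by apply: lee_nneseries => // k _ _; exact: integral_ge0.
  have : eseries (fun k => (c / (2 ^ k)%:R)%:E) @ \oo --> (2 * c / 2 ^+ 0)%:E.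
    have := @cvg_geometric_eseries_half R (2 * c) 0.
    move=> H; rewrite (_ : (fun k => (c / (2 ^ k)%:R)%:E) =
      (fun k : nat => (2 * c / (2 ^ (k + 1))%:R)%:E))//.
    apply/funext => k; congr EFin.
    have k0 : (2 ^ k)%:R != 0 :> R by rewrite pnatr_eq0 expn_eq0.
    by rewrite addn1 expnS natrM; field.
  by move/cvg_lim => -> //; rewrite ltry.
have SI : n.-integrable [set: T] (fun x => \sum_(0 <= k <oo) F k x)%E.
  apply/integrableP; split; first exact: ge0_emeasurable_sum.
  by under eq_integral do rewrite gee0_abs ?nneseries_ge0//.
have := integrable_ae measurableT SI; apply: filterS2 g0 => x gx /(_ I) Sx.
have -> : (fun k => f_ k x) = (fun k => f_ 0%N x + series (telescope (fun k => f_ k x)) k).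
  by apply/funext => k; rewrite -eq_sum_telescope.
apply: is_cvgD; first exact: is_cvg_cst.
apply: normed_cvg.
suff : cvgn (fun N => \sum_(0 <= k < N) `|(f_ k.+1 \- f_ k) x|) by [].
apply: nondecreasing_is_cvgn.
  by apply/nondecreasing_seqP => k; rewrite big_nat_recr//= lerDl.
exists (fine (\sum_(0 <= k <oo) F k x)%E / g x) => _ [N _ <-].
rewrite ler_pdivlMr// -lee_fin fineK//.
apply: le_trans (nneseries_lim_ge N _) => //.
rewrite mulr_suml -sumEFin.
by apply: lee_sum => k _; rewrite /F lee_fin /= (gtr0_norm gx).
Qed.

(** A fast subsequence [h] converges a.e. Fatou's lemma for [f_ i - h j], with [i] fixed and [j]
    growing, then estimates the distance of the whole sequence to the limit. *)
Lemma L2_complete g (f_ : nat -> T -> R) : reference_function n g ->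
  (forall k, L2 n (f_ k)) -> form_cauchy (L2_form n) f_ ->
  exists2 f, L2 n f & ip n (f_ k \- f) (f_ k \- f) @[k --> \oo] --> (0 : R).
Proof.
move=> gref Hf Cf.
have q0 k : 0 < (4^-1 : R) ^+ k by rewrite exprn_gt0// invr_gt0.
have /choice[N NP] : forall k, exists N : nat, forall i j, (N <= i)%N -> (N <= j)%N ->
   ip n (f_ i \- f_ j) (f_ i \- f_ j) < (4^-1) ^+ k by move=> k; exact: Cf.
(* Running maxima make the indices nondecreasing while keeping [s k] beyond [N k]. *)
pose s := fix s k := if k is k'.+1 then maxn (s k') (N k) else N 0%N.
have sN k : (N k <= s k)%N by case: k => //= k; exact: leq_maxr.
have sS k : (s k <= s k.+1)%N by exact: leq_maxl.
have smono : {homo s : i j / (i <= j)%N} by apply: homo_leq => //; exact: leq_trans.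
pose h k := f_ (s k).
have hc : {ae n, forall x, cvgn (fun k => h k x)}.
  apply: (L2_fast_cauchy gref) => [k|k]; first exact: Hf.
  by apply/ltW/NP => //; apply: leq_trans (sS k).
have mh k : measurable_fun [set: T] (h k) by exact/L2_meas/Hf.
have mf := flim_meas mh; set f := flim h in mf.
have hf : {ae n, forall x, h k x @[k --> \oo] --> f x}.
  by apply: filterS hc => x; exact: flim_cvg.
have key k i : (N k <= i)%N -> L2 n (f_ i \- f) /\ ip n (f_ i \- f) (f_ i \- f) <= (4^-1) ^+ k.
  move=> ki; apply: (@L2_fatou (fun j => f_ i \- h (j + k)%N) _ (cst ((4^-1) ^+ k))).
  - by move=> j; apply: (@L2_meas (f_ i \- h (j + k)%N)); apply: L2B; exact: Hf.
  - by apply: measurable_funB => //; exact: L2_meas.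
  - apply: filterS hf => x hx /=; apply: cvgB; first exact: cvg_cst.
    by rewrite (cvg_shiftn k (fun j => h j x)).
  - move=> j; rewrite -(@L2_quad_fin (f_ i \- h (j + k)%N)); last by apply: L2B; exact: Hf.
    rewrite lee_fin; apply/ltW/NP => //; apply: leq_trans (sN k) _.
    by apply: smono; exact: leq_addl.
  - exact: cvg_cst.
have Hff : L2 n f.
  have [H _] := key 0%N _ (leqnn _); have := L2B (Hf (N 0%N)) H.
  by congr (L2 n _); apply/funext => x /=; ring.
exists f => //; apply/cvg0P => e e0.
have /cvg0P/(_ _ e0)[k kP] : (4^-1) ^+ k @[k --> \oo] --> (0 : R).
  by apply: cvg_expr; rewrite ger0_norm ?invr_ge0// invf_lt1// ltr1n.
exists (N k) => i /key[_ H]; rewrite ger0_norm ?ip_ge0//.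
apply: le_lt_trans H _; have := kP k (leqnn _).
by rewrite ger0_norm// ltW.
Qed.

End L2_theory.

(** * Closure of a closable form *)

Section closure_theory.
Context {R : realType} {d : measure_display} {T : measurableType d}.
Variable n : {measure set T -> \bar R}.
Variable c : real_form T R.
Hypotheses (hc : prehilbert c) (cL2 : dom c `<=` L2 n) (cclos : closable n c).
Implicit Types f g u v w : T -> R.

Let b := form_closure n c.

Lemma approximatingP (u_ : nat -> T -> R) u : L2 n u ->
  L2_approximating n c u_ u <-> [/\ forall k, dom c (u_ k), form_cauchy c u_ &
    quad (L2_form n) (u_ k \- u) @[k --> \oo] --> (0 : R)].
Proof.
move=> Hu; split=> -[H1 H2 H3]; split => //.
  by apply/L2cvgP => // k; exact/cL2/H1.
by apply/L2cvgP => // k; exact/cL2/H1.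
Qed.

Lemma approximating_lin (e : R) (u_ v_ : nat -> T -> R) u v :
  L2 n u -> L2 n v -> L2_approximating n c u_ u -> L2_approximating n c v_ v ->
  L2_approximating n c (fun k x => e * u_ k x + v_ k x) (fun x => e * u x + v x).
Proof.
move=> Hu Hv /(approximatingP _ Hu)[du cu Cu] /(approximatingP _ Hv)[dv cv Cv].
have Hd k : dom c (fun x => e * u_ k x + v_ k x) by exact: ph_dom_lin.
apply/approximatingP; first exact: L2_lin.
split => //.
  exact: (cauchyD hc (fun k => ph_domZ hc e (du k)) dv (cauchyZ hc e du cu) cv).
have hL := @L2_prehilbert _ _ _ n.
apply: (@squeeze0 _ _ (fun k => 2 * (e ^+ 2 * quad (L2_form n) (u_ k \- u)) +
                        2 * quad (L2_form n) (v_ k \- v))).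
  move=> k; have L2u : L2 n (u_ k \- u) by apply: L2B => //; exact: cL2.
  have L2v : L2 n (v_ k \- v) by apply: L2B => //; exact: cL2.
  rewrite ip_ge0/= -(quadZ hL)//.
  have := quadD_le hL (ph_domZ hL e L2u) L2v.
  by congr (quad _ _ <= _); apply/funext => x /=; ring.
rewrite (_ : 0 = 2 * (e ^+ 2 * 0) + 2 * 0); last by rewrite !mulr0 addr0.
by apply: cvgD; apply: cvg_cmul => //; exact: cvg_cmul.
Qed.

(** The difference is form-Cauchy and tends to 0 in L2, which is exactly the situation of
    closability. *)
Lemma approximating_diff (u_ u'_ : nat -> T -> R) u :
  L2 n u -> L2_approximating n c u_ u -> L2_approximating n c u'_ u ->
  quad c (u_ k \- u'_ k) @[k --> \oo] --> (0 : R).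
Proof.
move=> Hu Au Au'; have [dw cw Lw] := approximating_lin (-1) Hu Hu Au' Au.
have E : (fun k x => -1 * u'_ k x + u_ k x) = (fun k => u_ k \- u'_ k).
  by apply/funext => k; apply/funext => x /=; ring.
have E0 : (fun x => -1 * u x + u x) = cst 0 by apply/funext => x /=; ring.
rewrite E E0 in cw Lw; apply: cclos => // k; apply: ph_domB => //.
  by have [] := Au.
by have [] := Au'.
Qed.

(** Replacing either sequence by another one with the same L2 limit changes [c (u_ k) (v_ k)] by a
    null sequence: Cauchy-Schwarz with [approximating_diff] for one factor and bounded energy for
    the other. *)
Lemma closure_cvg (u_ v_ : nat -> T -> R) u v : L2 n u -> L2 n v ->
  L2_approximating n c u_ u -> L2_approximating n c v_ v ->
  c (u_ k) (v_ k) @[k --> \oo] --> b u v.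
Proof.
move=> Hu Hv Au Av; have [du cu _] := Au; have [dv cv _] := Av.
have [r Hr] := cauchy_form_cvg hc du dv cu cv.
suff <- : r = b u v by [].
(* The value chosen by [get] is a limit along some pair of sequences, unrelated to the given one. *)
have [u'_ [v'_ [Au' Av' H']]] : [set r : R | exists u_ v_ : nat -> T -> R,
     [/\ L2_approximating n c u_ u, L2_approximating n c v_ v &
         c (u_ k) (v_ k) @[k --> \oo] --> r]] (b u v).
  by apply: getPex; exists r, u_, v_.
have [du' cu' _] := Au'; have [dv' cv' _] := Av'.
have Du := approximating_diff Hu Au Au'.
have Dv := approximating_diff Hv Av Av'.
have [r1 Hr1] := cauchy_quad_cvg hc dv cv.
have [r2 Hr2] := cauchy_quad_cvg hc du' cu'.
have H1 : c (u_ k \- u'_ k) (v_ k) @[k --> \oo] --> (0 : R).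
  apply: sqr_cvg0; apply: (@squeeze0 _ _ (fun k => quad c (u_ k \- u'_ k) * quad c (v_ k)));
    last by rewrite -(mul0r r1); exact: cvgM.
  move=> k.
  rewrite sqr_ge0/=; apply: cauchy_schwarz => //; exact: ph_domB.
have H2 : c (u'_ k) (v_ k \- v'_ k) @[k --> \oo] --> (0 : R).
  apply: sqr_cvg0; apply: (@squeeze0 _ _ (fun k => quad c (u'_ k) * quad c (v_ k \- v'_ k)));
    last by rewrite -(mulr0 r2); exact: cvgM.
  move=> k.
  rewrite sqr_ge0/=; apply: cauchy_schwarz => //; exact: ph_domB.
have H : c (u_ k) (v_ k) @[k --> \oo] --> 0 + 0 + b u v.
  apply: cvg_ext (cvg_add (cvg_add H1 H2) H') => k /=.
  by rewrite phBl// phBr//; ring.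
by rewrite !add0r in H; rewrite (cvg_uniq Hr H).
Qed.

Lemma approximating_cst u : dom c u -> L2_approximating n c (fun=> u) u.
Proof.
move=> du; apply/approximatingP; first exact: cL2.
have E : u \- u = cst 0 by apply/funext => x /=; ring.
split => //; first by move=> e e0; exists 0%N => j k _ _; rewrite E quad0.
by rewrite E (quad0 (@L2_prehilbert _ _ _ n)); exact: cvg_cst.
Qed.

Lemma core_sub_closure u : dom c u -> dom b u.
Proof.
by move=> du; split; [exact: cL2|exists (fun=> u); exact: approximating_cst].
Qed.

Lemma closure_core u v : dom c u -> dom c v -> b u v = c u v.
Proof.
move=> du dv.
have H := closure_cvg (cL2 du) (cL2 dv) (approximating_cst du) (approximating_cst dv).
exact: (cvg_uniq H (cvg_cst _)).
Qed.

Lemma closure_prehilbert : prehilbert b.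
Proof.
split.
- by apply: core_sub_closure; exact: ph_dom0.
- move=> e u v [Hu [u_ Au]] [Hv [v_ Av]]; split; first exact: L2_lin.
  by eexists; exact: (approximating_lin e Hu Hv Au Av).
- move=> e u v w [Hu [u_ Au]] [Hv [v_ Av]] [Hw [w_ Aw]].
  have [du _ _] := Au; have [dv _ _] := Av; have [dw _ _] := Aw.
  have H := closure_cvg (L2_lin e Hu Hv) Hw (approximating_lin e Hu Hv Au Av) Aw.
  apply: (cvg_uniq H).
  have H' := cvg_add (cvg_cmul (c:=e) (closure_cvg Hu Hw Au Aw)) (closure_cvg Hv Hw Av Aw).
  by apply: cvg_ext H' => k /=; rewrite (ph_lin hc).
- move=> u v [Hu [u_ Au]] [Hv [v_ Av]].
  have [du _ _] := Au; have [dv _ _] := Av.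
  have H := closure_cvg Hu Hv Au Av.
  apply: (cvg_uniq H); apply: cvg_ext (closure_cvg Hv Hu Av Au) => k /=.
  exact: ph_sym.
- move=> u [Hu [u_ Au]]; have [du _ _] := Au.
  by apply: cvg_ge (closure_cvg Hu Hu Au Au) _ => k; exact: (ph_ge0 hc).
Qed.

Let hb := closure_prehilbert.

Lemma closure_approximating_ae (u_ : nat -> T -> R) u v : L2 n u ->
  measurable_fun [set: T] v -> {ae n, forall x, u x = v x} ->
  L2_approximating n c u_ u -> L2_approximating n c u_ v.
Proof.
move=> Hu mv uv /(approximatingP _ Hu)[du cu Lu].
have Hv := L2_ae Hu mv uv; apply/approximatingP => //; split => //.
apply: cvg_ext Lu => k; apply: ip_quad_ae; try by apply: L2B => //; exact: cL2.
by apply: filterS uv => x /= ->.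
Qed.

Lemma closure_dom_ae u v : dom b u ->
  measurable_fun [set: T] v -> {ae n, forall x, u x = v x} -> dom b v.
Proof.
move=> [Hu [u_ Au]] mv uv; split; first exact: L2_ae uv.
by exists u_; exact: closure_approximating_ae Au.
Qed.

Lemma closure_quad_ae u v : dom b u ->
  measurable_fun [set: T] v -> {ae n, forall x, u x = v x} -> quad b u = quad b v.
Proof.
move=> [Hu [u_ Au]] mv uv; have Hv := L2_ae Hu mv uv.
have Av := closure_approximating_ae Hu mv uv Au.
exact: (cvg_uniq (closure_cvg Hu Hu Au Au) (closure_cvg Hv Hv Av Av)).
Qed.

(** With [k] fixed, the Cauchy bound on [quad c (u_ k - u_ j)] passes to the limit in [j]; halving
    [e] restores the strict inequality. *)
Lemma approximating_form_cvg (u_ : nat -> T -> R) u : L2 n u ->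
  L2_approximating n c u_ u -> quad b (u_ k \- u) @[k --> \oo] --> (0 : R).
Proof.
move=> Hu Au; have [du cu _] := Au.
have Hb k : dom b (u_ k) by exact: core_sub_closure.
have ub : dom b u by split => //; exists u_.
apply/cvg0P => e e0; have [|N NP] := cu (e / 2); first by lra.
exists N => k kN; rewrite ger0_norm; last by apply: ph_ge0 => //; exact: ph_domB.
suff : quad b (u_ k \- u) <= e / 2 by move=> ?; lra.
have AB := approximating_lin (-1) Hu (cL2 (du k)) Au (approximating_cst (du k)).
have HB := L2_lin (-1) Hu (cL2 (du k)).
have := closure_cvg HB HB AB AB.
rewrite (_ : (fun x => _) = u_ k \- u); last by apply/funext => x /=; ring.
rewrite -(cvg_shiftn N) /= => H; apply: cvg_le H _ => j.
have := NP k (j + N)%N kN (leq_addl _ _); rewrite /quad => /ltW.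
by congr (_ <= _); congr (c _ _); apply/funext => x /=; ring.
Qed.

(** A diagonal argument: the L2 limit [u] exists, and core functions [w_ k] at distance [1/(k+1)]
    from [u_ k], in the form and in L2, are an approximating sequence of [u]. *)
Lemma closure_complete g (u_ : nat -> T -> R) : reference_function n g ->
  (forall k, dom b (u_ k)) -> form_cauchy b u_ -> form_cauchy (L2_form n) u_ ->
  exists u, [/\ dom b u, quad b (u_ k \- u) @[k --> \oo] --> (0 : R) &
    quad (L2_form n) (u_ k \- u) @[k --> \oo] --> (0 : R)].
Proof.
move=> gref du cu cL; have hL := @L2_prehilbert _ _ _ n.
have L2u k : L2 n (u_ k) by have [] := du k.
have [u Hu Lu] := L2_complete gref L2u cL.
have : forall k, exists w, [/\ dom c w, quad b (u_ k \- w) <= k.+1%:R^-1 &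
    quad (L2_form n) (u_ k \- w) <= k.+1%:R^-1].
  move=> k; have [_ [w_ Aw]] := du k; have [dw _ _] := Aw.
  have k0 : 0 < k.+1%:R^-1 :> R by rewrite invr_gt0.
  have /cvg0P/(_ _ k0)[N NP] := approximating_form_cvg (L2u k) Aw.
  have /(approximatingP _ (L2u k))[_ _ /cvg0P/(_ _ k0)[M MP]] := Aw.
  exists (w_ (maxn N M)); split => //.
  - rewrite (quad_sym hb (du k) (core_sub_closure (dw _))).
    by apply: ltW; apply: le_lt_trans (ler_norm _) (NP _ (leq_maxl _ _)).
  - rewrite (quad_sym hL (L2u k) (cL2 (dw _))).
    by apply: ltW; apply: le_lt_trans (ler_norm _) (MP _ (leq_maxr _ _)).
move=> /choice[w_ wP].
have dw k : dom c (w_ k) by have [] := wP k.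
have bw k : dom b (w_ k) by exact: core_sub_closure.
have inv0 := @cvg_invS R.
have Duw : quad b (u_ k \- w_ k) @[k --> \oo] --> (0 : R).
  apply: squeeze0 inv0 => k; have [_ -> _] := wP k; rewrite andbT.
  by apply: ph_ge0 => //; exact: ph_domB.
have DLw : quad (L2_form n) (u_ k \- w_ k) @[k --> \oo] --> (0 : R).
  by apply: squeeze0 inv0 => k; have [_ _ ->] := wP k; rewrite andbT ip_ge0.
have Aw : L2_approximating n c w_ u.
  apply/approximatingP => //; split => //.
  - have : form_cauchy b w_.
      have := cauchyD hb (fun k => ph_domZ hb (-1) (ph_domB hb (du k) (bw k))) du
        (cauchyZ hb (-1) (fun k => ph_domB hb (du k) (bw k))
           (quad_cvg0_cauchy hb (fun k => ph_domB hb (du k) (bw k)) Duw)) cu.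
      congr (form_cauchy b _); apply/funext => k; apply/funext => x /=; ring.
    move=> H e /H[N NP]; exists N => j k jN kN; have := NP j k jN kN.
    by rewrite /quad closure_core//; exact: ph_domB.
  - apply: (@squeeze0 _ _ (fun k => 2 * quad (L2_form n) (u_ k \- w_ k) +
                              2 * quad (L2_form n) (u_ k \- u))).
      move=> k; apply/andP; split; first exact: ip_ge0.
      rewrite (quad_sym hL (L2u k) (cL2 (dw k))).
      by apply: (quad_chain hL) => //=; exact/cL2/dw.
    rewrite (_ : 0 = 2 * 0 + 2 * 0); last by rewrite !mulr0 addr0.
    by apply: cvgD; exact: cvg_cmul.
have bu : dom b u by split => //; exists w_.
exists u; split => //.
apply: (@squeeze0 _ _ (fun k => 2 * quad b (u_ k \- w_ k) +
                              2 * quad b (w_ k \- u))).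
  move=> k; apply/andP; split; first by apply: ph_ge0 => //; exact: ph_domB.
  exact: quad_chain.
rewrite (_ : 0 = 2 * 0 + 2 * 0); last by rewrite !mulr0 addr0.
by apply: cvgD; apply: cvg_cmul => //; exact: approximating_form_cvg.
Qed.

(* Almost minimisers of [quad c] over the convex sets [C k] form a Cauchy
   sequence, which replaces weak compactness. *)
Lemma closure_lsc (v_ : nat -> T -> R) w (M_ : nat -> R) (M : R) :
  (forall k, dom c (v_ k)) -> L2 n w ->
  quad (L2_form n) (v_ k \- w) @[k --> \oo] --> (0 : R) ->
  (forall k, quad c (v_ k) <= M_ k) -> M_ @ \oo --> M ->
  dom b w /\ quad b w <= M.
Proof.
move=> dv Hw Lv vM MM; have hL := @L2_prehilbert _ _ _ n.
pose C k := [set v | dom c v /\ quad (L2_form n) (v \- w) <= k.+1%:R^-1].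
pose Q k := [set quad c v | v in C k].
have Q0 k : lbound (Q k) 0 by move=> _ [v [dv' _] <-]; exact: ph_ge0.
have Qlb k : has_lbound (Q k) by exists 0.
have vC k : exists N, forall j, (N <= j)%N -> C k (v_ j).
  have k0 : 0 < k.+1%:R^-1 :> R by rewrite invr_gt0.
  have /cvg0P/(_ _ k0)[N NP] := Lv; exists N => j jN; split => //.
  by apply: ltW; apply: le_lt_trans (ler_norm _) (NP _ jN).
have Qne k : has_inf (Q k).
  by have [N NP] := vC k; split => //; exists (quad c (v_ N)), (v_ N) => //; exact: NP.
pose D k := inf (Q k).
have DM k : D k <= M.
  have [N NP] := vC k; rewrite -(cvg_shiftn N) in MM.
  apply: cvg_ge MM _ => j /=; apply: le_trans (vM _).
  by apply: inf_lbound => //; exists (v_ (j + N)%N) => //; exact/NP/leq_addl.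
have Dmono j k : (j <= k)%N -> D j <= D k.
  move=> jk; apply: lb_le_inf; first by case: (Qne k).
  move=> _ [v [dv' vC'] <-]; apply: inf_lbound => //; exists v => //; split => //.
  by apply: le_trans vC' _; rewrite lef_pV2 ?posrE// ler_nat.
have : forall k, exists v, C k v /\ quad c v < D k + k.+1%:R^-1.
  move=> k; have k0 : 0 < k.+1%:R^-1 :> R by rewrite invr_gt0.
  by have [_ [v Cv <-] H] := inf_adherent k0 (Qne k); exists v.
move=> /choice[w_ wP].
have dw k : dom c (w_ k) by have [[]] := wP k.
have cD : cvgn D.
  apply: nondecreasing_is_cvgn; first by move=> j k; exact: Dmono.
  by exists M => _ [k _ <-].
have inv0 := @cvg_invS R.
(* The midpoint of [w_ j] and [w_ k] lies in the convex set [C N], so its energy is at least [D N];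
   the parallelogram identity turns this into a bound on the difference. *)
have mid N j k : (N <= j)%N -> (N <= k)%N ->
    quad c (w_ j \- w_ k) <= 2 * (D j + j.+1%:R^-1) + 2 * (D k + k.+1%:R^-1) - 4 * D N.
  move=> jN kN.
  have Lj : quad (L2_form n) (w_ j \- w) <= N.+1%:R^-1.
    have [[_ H] _] := wP j; apply: le_trans H _.
    by rewrite lef_pV2 ?posrE// ler_nat.
  have Lk : quad (L2_form n) (w_ k \- w) <= N.+1%:R^-1.
    have [[_ H] _] := wP k; apply: le_trans H _.
    by rewrite lef_pV2 ?posrE// ler_nat.
  have L2j : L2 n (w_ j \- w) by apply: L2B => //; exact: cL2.
  have L2k : L2 n (w_ k \- w) by apply: L2B => //; exact: cL2.
  have dD := ph_domD hc (dw j) (dw k).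
  have : D N <= quad c (fun x => 2^-1 * (w_ j \+ w_ k) x).
    apply: inf_lbound => //; exists (fun x => 2^-1 * (w_ j \+ w_ k) x) => //.
    split; first exact: ph_domZ.
    have -> : (fun x => 2^-1 * (w_ j \+ w_ k) x) \- w =
        (fun x => 2^-1 * ((w_ j \- w) \+ (w_ k \- w)) x).
      by apply/funext => x /=; field.
    rewrite (quadZ hL); last exact: L2D.
    have := quadD_le hL L2j L2k; set X := quad _ _ => HX.
    have -> : 2^-1 ^+ 2 = 4^-1 :> R by field.
    by move: Lj Lk HX; set y := N.+1%:R^-1 => *; lra.
  rewrite (quadZ hc)//; have -> : 2^-1 ^+ 2 = 4^-1 :> R by field.
  have := parallelogram hc (dw j) (dw k).
  have [_ Hj] := wP j; have [_ Hk] := wP k.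
  by move: Hj Hk; set y := j.+1%:R^-1; set z := k.+1%:R^-1 => *; lra.
have cw : form_cauchy c w_.
  (* In [mid], both [4 (l - D N)] and the two reciprocals taken twice stay below [e / 4]. *)
  move=> e e0; have e8 : 0 < e / 16 by lra.
  move/cvg_ex: cD => [l Dl].
  have Dle k : D k <= l.
    rewrite -(cvg_shiftn k) in Dl; apply: cvg_ge Dl _ => j /=.
    by apply: Dmono; exact: leq_addl.
  have /cvg0P/(_ _ e8)[N1 N1P] := cvg_dist0 Dl.
  have /cvg0P/(_ _ e8)[N2 N2P] := inv0.
  pose N := maxn N1 N2; exists N => j k jN kN; apply: le_lt_trans (mid N _ _ jN kN) _.
  have := N1P N (leq_maxl _ _); rewrite ltr_norml => /andP[HD _].
  have := N2P j (leq_trans (leq_maxr _ _) jN); rewrite ltr_norml => /andP[_ Hj].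
  have := N2P k (leq_trans (leq_maxr _ _) kN); rewrite ltr_norml => /andP[_ Hk].
  have := Dle j; have := Dle k; move: Hj Hk HD => /=.
  by set y := j.+1%:R^-1; set z := k.+1%:R^-1 => *; lra.
have Aw : L2_approximating n c w_ w.
  apply/approximatingP => //; split => //.
  by apply: squeeze0 inv0 => k; rewrite ip_ge0/=; have [[]] := wP k.
split; first by split => //; exists w_.
have H := closure_cvg Hw Hw Aw Aw.
have H2 : M + -1 * c (w_ k) (w_ k) + k.+1%:R^-1 @[k --> \oo] --> M + -1 * b w w + 0.
  by apply: cvg_add inv0; apply: cvg_add; [exact: cvg_cst|exact: cvg_cmul].
suff : 0 <= M + -1 * b w w + 0 by rewrite /quad => ?; lra.
apply: cvg_ge H2 _ => k.
by have [_] := wP k; have := DM k; rewrite /quad; set y := k.+1%:R^-1 => *; lra.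
Qed.

(** The sequence [|u_ k|] is not known to be form-Cauchy; only its L2 convergence and the bound on
    its energies are at hand, hence semicontinuity. *)
Lemma closure_abs u :
  (forall v, dom c v -> dom c (fun x => `|v x|) /\ quad c (fun x => `|v x|) <= quad c v) ->
  dom b u -> dom b (fun x => `|u x|) /\ quad b (fun x => `|u x|) <= quad b u.
Proof.
move=> cabs [Hu [u_ Au]]; have [du _ _] := Au.
have /(approximatingP _ Hu)[_ _ Lu] := Au.
apply: (@closure_lsc (fun k x => `|u_ k x|) _ (fun k => quad c (u_ k))).
- by move=> k; have [] := cabs _ (du k).
- exact: L2_abs.
- apply: squeeze0 Lu => k; rewrite ip_ge0/=.
  have L2u : L2 n (u_ k) by exact: cL2.
  have [| | |//] := @L2_dominated _ _ _ n ((fun x => `|u_ k x|) \- (fun x => `|u x|)) (u_ k \- u).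
  + by apply: (@L2_meas _ _ _ n); apply: L2B; apply: L2_abs.
  + exact: L2B.
  + by apply: aeW => x /=; exact: ler_dist_dist.
- by move=> k; have [] := cabs _ (du k).
- exact: closure_cvg.
Qed.

End closure_theory.

(** * Resolvents *)

(** The interface through which the closed form is used below. The absolute value takes the place of
    the unit contraction of a Dirichlet form. *)
Record positivity_preserving_form (d : measure_display) (T : measurableType d)
    (R : realType) (n : {measure set T -> \bar R}) (b : real_form T R) : Prop :=
  PositivityPreservingForm {
  ppf_prehilbert :> prehilbert b ;
  ppf_L2 : dom b `<=` L2 n ;
  ppf_dom_ae : forall u v, dom b u -> measurable_fun [set: T] v ->
    {ae n, forall x, u x = v x} -> dom b v ;
  ppf_quad_ae : forall u v, dom b u -> measurable_fun [set: T] v ->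
    {ae n, forall x, u x = v x} -> quad b u = quad b v ;
  ppf_complete : forall u_ : nat -> T -> R, (forall k, dom b (u_ k)) ->
    form_cauchy b u_ -> form_cauchy (L2_form n) u_ ->
    exists u, [/\ dom b u, quad b (u_ k \- u) @[k --> \oo] --> (0 : R) &
      quad (L2_form n) (u_ k \- u) @[k --> \oo] --> (0 : R)] ;
  ppf_abs : forall u, dom b u -> dom b (fun x => `|u x|) /\
    quad b (fun x => `|u x|) <= quad b u ;
  ppf_dense : forall f, L2 n f -> forall e : R, 0 < e ->
    exists2 v, dom b v & ip n (v \- f) (v \- f) < e }.

Definition pos_part (T : Type) (R : realType) (u : T -> R) x : R := Num.max (u x) 0.

(** The weak form of [(alpha - A) u = g], so that [u] is a version of [G_alpha g]; a relation is
    used because [u] is determined only a.e. *)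
Definition resolvent_at (d : measure_display) (T : measurableType d)
    (R : realType) (n : {measure set T -> \bar R}) (b : real_form T R)
    (alpha : R) (g u : T -> R) :=
  dom b u /\ forall v, dom b v -> b u v + alpha * ip n u v = ip n g v.

Section resolvent.
Context {R : realType} {d : measure_display} {T : measurableType d}.
Variables (n : {measure set T -> \bar R}) (b : real_form T R).
Hypothesis hb : positivity_preserving_form n b.
Implicit Types f g u v w : T -> R.

Let ph := ppf_prehilbert hb.
Let bL := ppf_L2 hb.

Lemma pos_partE u : pos_part u = (fun x => 2^-1 * (u x + `|u x|)).
Proof.
by apply/funext => x; rewrite /pos_part; case: (leP (u x) 0) => ux;
  [rewrite ler0_norm// subrr mulr0|rewrite gtr0_norm//; field].
Qed.

Lemma pos_part_ge0 u x : 0 <= pos_part u x.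
Proof. by rewrite /pos_part le_max lexx orbT. Qed.

Lemma dom_pos u : dom b u -> dom b (pos_part u).
Proof.
move=> du; have [da _] := ppf_abs hb du.
by rewrite pos_partE; exact: (ph_domZ ph 2^-1 (ph_domD ph du da)).
Qed.

Lemma dom_opp u : dom b u -> dom b (fun x => - u x).
Proof.
move=> du; have := ph_domZ ph (-1) du.
by congr (dom b _); apply/funext => x; rewrite mulN1r.
Qed.

Lemma form_opp u v : dom b u -> dom b v -> b (fun x => - u x) v = - b u v.
Proof.
move=> du dv; have := phZl ph (-1) du dv; rewrite mulN1r => <-.
by congr (b _ _); apply/funext => x; rewrite mulN1r.
Qed.

Lemma pos_negE u : u = pos_part u \- pos_part (fun x => - u x).
Proof. by apply/funext => x; rewrite !pos_partE/= normrN; field. Qed.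

(** [|u|] and [u] are the sum and the difference of the positive and negative parts, so
    [quad b |u| <= quad b u] is precisely the sign of the cross term. *)
Lemma pos_neg_le0 u : dom b u -> b (pos_part u) (pos_part (fun x => - u x)) <= 0.
Proof.
move=> du; have dp := dom_pos du; have dm := dom_pos (dom_opp du).
have [da qa] := ppf_abs hb du.
have absE : (fun x => `|u x|) = pos_part u \+ pos_part (fun x => - u x).
  by apply/funext => x; rewrite !pos_partE/= normrN; field.
move: qa; rewrite absE [in X in _ <= X](pos_negE u) (quadD ph)// (quadB ph)// => H.
by lra.
Qed.

Lemma form_pos_ge u : dom b u -> quad b (pos_part u) <= b u (pos_part u).
Proof.
move=> du; have dp := dom_pos du; have dm := dom_pos (dom_opp du).
rewrite [in X in _ <= X](pos_negE u).
have -> : pos_part (pos_part u \- pos_part (fun x => - u x)) = pos_part u.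
  by rewrite -pos_negE.
rewrite (phBl ph)// (ph_sym ph dm dp) /quad.
by have := pos_neg_le0 du => H; lra.
Qed.

Lemma ip_pos u : ip n u (pos_part u) = ip n (pos_part u) (pos_part u).
Proof.
apply: eq_Rintegral => x _; rewrite /pos_part; case: (leP (u x) 0) => //.
by rewrite !mulr0.
Qed.

Lemma pos_part_ip0 u : L2 n u -> ip n (pos_part u) (pos_part u) <= 0 ->
  {ae n, forall x, u x <= 0}.
Proof.
move=> Hu H; have Hp : L2 n (pos_part u) by exact: L2_pos.
have /(ip_eq0_ae Hp) : ip n (pos_part u) (pos_part u) = 0.
  by apply/eqP; rewrite eq_le H ip_ge0.
apply: filterS => x; rewrite /pos_part => /eqP.
by rewrite eq_le ge_max => /andP[/andP[]].
Qed.

(** Weak maximum principle: by [form_pos_ge], testing [w] against its own positive part bounds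
    [alpha] times the squared norm of that part by 0. *)
Lemma form_le0 (alpha : R) w : 0 < alpha -> dom b w ->
  b w (pos_part w) + alpha * ip n w (pos_part w) <= 0 -> {ae n, forall x, w x <= 0}.
Proof.
move=> a0 dw H; apply: pos_part_ip0; first exact: bL.
have := ph_ge0 ph (dom_pos dw); have := form_pos_ge dw; rewrite ip_pos in H.
move=> H1 H2; suff : alpha * ip n (pos_part w) (pos_part w) <= 0.
  by rewrite pmulr_rle0.
by lra.
Qed.

(** The direct method: [u] minimises the functional [J], whose first variation is the resolvent
    equation. *)
Lemma resolvent_exists (alpha : R) g : 0 < alpha -> L2 n g ->
  exists u, resolvent_at n b alpha g u.
Proof.
move=> a0 Hg; have hL := @L2_prehilbert _ _ _ n.
pose q u := quad b u + alpha * ip n u u.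
pose J u := q u - 2 * ip n g u.
pose V := [set J u | u in dom b].
(* Completing the square: [alpha^-1] times the squared norm of [alpha u - g]. *)
have Jlb u : dom b u -> - (alpha^-1 * ip n g g) <= J u.
  move=> du; have qu := ph_ge0 ph du.
  have := ip_ge0 n ((fun x => alpha * u x) \- g).
  rewrite (ip_quadB (L2Z alpha (bL du)) Hg) (ip_quadZ _ (bL du)) (ipZl _ (bL du) Hg).
  rewrite (ip_sym n u g) => H.
  have : 0 <= alpha^-1 * (alpha ^+ 2 * ip n u u - 2 * (alpha * ip n g u) + ip n g g).
    by rewrite mulr_ge0// invr_ge0 ltW.
  have -> : alpha^-1 * (alpha ^+ 2 * ip n u u - 2 * (alpha * ip n g u) + ip n g g) =
      alpha * ip n u u - 2 * ip n g u + alpha^-1 * ip n g g.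
    by field; rewrite gt_eqF.
  by rewrite /J /q => ?; lra.
have Vinf : has_inf V.
  split; first by exists (J (cst 0)), (cst 0) => //; exact: ph_dom0.
  by exists (- (alpha^-1 * ip n g g)) => _ [u du <-]; exact: Jlb.
pose I := inf V.
have IJ u : dom b u -> I <= J u.
  by move=> du; apply: inf_lbound; [case: Vinf|exists u].
have : forall k, exists u, dom b u /\ J u < I + k.+1%:R^-1.
  move=> k; have k0 : 0 < k.+1%:R^-1 :> R by rewrite invr_gt0.
  by have [_ [u du <-] H] := inf_adherent k0 Vinf; exists u.
move=> /choice[u_ uP].
have du k : dom b (u_ k) by have [] := uP k.
have Lu k : L2 n (u_ k) by exact: bL.
(* The midpoint has [J] at least [I]. The linear terms cancel in the parallelogram identity, which
   leaves the excesses of [J] over [I]. *)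
have qC j k : q (u_ j \- u_ k) <= 2 * j.+1%:R^-1 + 2 * k.+1%:R^-1.
  have dD := ph_domD ph (du j) (du k).
  have := IJ _ (ph_domZ ph 2^-1 dD).
  have LD := L2D (Lu j) (Lu k).
  rewrite /J /q (quadZ ph)// ip_quadZ// ipZr// [ip n g (_ \+ _)]ipDr//.
  have -> : 2^-1 ^+ 2 = 4^-1 :> R by field.
  have := parallelogram ph (du j) (du k).
  have := parallelogram hL (Lu j) (Lu k); rewrite /quad/= => P1 P2.
  have [_] := uP j; have [_] := uP k; rewrite /J /q.
  move: P1 P2; rewrite /quad.
  set y := j.+1%:R^-1; set z := k.+1%:R^-1.
  set A := ip _ _ _; set B := ip _ _ _; set C := ip _ _ _; set D := ip _ (u_ k) _.
  move=> P1 P2 ? ? ?; have -> : A = 2 * C + 2 * D - B by lra.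
  by lra.
have qsmall e : 0 < e -> exists N, forall j k, (N <= j)%N -> (N <= k)%N ->
    q (u_ j \- u_ k) < e.
  move=> e0; have e8 : 0 < e / 8 by lra.
  have /cvg0P/(_ _ e8)[N NP] := @cvg_invS R; exists N => j k /NP Hj /NP Hk.
  apply: le_lt_trans (qC j k) _; move: Hj Hk; rewrite !ltr_norml.
  set y := j.+1%:R^-1; set z := k.+1%:R^-1 => /andP[_ ?] /andP[_ ?]; lra.
have cb : form_cauchy b u_.
  move=> e /qsmall[N NP]; exists N => j k jN kN; apply: le_lt_trans (NP _ _ jN kN).
  by rewrite /q lerDl mulr_ge0 ?ip_ge0// ltW.
have cL : form_cauchy (L2_form n) u_.
  move=> e e0; have [|N NP] := qsmall (alpha * e); first exact: mulr_gt0.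
  exists N => j k jN kN; have := NP _ _ jN kN; rewrite /q => H.
  have := ph_ge0 ph (ph_domB ph (du j) (du k)) => H'.
  by rewrite -(ltr_pM2l a0); apply: le_lt_trans H; rewrite lerDr.
have [u [bu Cb CL]] := ppf_complete hb du cb cL.
have Hu : L2 n u by exact: bL.
have Ju : J u <= I.
  have H1 := quad_cvg ph du bu Cb.
  have H2 := quad_cvg hL Lu Hu CL.
  have H3 := form_cvgl hL Lu Hu Hg CL.
  have H : J (u_ k) - k.+1%:R^-1 @[k --> \oo] --> J u.
    have -> : J u = quad b u + alpha * ip n u u + (-2) * ip n u g + (-1) * 0.
      by rewrite /J /q (ip_sym n g u); ring.
    apply: cvg_ext (cvg_add (cvg_add (cvg_add H1 (cvg_cmul (c:=alpha) H2))
      (cvg_cmul (c:=-2) H3)) (cvg_cmul (c:=-1) (@cvg_invS R))) => k.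
    by rewrite /J /q (ip_sym n g) /quad /=; ring.
  by apply: cvg_le H _ => k; have [_] := uP k; set y := k.+1%:R^-1 => ?; lra.
exists u; split => // v dv; have Lv : L2 n v by exact: bL.
set B := b u v + alpha * ip n u v - ip n g v.
suff : B = 0 by rewrite /B => ?; lra.
pose A := q v.
have A0 : 0 <= A by rewrite addr_ge0 ?ph_ge0// mulr_ge0 ?ip_ge0// ltW.
have var t : 0 <= t ^+ 2 * A + 2 * t * B.
  have dtv := ph_domZ ph t dv; have Ltv := L2Z t Lv.
  have := IJ _ (ph_domD ph bu dtv).
  rewrite /J /q (quadD ph)// ip_quadD// (quadZ ph)// ip_quadZ// (phZr ph)// ipDr//.
  rewrite !ipZr// => H.
  by move: Ju; rewrite /J /q /A /B /q => ?; lra.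
have A1 : A + 1 != 0 by rewrite gt_eqF// ltr_wpDl.
(* The minimising [t] would be [-B / A]; the denominator [A + 1] covers the case [A = 0] and still
   gives a negative value unless [B = 0]. *)
have := var (- B / (A + 1)).
have -> : (- B / (A + 1)) ^+ 2 * A + 2 * (- B / (A + 1)) * B =
    - (B ^+ 2 * ((A + 2) / (A + 1) ^+ 2)) by field.
have c0 : 0 < (A + 2) / (A + 1) ^+ 2.
  by rewrite divr_gt0// ?exprn_gt0//; lra.
rewrite oppr_ge0 pmulr_lle0// => H; apply/eqP; rewrite -sqrf_eq0.
by rewrite eq_le H sqr_ge0.
Qed.

(** By the equation for [w], the right side exceeds the left by [quad b (v - w)] plus [alpha] times
    the squared norm of [v - w]. *)
Lemma resolvent_minimizes (alpha : R) g w v : 0 <= alpha -> L2 n g ->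
  resolvent_at n b alpha (fun x => alpha * g x) w -> dom b v ->
  quad b w + alpha * ip n (w \- g) (w \- g) <= quad b v + alpha * ip n (v \- g) (v \- g).
Proof.
move=> a0 Hg [dw Hw] dv; have Lw := bL dw; have Lv := bL dv.
have := Hw _ dv; have := Hw _ dw; have := ph_ge0 ph (ph_domB ph dv dw).
have : 0 <= alpha * ip n (v \- w) (v \- w) by rewrite mulr_ge0 ?ip_ge0.
rewrite (quadB ph)// !ip_quadB// !ipZl// (ph_sym ph dw dv) (ip_sym n g v) (ip_sym n g w).
rewrite (ip_sym n v w) /quad.
by move=> *; nra.
Qed.

Lemma resolvent_ge0 (alpha : R) g u : 0 < alpha -> L2 n g ->
  {ae n, forall x, 0 <= g x} -> resolvent_at n b alpha g u ->
  {ae n, forall x, 0 <= u x}.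
Proof.
move=> a0 Hg g0 [du Hu]; have dn := dom_opp du; have dp := dom_pos dn.
suff : {ae n, forall x, - u x <= 0} by apply: filterS => x; rewrite oppr_le0.
apply: (form_le0 a0 dn); rewrite form_opp//.
have -> : ip n (fun x => - u x) (pos_part (fun x => - u x)) =
    - ip n u (pos_part (fun x => - u x)).
  rewrite -[RHS]mulN1r -ipZl; [|exact: bL|exact: bL].
  by apply: eq_Rintegral => x _; rewrite mulN1r.
have := Hu _ dp; have : 0 <= ip n g (pos_part (fun x => - u x)).
  apply: ip_ge0_ae => //; first exact: bL.
  by apply: aeW => x; exact: pos_part_ge0.
by move=> *; lra.
Qed.

(** [v - u] solves the equation at [alpha] with right-hand side [-(beta - alpha) v], which is
    nonpositive, and the maximum principle applies. *)
Lemma resolvent_antimono (alpha beta : R) g u v : 0 < alpha -> alpha <= beta ->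
  L2 n g -> {ae n, forall x, 0 <= g x} ->
  resolvent_at n b alpha g u -> resolvent_at n b beta g v ->
  {ae n, forall x, v x <= u x}.
Proof.
move=> a0 ab Hg g0 Ru Rv; have v0 := resolvent_ge0 (lt_le_trans a0 ab) Hg g0 Rv.
have [du Hu] := Ru; have [dv Hv] := Rv; have dB := ph_domB ph dv du.
have dp := dom_pos dB.
suff : {ae n, forall x, (v \- u) x <= 0}.
  by apply: filterS => x /=; rewrite subr_le0.
apply: (form_le0 a0 dB); rewrite (phBl ph)// ipBl; try exact: bL.
have : 0 <= ip n v (pos_part (v \- u)).
  apply: ip_ge0_ae => //; try exact: bL.
  by apply: aeW => x; exact: pos_part_ge0.
by have := Hu _ dp; have := Hv _ dp; move=> *; nra.
Qed.

(** [N G_N f] tends to [f]: minimality is tested against a [v] of the domain close to [f], whose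
    energy becomes negligible after division by [N]. *)
Lemma resolvent_dense f (e : R) : L2 n f -> 0 < e ->
  exists N w, [/\ 1 <= N, resolvent_at n b N (fun x => N * f x) w &
    ip n (w \- f) (w \- f) < e].
Proof.
move=> Hf e0; have [|v dv Hv] := ppf_dense hb Hf (e:=e / 2); first by lra.
(* Chosen so that [quad b v < N * (e / 2)]; the summand 1 gives [1 <= N], which comparison with the
   resolvent at 1 requires later. *)
pose N := 4 * quad b v / e + 1; have qv := ph_ge0 ph dv.
have N1 : 1 <= N by rewrite lerDr divr_ge0 ?mulr_ge0// ltW.
have N0 : 0 < N by exact: lt_le_trans N1.
have [w Rw] := resolvent_exists N0 (L2Z N Hf).
have Hmin := resolvent_minimizes (ltW N0) Hf Rw dv.
have [dw _] := Rw; exists N, w; split => //.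
have qw := ph_ge0 ph dw; have eN : quad b v < N * (e / 2).
  have -> : N * (e / 2) = 2 * quad b v + e / 2 by rewrite /N; field; rewrite gt_eqF.
  by lra.
rewrite -(ltr_pM2l N0).
have : N * ip n (v \- f) (v \- f) < N * (e / 2) by rewrite ltr_pM2l.
by move=> *; lra.
Qed.

(** For [w = N G_N f] the resolvent equation reads [A w = N (w - f)]. *)
Lemma operator_domain_dense f (e : R) : L2 n f -> 0 < e ->
  exists w h, [/\ dom b w, L2 n h, forall v, dom b v -> b w v = - ip n h v &
    ip n (w \- f) (w \- f) < e].
Proof.
move=> Hf e0; have [N [w [_ [dw Hw] He]]] := resolvent_dense Hf e0.
have Lw := bL dw; exists w, (fun x => N * (w \- f) x); split => //.
  by apply: L2Z; exact: L2B.
move=> v dv; have := Hw _ dv; have Lv := bL dv.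
by rewrite !ipZl ?ipBl//; [move=> ?; lra|exact: L2B].
Qed.

End resolvent.

(** * Evolutions driven by a form *)

(* Explicit Euler scheme: steps of size [t / N] with local error [o(t / N)]. *)
Lemma euler_bound (R : realType) (F : R -> R) (C : R) :
  (forall e, 0 < e -> exists2 delta, 0 < delta & forall s t, 0 <= t ->
     0 < s < delta -> F (t + s) <= F t + s * (C + e)) ->
  forall t, 0 < t -> F t <= F 0 + t * C.
Proof.
move=> H t t0; apply/ler_addgt0Pr => e e0.
have et : 0 < e / t by rewrite divr_gt0.
have [delta d0 Hd] := H _ et.
pose N := (Num.truncn (t / delta)).+1; have N0 : (0 : R) < N%:R by rewrite ltr0n.
pose s := t / N%:R.
have s0 : 0 < s < delta.
  rewrite divr_gt0//= /s ltr_pdivrMr// mulrC -ltr_pdivrMr//.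
  exact: truncnS_gt.
have step k : F (k%:R * s) <= F 0 + k%:R * s * (C + e / t).
  elim: k => [|k IH]; first by rewrite !mul0r addr0.
  have -> : k.+1%:R * s = k%:R * s + s by rewrite -natr1 mulrDl mul1r.
  apply: le_trans (Hd _ _ _ s0) _; first by rewrite mulr_ge0// ltW//; case/andP: s0.
  by rewrite mulrDl addrA lerD2r.
have := step N; have -> : N%:R * s = t by rewrite /s mulrCA divff ?mulr1// gt_eqF.
have -> : t * (C + e / t) = t * C + e by field; rewrite gt_eqF.
by rewrite addrA.
Qed.

Section evolution.
Context {R : realType} {d : measure_display} {T : measurableType d}.
Variables (n : {measure set T -> \bar R}) (b : real_form T R).
Hypothesis hb : positivity_preserving_form n b.
Implicit Types f g h u v w : T -> R.

Let ph := ppf_prehilbert hb.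
Let bL := ppf_L2 hb.

(** A solution of [dz/dt = (A - alpha) z] with derivative [z']. In [evo_step] the remainder is small
    compared with [s] in L2, uniformly in [t], as the Euler scheme demands. *)
Record evolution (alpha : R) (z z' : R -> T -> R) : Prop := Evolution {
  evo_dom : forall t, 0 <= t -> dom b (z t) ;
  evo_L2 : forall t, 0 <= t -> L2 n (z' t) ;
  evo_eq : forall t, 0 <= t -> forall v, dom b v ->
    b (z t) v + alpha * ip n (z t) v = - ip n (z' t) v ;
  evo_bound : exists M : R, forall t, 0 <= t ->
    ip n (z t) (z t) <= M /\ ip n (z' t) (z' t) <= M ;
  evo_step : forall e, 0 < e -> exists2 delta, 0 < delta &
    forall s t, 0 <= t -> 0 < s < delta ->
    exists2 r : T -> R, L2 n r /\ ip n r r <= e * s ^+ 2 &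
      {ae n, forall x, z (t + s) x = z t x + (s * z' t x + r x)} }.

(* [phi] is one of [x |-> x] and [x |-> max x 0]: [phi ^ 2 / 2] is convex with
   derivative [phi] and second derivative at most [1]. *)
Lemma evolution_bound (alpha C : R) (z z' : R -> T -> R) v (phi : R -> R) :
  evolution alpha z z' -> dom b v -> 0 <= C ->
  (forall x y, phi y ^+ 2 <= phi x ^+ 2 + 2 * phi x * (y - x) + (y - x) ^+ 2) ->
  (forall u, dom b u -> dom b (phi \o u)) ->
  (forall u, L2 n u -> ip n (phi \o u) (phi \o u) <= ip n u u) ->
  (forall u, L2 n u -> L2 n (phi \o u)) ->
  (forall t, 0 <= t -> - 2 * (b (z t) (phi \o (z t \- v)) +
     alpha * ip n (z t) (phi \o (z t \- v))) <= C) ->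
  forall t, 0 < t -> ip n (phi \o (z t \- v)) (phi \o (z t \- v)) <=
    ip n (phi \o (z 0 \- v)) (phi \o (z 0 \- v)) + t * C.
Proof.
move=> [zd zL zE [M zM] zs] dv C0 phi2 phid phiL phi_L HC.
apply: euler_bound => e e0; have Lv := bL dv.
have M0 : 0 <= M by have [H _] := zM 0 (lexx _); exact: le_trans (ip_ge0 _ _) H.
(* [K] bounds the squared norm of [phi (z t - v)], and [L], defined below, that of the increment
   divided by [s]. With [theta] bounding the norm of [r / s], the remainder and the second-order
   term each cost at most [s * (e / 2)]. *)
pose K := 2 * M + 2 * ip n v v; have K0 : 0 <= K.
  by rewrite addr_ge0// mulr_ge0// ip_ge0.
pose theta := e / (2 * (K + 1)); have th0 : 0 < theta.
  by rewrite divr_gt0// mulr_gt0// ltr_wpDl.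
have [|delta d0 Hd] := zs (theta ^+ 2); first by rewrite exprn_gt0.
pose L := 2 * M + 2 * theta ^+ 2 + 1.
have L0 : 0 < L by rewrite ltr_wpDl// addr_ge0// mulr_ge0// sqr_ge0.
exists (Num.min delta (e / (2 * L))).
  by rewrite lt_min d0 divr_gt0// mulr_gt0.
move=> s t t0 /andP[s0]; rewrite lt_min => /andP[sd se].
have [|r [Lr rs] zr] := Hd s t t0; first by rewrite s0.
set x := z t \- v; set y := z (t + s) \- v.
have ts0 : 0 <= t + s by rewrite addr_ge0// ltW.
have Lx : L2 n x by apply: L2B => //; exact/bL/zd.
have Ly : L2 n y by apply: L2B => //; exact/bL/zd.
have Lp := phi_L _ Lx; have Lp' := phi_L _ Ly.
have Lz' := zL _ t0.
pose D := (fun a => s * z' t a) \+ r.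
have LD : L2 n D by apply: L2D => //; exact: L2Z.
have yx : {ae n, forall a, y a - x a = D a}.
  by apply: filterS zr => a za; rewrite /y /x /D /= za; ring.
have H1 : ip n (phi \o y) (phi \o y) <= ip n (phi \o x) (phi \o x) +
    2 * ip n (phi \o x) D + ip n D D.
  rewrite -(ip_quadD Lp LD).
  have [| | |//] := @L2_dominated _ _ _ n (phi \o y) (phi \o x \+ D).
  - exact: L2_meas Lp'.
  - exact: L2D.
  - apply: filterS yx => a yxa; rewrite -!sqrtr_sqr; apply: ler_wsqrtr.
    apply: le_trans (phi2 (x a) (y a)) _.
    rewrite -[(phi \o x \+ D) a]/(phi (x a) + D a) yxa.
    have sq (p q : R) : p ^+ 2 + 2 * p * q + q ^+ 2 = (p + q) ^+ 2 by ring.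
    by rewrite sq.
have H2 : 2 * ip n (phi \o x) D <= s * C + 2 * ip n (phi \o x) r.
  rewrite ipDr//; last exact: L2Z.
  rewrite ipZr//.
  have := HC _ t0; have := zE _ t0 _ (phid _ (ph_domB ph (zd _ t0) dv)).
  rewrite -/x => -> H; rewrite (ip_sym n (phi \o x) (z' t)).
  by nra.
have H3 : 2 * ip n (phi \o x) r <= s * theta * (K + 1).
  have st0 : 0 < s * theta by rewrite mulr_gt0.
  have := young (@L2_prehilbert _ _ _ n) (L2Z (s * theta) Lp) Lr.
  rewrite /quad/= ip_quadZ// ipZl// => Y.
  have Hp : ip n (phi \o x) (phi \o x) <= K.
    apply: le_trans (phiL _ Lx) _.
    apply: le_trans (quadB_le (@L2_prehilbert _ _ _ n) (bL (zd _ t0)) Lv) _.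
    by rewrite lerD2r ler_wpM2l//; have [] := zM _ t0.
  rewrite -(ler_pM2l st0).
  have : (s * theta) ^+ 2 * ip n (phi \o x) (phi \o x) <= (s * theta) ^+ 2 * K.
    by rewrite ler_wpM2l// sqr_ge0.
  move=> Q; apply: (@le_trans _ _ ((s * theta) ^+ 2 * K + theta ^+ 2 * s ^+ 2)).
    by lra.
  by rewrite le_eqVlt; apply/orP; left; apply/eqP; ring.
have H4 : ip n D D <= s ^+ 2 * L.
  apply: le_trans (quadD_le (@L2_prehilbert _ _ _ n) (L2Z s Lz') Lr) _.
  rewrite /quad/= ip_quadZ//.
  have [_ zm] := zM _ t0.
  have : s ^+ 2 * ip n (z' t) (z' t) <= s ^+ 2 * M by rewrite ler_wpM2l// sqr_ge0.
  rewrite /L; have := sqr_ge0 s => *; nra.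
have H5 : s * theta * (K + 1) = s * (e / 2).
  by rewrite /theta; field; rewrite gt_eqF// ltr_wpDl.
have H6 : s ^+ 2 * L <= s * (e / 2).
  rewrite expr2 -mulrA ler_wpM2l ?ltW//.
  have -> : e / 2 = e / (2 * L) * L by field; rewrite gt_eqF.
  by rewrite ltr_pM2r.
by lra.
Qed.

(** Parabolic comparison with a supersolution [v]. Tested against the positive part of [z t - v],
    the form at [z t] is the sum of a term from [z t - v], nonnegative by [form_pos_ge], and a term
    from [v], nonnegative by hypothesis. *)
Lemma evolution_comparison (alpha : R) (z z' : R -> T -> R) v :
  0 <= alpha -> evolution alpha z z' -> dom b v ->
  (forall w, dom b w -> (forall x, 0 <= w x) -> 0 <= b v w + alpha * ip n v w) ->
  forall t, 0 < t -> ip n (pos_part (z t \- v)) (pos_part (z t \- v)) <=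
    ip n (pos_part (z 0 \- v)) (pos_part (z 0 \- v)).
Proof.
move=> a0 ez dv Hv t t0.
have := @evolution_bound alpha 0 z z' v (fun x => Num.max x 0) ez dv (lexx _).
move=> H; have := H _ _ _ _ _ t t0; rewrite mulr0 addr0; apply => {H}.
- move=> x y; have := sqr_ge0 (y - x); have := sqr_ge0 y; have := sqr_ge0 x.
  have [x0|x0] := leP x 0; have [y0|y0] := leP y 0; nra.
- by move=> u du; exact: (dom_pos hb du).
- move=> u Lu; have [| | |//] := @L2_dominated _ _ _ n (pos_part u) u.
  + exact: L2_meas (L2_pos Lu).
  + exact: Lu.
  + apply: aeW => x; rewrite ger0_norm ?pos_part_ge0//.
    by rewrite /pos_part ge_max ler_norm normr_ge0.
- by move=> u; exact: L2_pos.
- move=> s s0; have dz := evo_dom ez s0.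
  have dB := ph_domB ph dz dv; have dp := dom_pos hb dB.
  rewrite -[_ \o _]/(pos_part (z s \- v)).
  have := form_pos_ge hb dB; have := ip_pos n (z s \- v).
  have := ph_ge0 ph dp; have := ip_ge0 n (pos_part (z s \- v)).
  rewrite (phBl ph)// ipBl; try exact: bL.
  have := Hv _ dp (pos_part_ge0 _).
  by move=> *; nra.
Qed.

Lemma evolution_distance (z z' : R -> T -> R) v :
  evolution 0 z z' -> dom b v ->
  forall t, 0 < t -> ip n (z t \- v) (z t \- v) <=
    ip n (z 0 \- v) (z 0 \- v) + t * (quad b v / 2).
Proof.
move=> ez dv t t0; have qv := ph_ge0 ph dv.
have := @evolution_bound 0 (quad b v / 2) z z' v (fun x => x) ez dv.
apply => //; first by rewrite divr_ge0.
- by move=> x y; lra.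
- move=> s s0; have dz := evo_dom ez s0.
  rewrite -[_ \o _]/(z s \- v) mul0r addr0 (phBr ph)//.
  (* Positivity of [quad b (2 z - v)] says that [-2 b (z, z - v) <= quad b v / 2]; this is the
     origin of the factor 1/2. *)
  have := ph_ge0 ph (ph_domB ph (ph_domZ ph 2 dz) dv).
  rewrite (quadB ph)// ?(quadZ ph)// ?(phZl ph)//; last exact: ph_domZ.
  by rewrite /quad => H; lra.
Qed.

End evolution.

(** * The semigroup of a form *)

Section semigroup.
Context {R : realType} {d : measure_display} {T : measurableType d}.
Variables (n : {measure set T -> \bar R}) (b : real_form T R).
Variable S : R -> (T -> R) -> T -> R.
Hypothesis hb : positivity_preserving_form n b.
Hypothesis hS : semigroup_of n b S.
Implicit Types f g h u v w : T -> R.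

Let ph := ppf_prehilbert hb.
Let bL := ppf_L2 hb.
Let hL := @L2_prehilbert _ _ _ n.
Let sg := hS.1.

Lemma semigroup_ip_le t f : 0 < t -> L2 n f -> ip n (S t f) (S t f) <= ip n f f.
Proof.
move=> t0 Hf; have := sg_contraction sg t0 Hf.
rewrite !L2norm_ip//; last exact: (sg_L2 sg).
rewrite lee_fin => H.
rewrite -[leLHS]sqr_sqrtr ?ip_ge0// -[leRHS]sqr_sqrtr ?ip_ge0//.
by rewrite lerXn2r// nnegrE sqrtr_ge0.
Qed.

Definition diff_quotient u f s x : R := s^-1 * (S s u x - u x) - f x.

Lemma diff_quotient_L2 u f s : 0 < s -> L2 n u -> L2 n f ->
  L2 n (diff_quotient u f s).
Proof.
move=> s0 Hu Hf; apply: (L2B _ Hf); apply: (L2Z s^-1 (L2B _ Hu)).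
exact: (sg_L2 sg).
Qed.

Lemma generatorP u f : L2 n u -> L2 n f -> generator n S u f <->
  forall e, 0 < e -> exists2 delta, 0 < delta & forall s, 0 < s < delta ->
    ip n (diff_quotient u f s) (diff_quotient u f s) < e.
Proof.
move=> Hu Hf; split.
- move=> /fine_cvgP[_ /cvgrPdist_lt H] e e0.
  have [|delta /= d0 Hd] := H (Num.sqrt e); first by rewrite sqrtr_gt0.
  exists delta => // s /andP[s0 sd]; have := Hd s.
  rewrite /ball/= !sub0r !normrN gtr0_norm// => /(_ sd s0).
  rewrite -/(diff_quotient u f s) L2norm_ip; last exact: diff_quotient_L2.
  by rewrite /= ger0_norm ?sqrtr_ge0// ltr_sqrt.
- move=> H; apply/fine_cvgP; split.
    exists 1 => //= s _ s0; rewrite -/(diff_quotient u f s).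
    by rewrite L2norm_ip//; exact: diff_quotient_L2.
  apply/cvgrPdist_lt => e e0.
  have [|delta d0 Hd] := H (e ^+ 2); first by rewrite exprn_gt0.
  exists delta => //= s; rewrite /ball/= !sub0r !normrN => sd s0.
  rewrite gtr0_norm// in sd.
  rewrite -/(diff_quotient u f s) L2norm_ip; last exact: diff_quotient_L2.
  rewrite /= ger0_norm ?sqrtr_ge0// -(ger0_norm (ltW e0)) -sqrtr_sqr.
  by rewrite ltr_sqrt ?exprn_gt0//; apply: Hd; rewrite s0.
Qed.

Lemma semigroup_lin3 t c1 c2 f1 f2 f3 : 0 < t -> L2 n f1 -> L2 n f2 -> L2 n f3 ->
  {ae n, forall x, S t (fun x => c1 * f1 x + (c2 * f2 x + f3 x)) x =
    c1 * S t f1 x + (c2 * S t f2 x + S t f3 x)}.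
Proof.
move=> t0 H1 H2 H3.
have := sg_lin sg c1 t0 H1 (L2_lin c2 H2 H3).
by have := sg_lin sg c2 t0 H2 H3; apply: filterS2 => x -> ->.
Qed.

Lemma semigroupB t f g : 0 < t -> L2 n f -> L2 n g ->
  {ae n, forall x, S t (f \- g) x = S t f x - S t g x}.
Proof.
move=> t0 Hf Hg; have := sg_lin sg (-1) t0 Hg Hf.
have -> : (fun y => -1 * g y + f y) = f \- g by apply/funext => x /=; ring.
by apply: filterS => x ->; ring.
Qed.

Definition operator_graph f h :=
  [/\ dom b f, L2 n h & forall v, dom b v -> b f v = - ip n h v].

Lemma operator_graphP f h : L2 n f -> L2 n h -> generator n S f h <-> operator_graph f h.
Proof.
move=> Hf Hh; split=> [/(hS.2 _ _ Hf Hh)[]//|[H1 _ H2]].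
exact/(hS.2 _ _ Hf Hh).
Qed.

(** [S t] commutes with the generator: the difference quotient of [S t f] is a.e. the image under
    [S t] of that of [f], and [S t] is a contraction. *)
Lemma semigroup_operator t f h : 0 < t -> operator_graph f h ->
  operator_graph (S t f) (S t h).
Proof.
move=> t0 gfh; have [df Hh _] := gfh; have Hf := bL df.
have HSf := sg_L2 sg t0 Hf; have HSh := sg_L2 sg t0 Hh.
apply/operator_graphP => //; apply/generatorP => // e e0.
have /operator_graphP/(generatorP Hf Hh)/(_ _ e0)[//|//|delta d0 Hd] := gfh.
exists delta => // s sd; apply: le_lt_trans (Hd s sd); case/andP: sd => s0 _.
have HD := diff_quotient_L2 s0 Hf Hh.
rewrite (@ip_quad_ae _ _ _ n _ (S t (diff_quotient f h s))); first last.
- have Hs := sg_L2 sg s0 Hf.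
  have H3 := semigroup_lin3 s^-1 (-1) t0 (L2B Hs Hf) Hh (@L2_0 _ _ _ n).
  have H4 := semigroupB t0 Hs Hf.
  have H5 := sg_add sg s0 t0 Hf; have := sg_add sg t0 s0 Hf; rewrite addrC => H6.
  (* [S] is linear only a.e., so the value 0 of [S t (cst 0)] has to be deduced from
     [S t 0 = S t 0 + S t 0]. *)
  have H7 := sg_lin sg 1 t0 (@L2_0 _ _ _ n) (@L2_0 _ _ _ n).
  have E0 : (fun y : T => 1 * cst 0 y + cst 0 y) = cst 0 :> (T -> R).
    by apply/funext => y /=; ring.
  rewrite E0 in H7.
  have -> : diff_quotient f h s =
      (fun x => s^-1 * (S s f \- f) x + (-1 * h x + (cst 0 : T -> R) x)).
    by apply/funext => x; rewrite /diff_quotient /=; ring.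
  move: (aeI (aeI H3 H4) (aeI (aeI H5 H6) H7)).
  apply: filterS => x [[-> h4] [[h5 h6] h7]].
  rewrite /diff_quotient -h5 h6 h4.
  have -> : S t (cst 0) x = 0 by lra.
  ring.
- exact: (sg_L2 sg).
- exact: diff_quotient_L2.
exact: semigroup_ip_le.
Qed.

(** The laws of [S] concern positive times; an evolution needs the identity at time 0. *)
Definition semigroup0 t f := if t == 0 then f else S t f.

Lemma semigroup0_L2 t f : 0 <= t -> L2 n f -> L2 n (semigroup0 t f).
Proof.
rewrite le_eqVlt /semigroup0 => /predU1P[<-|t0 Hf]; first by rewrite eqxx.
by rewrite gt_eqF//; exact: (sg_L2 sg).
Qed.

Lemma semigroup0_ip_le t f : 0 <= t -> L2 n f ->
  ip n (semigroup0 t f) (semigroup0 t f) <= ip n f f.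
Proof.
rewrite le_eqVlt /semigroup0 => /predU1P[<-|t0 Hf]; first by rewrite eqxx.
by rewrite gt_eqF//; exact: semigroup_ip_le.
Qed.

Lemma semigroup0_lin3 t c1 c2 f1 f2 f3 : 0 <= t -> L2 n f1 -> L2 n f2 -> L2 n f3 ->
  {ae n, forall x, semigroup0 t (fun x => c1 * f1 x + (c2 * f2 x + f3 x)) x =
    c1 * semigroup0 t f1 x + (c2 * semigroup0 t f2 x + semigroup0 t f3 x)}.
Proof.
rewrite le_eqVlt /semigroup0 => /predU1P[<-|t0]; first by rewrite eqxx => *; exact: aeW.
by rewrite gt_eqF//; exact: semigroup_lin3.
Qed.

Lemma semigroup0_add t s f : 0 <= t -> 0 < s -> L2 n f ->
  {ae n, forall x, semigroup0 (t + s) f x = semigroup0 t (S s f) x}.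
Proof.
rewrite le_eqVlt /semigroup0 => /predU1P[<-|t0] s0 Hf.
  by rewrite eqxx add0r gt_eqF//; exact: aeW.
by rewrite !gt_eqF ?addr_gt0//; exact: (sg_add sg).
Qed.

Lemma semigroup0_operator t f h : 0 <= t -> operator_graph f h ->
  operator_graph (semigroup0 t f) (semigroup0 t h).
Proof.
rewrite le_eqVlt /semigroup0 => /predU1P[<-|t0]; first by rewrite eqxx.
by rewrite gt_eqF//; exact: semigroup_operator.
Qed.

(** With [x = alpha s], everything follows from [1 + y <= exp y] at [y = x] and [y = -x], since
    [exp (-x) <= 1 / (1 + x) <= 1 - x + x^2]. *)
Lemma expR_discount (alpha s : R) : 0 <= alpha -> 0 < s ->
  `|expR (- alpha * s) - 1| <= alpha * s /\
  `|s^-1 * (expR (- alpha * s) - 1) + alpha| <= alpha ^+ 2 * s.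
Proof.
move=> a0 s0; have x0 : 0 <= alpha * s by rewrite mulr_ge0// ltW.
have E : - alpha * s = - (alpha * s) by rewrite mulNr.
rewrite E; have := expR_ge1Dx (- (alpha * s)); have := expR_ge1Dx (alpha * s).
rewrite expRN; set y := expR _; set x := alpha * s in x0 * => Hy Hy'.
have y0 : 0 < y by exact: expR_gt0.
have Hi : y^-1 <= 1 - x + x ^+ 2.
  rewrite -[leLHS]mul1r ler_pdivrMr//.
  have := sqr_ge0 x => ?; have : 0 <= 1 - x + x ^+ 2 by nra.
  move=> ?; apply: (@le_trans _ _ ((1 - x + x ^+ 2) * (1 + x))); last first.
    by rewrite ler_wpM2l.
  have : 0 <= x ^+ 3 by rewrite exprn_ge0.
  have -> : (1 - x + x ^+ 2) * (1 + x) = 1 + x ^+ 3 by ring.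
  by move=> ?; lra.
have Hi1 : y^-1 <= 1 by rewrite invf_le1//; lra.
split; first by rewrite ler0_norm; lra.
have -> : s^-1 * (y^-1 - 1) + alpha = s^-1 * (y^-1 - 1 + x).
  by rewrite /x; field; rewrite !gt_eqF.
rewrite normrM gtr0_norm ?invr_gt0// mulrC ler_pdivrMr//.
have -> : alpha ^+ 2 * s * s = x ^+ 2 by rewrite /x; ring.
by rewrite ger0_norm; lra.
Qed.

Lemma discounted_quotient (alpha : R) f h : 0 <= alpha -> operator_graph f h ->
  forall e, 0 < e -> exists2 delta, 0 < delta & forall s, 0 < s < delta ->
    let E := (fun x => s^-1 * (expR (- alpha * s) * S s f x - f x) -
                       (h x - alpha * f x)) in
    L2 n E /\ ip n E E <= e.
Proof.
move=> a0 gfh e e0; have [df Hh _] := gfh; have Hf := bL df.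
have /operator_graphP/(generatorP Hf Hh) H := gfh.
have [|d1 d10 Hd1] := H Hf Hh (e / 16); first by lra.
pose K := alpha ^+ 2 * ip n h h + alpha ^+ 4 * ip n f f.
have K0 : 0 <= K.
  by rewrite addr_ge0// mulr_ge0 ?ip_ge0//; [exact: sqr_ge0|exact: exprn_ge0].
pose d2 := Num.min 1 (e / (16 * (K + 1))).
have d20 : 0 < d2 by rewrite lt_min ltr01 divr_gt0// mulr_gt0// ltr_wpDl.
exists (Num.min d1 d2); first by rewrite lt_min d10 d20.
move=> s /andP[s0]; rewrite !lt_min => /andP[sd1 /andP[s1 sd2]].
have [X1 X2] := expR_discount a0 s0.
set p := expR (- alpha * s) in X1 X2 *; move=> E.
have p0 : 0 < p by exact: expR_gt0.
have p1 : p <= 1 by rewrite -expR0 ler_expR mulNr oppr_le0 mulr_ge0// ltW.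
set q := s^-1 * (p - 1) + alpha in X2.
have HD := diff_quotient_L2 s0 Hf Hh.
(* A multiple of the undiscounted quotient and two terms whose coefficients are of order [s] by
   [expR_discount]. *)
have EE : E = (fun x => p * diff_quotient f h s x) \+
    ((fun x => (p - 1) * h x) \+ (fun x => q * f x)).
  apply/funext => x; rewrite /E /q /diff_quotient /=; ring.
have L1 := L2Z p HD; have L2' := L2Z (p - 1) Hh; have L3 := L2Z q Hf.
rewrite EE; split; first by do 2 (apply: L2D => //).
apply: le_trans (quadD_le hL L1 (L2D L2' L3)) _.
have := quadD_le hL L2' L3; rewrite /quad /= !ip_quadZ//.
have Hq := Hd1 s; rewrite s0 sd1 in Hq; have {}Hq := Hq isT.
have B1 : p ^+ 2 * ip n (diff_quotient f h s) (diff_quotient f h s) <= e / 16.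
  apply: le_trans (ltW Hq); rewrite ler_piMl ?ip_ge0//.
  by rewrite expr_le1// ltW.
have sq (z w : R) : `|z| <= w -> z ^+ 2 <= w ^+ 2.
  move=> zw; rewrite -[z ^+ 2]ger0_norm ?sqr_ge0// normrX lerXn2r// nnegrE//.
  exact: le_trans zw.
have B2 : (p - 1) ^+ 2 * ip n h h <= (alpha * s) ^+ 2 * ip n h h.
  by rewrite ler_wpM2r ?ip_ge0//; exact: sq.
have B3 : q ^+ 2 * ip n f f <= (alpha ^+ 2 * s) ^+ 2 * ip n f f.
  by rewrite ler_wpM2r ?ip_ge0//; exact: sq.
have B4 : (alpha * s) ^+ 2 * ip n h h + (alpha ^+ 2 * s) ^+ 2 * ip n f f <= s * (K + 1).
  have -> : (alpha * s) ^+ 2 * ip n h h + (alpha ^+ 2 * s) ^+ 2 * ip n f f = s * (s * K).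
    by rewrite /K; ring.
  by rewrite ler_wpM2l ?ltW//; nra.
have B5 : s * (K + 1) <= e / 16.
  have -> : e / 16 = e / (16 * (K + 1)) * (K + 1).
    by field; rewrite gt_eqF// ltr_wpDl.
  by rewrite ler_wpM2r ?ltW// ltr_wpDl.
by move=> H'; lra.
Qed.

(** The remainder at time [t] is the discounted image under [S t] of the remainder at time 0;
    contraction makes the bound uniform in [t]. *)
Lemma semigroup_evolution (alpha : R) f h : 0 <= alpha -> operator_graph f h ->
  evolution n b alpha (fun t x => expR (- alpha * t) * semigroup0 t f x)
    (fun t x => expR (- alpha * t) * semigroup0 t (fun y => h y - alpha * f y) x).
Proof.
move=> a0 gfh; have [df Hh _] := gfh; have Hf := bL df.
pose k := fun y => h y - alpha * f y.
have Hk : L2 n k by apply: (L2B Hh); exact: L2Z.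
have kE : k = (fun y => - alpha * f y + (0 * f y + h y)).
  by apply/funext => y; rewrite /k; ring.
have le1 t : 0 <= t -> expR (- alpha * t) <= 1.
  by move=> t0; rewrite -expR0 ler_expR mulNr oppr_le0 mulr_ge0.
have bnd t g : 0 <= t -> L2 n g ->
    ip n (fun x => expR (- alpha * t) * semigroup0 t g x)
         (fun x => expR (- alpha * t) * semigroup0 t g x) <= ip n g g.
  move=> t0 Hg; have HSg := semigroup0_L2 t0 Hg; rewrite ip_quadZ//.
  apply: le_trans (semigroup0_ip_le t0 Hg); rewrite ler_piMl ?ip_ge0//.
  by rewrite expr_le1// ?le1// expR_ge0.
split.
- move=> t t0; have [dS _ _] := semigroup0_operator t0 gfh.
  exact: ph_domZ.
- by move=> t t0; apply: L2Z; exact: semigroup0_L2.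
- move=> t t0 v dv; have [dS HSh Sv] := semigroup0_operator t0 gfh.
  have Lv := bL dv; have LS := bL dS; have HSk := semigroup0_L2 t0 Hk.
  rewrite (phZl ph)// !ipZl// Sv//.
  have -> : ip n (semigroup0 t (fun y => h y - alpha * f y)) v =
      ip n (semigroup0 t h) v - alpha * ip n (semigroup0 t f) v.
    rewrite -ipZl// -ipBl//; last exact: L2Z.
    apply: ip_ae => //; first by apply: L2B => //; exact: L2Z.
    have := semigroup0_lin3 (- alpha) 0 t0 Hf Hf Hh; rewrite -kE /k.
    by apply: filterS => x ->; rewrite /=; ring.
  ring.
- exists (Num.max (ip n f f) (ip n k k)) => t t0.
  by rewrite !le_max !bnd//= orbT.
- move=> e e0; have [delta d0 Hd] := discounted_quotient a0 gfh e0.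
  exists delta => // s t t0 sd; have [LE qE] := Hd s sd.
  move: LE qE; set E := (fun x : T => _) => LE qE; have /andP[s0 _] := sd.
  exists (fun x => s * (expR (- alpha * t) * semigroup0 t E x)).
    split; first by do 2 apply: L2Z; exact: semigroup0_L2.
    rewrite ip_quadZ; last by apply: L2Z; exact: semigroup0_L2.
    rewrite mulrC ler_wpM2r ?sqr_ge0//.
    exact: le_trans (bnd _ _ t0 LE) qE.
  have Hs := sg_L2 sg s0 Hf.
  have EE : E = (fun x => (s^-1 * expR (- alpha * s)) * S s f x +
      (- s^-1 * f x + (fun x => - k x) x)).
    by apply/funext => x; rewrite /E /k; ring.
  have Hnk : L2 n (fun x => - k x).
    by have := L2Z (-1) Hk; congr (L2 n _); apply/funext => x; rewrite mulN1r.
  have H1 := semigroup0_lin3 (s^-1 * expR (- alpha * s)) (- s^-1) t0 Hs Hf Hnk.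
  have H2 := semigroup0_lin3 (-1) 0 t0 Hk Hk (@L2_0 _ _ _ n).
  (* These coefficients give [S t 0 = 2 S t 0] a.e., hence the value 0. *)
  have H3 := semigroup0_lin3 0 1 t0 (@L2_0 _ _ _ n) (@L2_0 _ _ _ n) (@L2_0 _ _ _ n).
  have H4 := semigroup0_add t0 s0 Hf.
  have N1 : (fun x => -1 * k x + (0 * k x + (cst 0 : T -> R) x)) = (fun x => - k x).
    by apply/funext => x /=; ring.
  have N2 : (fun x : T => 0 * (cst 0 : T -> R) x +
      (1 * (cst 0 : T -> R) x + (cst 0 : T -> R) x)) = cst 0 :> (T -> R).
    by apply/funext => x /=; ring.
  rewrite -EE in H1; rewrite N1 in H2; rewrite N2 in H3.
  move: (aeI (aeI H1 H2) (aeI H3 H4)); apply: filterS.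
  move=> x [[-> ->] [h3 ->]].
  have -> : semigroup0 t (cst 0) x = 0 by lra.
  rewrite mulrDr expRD -/k; field; rewrite gt_eqF//.
Qed.

Lemma semigroup_approx t f g : 0 < t -> L2 n f -> L2 n g ->
  ip n (S t f \- S t g) (S t f \- S t g) <= ip n (f \- g) (f \- g).
Proof.
move=> t0 Hf Hg; have HSf := sg_L2 sg t0 Hf; have HSg := sg_L2 sg t0 Hg.
rewrite (@ip_quad_ae _ _ _ n _ (S t (f \- g))).
- by apply: semigroup_ip_le => //; exact: L2B.
- exact: L2B.
- by apply: (sg_L2 sg) => //; exact: L2B.
- by have := semigroupB t0 Hf Hg; apply: filterS => x ->.
Qed.

Lemma operator_domain_seq f : L2 n f -> exists f_ : nat -> T -> R,
  (forall k, exists h, operator_graph (f_ k) h) /\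
  quad (L2_form n) (f_ k \- f) @[k --> \oo] --> (0 : R).
Proof.
move=> Hf; have : forall k, exists w, (exists h, operator_graph w h) /\
    ip n (w \- f) (w \- f) <= k.+1%:R^-1.
  move=> k; have [|w [h [dw Hh wh H]]] := operator_domain_dense hb Hf (e := k.+1%:R^-1).
    by rewrite invr_gt0.
  by exists w; split; [exists h|exact: ltW].
move=> /choice[w_ wP]; exists w_; split; first by move=> k; case: (wP k).
by apply: squeeze0 (@cvg_invS R) => k; rewrite ip_ge0/=; case: (wP k).
Qed.

Lemma semigroup_quad_cvg t (f_ : nat -> T -> R) f v : 0 < t -> (forall k, L2 n (f_ k)) ->
  L2 n f -> L2 n v -> quad (L2_form n) (f_ k \- f) @[k --> \oo] --> (0 : R) ->
  ip n (S t (f_ k) \- v) (S t (f_ k) \- v) @[k --> \oo] --> ip n (S t f \- v) (S t f \- v).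
Proof.
move=> t0 Hf_ Hf Hv Cf; have HS k : L2 n (S t (f_ k)) by exact: (sg_L2 sg).
have HSf := sg_L2 sg t0 Hf.
apply: (quad_cvg hL) => [k||]; try exact: L2B.
apply: squeeze0 Cf => k; rewrite ip_ge0/=.
have := semigroup_approx t0 (Hf_ k) Hf; congr (_ <= _); rewrite /quad /=.
by congr (ip n _ _); apply/funext => x /=; ring.
Qed.

(** For [f] in the operator domain this is [evolution_distance] without discount; both sides are
    continuous in [f] for the L2 norm. *)
Lemma semigroup_distance t f v : 0 < t -> L2 n f -> dom b v ->
  ip n (S t f \- v) (S t f \- v) <= ip n (f \- v) (f \- v) + t * (quad b v / 2).
Proof.
move=> t0 Hf dv; have [f_ [gf Cf]] := operator_domain_seq Hf; have Lv := bL dv.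
have Hf_ k : L2 n (f_ k) by have [h [/bL]] := gf k.
have C1 := semigroup_quad_cvg t0 Hf_ Hf Lv Cf.
have C2 : quad (L2_form n) (f_ k \- v) @[k --> \oo] --> quad (L2_form n) (f \- v).
  apply: (quad_cvg hL) => [k||]; try exact: L2B.
  by apply: cvg_ext Cf => k; congr quad; apply/funext => x /=; ring.
suff : 0 <= ip n (f \- v) (f \- v) + t * (quad b v / 2) + -1 * ip n (S t f \- v) (S t f \- v).
  by move=> ?; lra.
have C0 : cst (t * (quad b v / 2)) @ \oo --> t * (quad b v / 2) by exact: cvg_cst.
apply: cvg_ge (cvg_add (cvg_add C2 C0) (cvg_cmul (c:=-1) C1)) _ => k; have [h gfh] := gf k.
have := evolution_distance hb (semigroup_evolution (lexx 0) gfh) dv t0.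
have E s : (fun x => expR (- 0 * s) * semigroup0 s (f_ k) x) \- v = semigroup0 s (f_ k) \- v.
  by apply/funext => x /=; rewrite oppr0 mul0r expR0 mul1r.
by rewrite !E /semigroup0 eqxx gt_eqF// /quad /= => ?; lra.
Qed.

Lemma semigroup_continuity t v : 0 < t -> dom b v ->
  ip n (S t v \- v) (S t v \- v) <= t * (quad b v / 2).
Proof.
move=> t0 dv; have := semigroup_distance t0 (bL dv) dv.
have -> : v \- v = cst 0 by apply/funext => x /=; ring.
by rewrite -[ip n (cst 0) _]/(quad (L2_form n) (cst 0)) (quad0 hL) add0r.
Qed.

Lemma pos_part_dist u v : L2 n u -> L2 n v ->
  ip n (pos_part u \- pos_part v) (pos_part u \- pos_part v) <= ip n (u \- v) (u \- v).
Proof.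
move=> Hu Hv; have Hpu := L2_pos Hu; have Hpv := L2_pos Hv.
have [| | |//] := @L2_dominated _ _ _ n (pos_part u \- pos_part v) (u \- v).
- exact: L2_meas (L2B Hpu Hpv).
- exact: L2B.
- apply: aeW => x; rewrite !pos_partE /= -mulrBr normrM ger0_norm ?invr_ge0//.
  have -> : u x + `|u x| - (v x + `|v x|) = (u x - v x) + (`|u x| - `|v x|) by ring.
  have := ler_normD (u x - v x) (`|u x| - `|v x|).
  by have := ler_dist_dist (u x) (v x); lra.
Qed.

(** Comparison with the supersolution 0, extended by L2 continuity of the positive part. It makes
    the semigroup positivity preserving. *)
Lemma semigroup_pos_part_le t f : 0 < t -> L2 n f ->
  ip n (pos_part (S t f)) (pos_part (S t f)) <= ip n (pos_part f) (pos_part f).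
Proof.
move=> t0 Hf; have [f_ [gf Cf]] := operator_domain_seq Hf.
have Hf_ k : L2 n (f_ k) by have [h [/bL]] := gf k.
have HS k : L2 n (S t (f_ k)) by exact: (sg_L2 sg).
have HSf := sg_L2 sg t0 Hf.
have C1 : quad (L2_form n) (pos_part (S t (f_ k))) @[k --> \oo] -->
    quad (L2_form n) (pos_part (S t f)).
  apply: (quad_cvg hL) => [k||]; try exact: L2_pos.
  apply: squeeze0 Cf => k; rewrite ip_ge0/=; apply: le_trans (pos_part_dist _ _) _ => //.
  exact: semigroup_approx.
have C2 : quad (L2_form n) (pos_part (f_ k)) @[k --> \oo] --> quad (L2_form n) (pos_part f).
  apply: (quad_cvg hL) => [k||]; try exact: L2_pos.
  by apply: squeeze0 Cf => k; rewrite ip_ge0/=; exact: pos_part_dist.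
suff : 0 <= ip n (pos_part f) (pos_part f) + -1 * ip n (pos_part (S t f)) (pos_part (S t f)).
  by move=> ?; lra.
apply: cvg_ge (cvg_add C2 (cvg_cmul (c:=-1) C1)) _ => k; have [h gfh] := gf k.
have := evolution_comparison hb (lexx 0) (semigroup_evolution (lexx 0) gfh)
  (ph_dom0 ph) _ t0.
have E s : (fun x => expR (- 0 * s) * semigroup0 s (f_ k) x) \- (cst 0) = semigroup0 s (f_ k).
  by apply/funext => x /=; rewrite oppr0 mul0r expR0 mul1r addr0.
rewrite !E /semigroup0 eqxx gt_eqF// /quad /= => H.
suff : ip n (pos_part (S t (f_ k))) (pos_part (S t (f_ k))) <=
  ip n (pos_part (f_ k)) (pos_part (f_ k)) by move=> ?; lra.
apply: H => w dw _; rewrite (ph0l ph)// mul0r addr0; exact: lexx.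
Qed.

Lemma semigroup_le0 t f : 0 < t -> L2 n f -> {ae n, forall x, f x <= 0} ->
  {ae n, forall x, S t f x <= 0}.
Proof.
move=> t0 Hf f0; have HSf := sg_L2 sg t0 Hf; apply: (pos_part_ip0 HSf).
apply: le_trans (semigroup_pos_part_le t0 Hf) _.
rewrite (@ip_quad_ae _ _ _ n _ (cst 0)).
- by rewrite -[ip n (cst 0) _]/(quad (L2_form n) (cst 0)) (quad0 hL).
- exact: L2_pos.
- exact: L2_0.
- by apply: filterS f0 => x fx; rewrite /pos_part max_r.
Qed.

Lemma semigroup_le t f g : 0 < t -> L2 n f -> L2 n g ->
  {ae n, forall x, f x <= g x} -> {ae n, forall x, S t f x <= S t g x}.
Proof.
move=> t0 Hf Hg fg.
have : {ae n, forall x, S t (f \- g) x <= 0}.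
  apply: semigroup_le0 => //; first exact: L2B.
  by apply: filterS fg => x; rewrite /= subr_le0.
have := semigroupB t0 Hf Hg; apply: filterS2 => x ->.
by rewrite subr_le0.
Qed.

(** As [g] is nonnegative, [u] is a supersolution for the rate [alpha]; the discounted evolution
    starting at [u] therefore stays below [u]. *)
Lemma semigroup_resolvent_le (alpha : R) g u t : 0 < alpha -> 0 < t -> L2 n g ->
  {ae n, forall x, 0 <= g x} -> resolvent_at n b alpha g u ->
  {ae n, forall x, S t u x <= expR (alpha * t) * u x}.
Proof.
move=> a0 t0 Hg g0 [du Hu]; have Lu := bL du.
have gr : operator_graph u (fun x => alpha * u x - g x).
  split => //; first by apply: (L2B _ Hg); exact: L2Z.
  move=> v dv; have Lv := bL dv.
  have := ipBl (L2Z alpha Lu) Hg Lv; rewrite ipZl// => ->.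
  by have := Hu _ dv => ?; lra.
have := evolution_comparison hb (ltW a0) (semigroup_evolution (ltW a0) gr) du _ t0.
rewrite /semigroup0 eqxx gt_eqF// => H.
have LSu := sg_L2 sg t0 Lu.
have LB : L2 n ((fun x => expR (- alpha * t) * S t u x) \- u).
  by apply: (L2B _ Lu); exact: L2Z.
have : {ae n, forall x, ((fun x => expR (- alpha * t) * S t u x) \- u) x <= 0}.
  apply: (pos_part_ip0 LB); apply: le_trans (H _) _.
    move=> w dw w0; rewrite Hu//; apply: ip_ge0_ae => //; first exact: bL.
    exact: aeW.
  have -> : pos_part ((fun x => expR (- alpha * 0) * u x) \- u) = cst 0.
    apply/funext => x; rewrite /pos_part /= mulr0 expR0 mul1r subrr.
    by rewrite max_l.
  by rewrite -[ip n (cst 0) _]/(quad (L2_form n) (cst 0)) (quad0 hL).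
apply: filterS => x /=; rewrite subr_le0 mulNr expRN => H1.
by rewrite mulrC -ler_pdivrMr ?expR_gt0// mulrC.
Qed.

End semigroup.

(** * Integration against a squared density *)

Section density.
Context {R : realType} {d : measure_display} {T : measurableType d}.
Variables (n : {measure set T -> \bar R}) (h : {mfun T >-> R}).
Implicit Types u f g : T -> R.

Import HBNNSimple.

Let nu : {measure set T -> \bar R} := sqr_density n h.

Let mh2 : measurable_fun [set: T] (fun x => (h x ^+ 2)%:E).
Proof. by apply/measurable_EFinP; apply: measurable_funX => //; exact: measurable_funPT. Qed.

Let h20 x : (0 <= (h x ^+ 2)%:E)%E.
Proof. by rewrite lee_fin sqr_ge0. Qed.

(** Approximation by simple functions and monotone convergence on both sides; on a level set the
    identity is the definition of [sqr_density]. *)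
Lemma integral_sqr_density f : measurable_fun [set: T] f -> (forall x, 0 <= f x) ->
  (\int[sqr_density n h]_x (f x)%:E = \int[n]_x (f x * h x ^+ 2)%:E)%E.
Proof.
move=> mf f0; have mEf : measurable_fun [set: T] (EFin \o f) by exact/measurable_EFinP.
pose s := nnsfun_approx measurableT mEf.
have sf x : (EFin \o s^~ x) @ \oo --> (f x)%:E.
  by apply: (cvg_nnsfun_approx measurableT mEf) => // y _; rewrite lee_fin.
have -> : (\int[sqr_density n h]_x (f x)%:E =
    lim (\int[nu]_x (EFin \o s k) x @[k --> \oo]))%E.
  have fE x : (f x)%:E = lim ((EFin \o s k) x @[k --> \oo]).
    by apply/esym/cvg_lim => //; exact: sf.
  under eq_integral => x _ do rewrite fE.
  apply: monotone_convergence => //.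
  - by move=> k; apply/measurable_EFinP; exact/measurable_funP.
  - by move=> k x _; rewrite lee_fin.
  - by move=> x _ i j ij; rewrite lee_fin; exact/lefP/nd_nnsfun_approx.
have -> : (\int[n]_x (f x * h x ^+ 2)%:E =
    lim (\int[n]_x ((EFin \o s k) x * (h x ^+ 2)%:E) @[k --> \oo]))%E.
  have fE x : (f x * h x ^+ 2)%:E = lim (((EFin \o s k) x * (h x ^+ 2)%:E)%E @[k --> \oo]).
    by apply/esym/cvg_lim => //; exact: (cvgeZr _ (sf x)).
  under eq_integral => x _ do rewrite fE.
  apply: monotone_convergence => //.
  - move=> k; apply/emeasurable_funM => //.
    by apply/measurable_EFinP; exact/measurable_funP.
  - by move=> k x _; rewrite mule_ge0// lee_fin.
  - by move=> x _ i j ij; rewrite lee_wpmul2r// lee_fin; exact/lefP/nd_nnsfun_approx.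
suff suf k : (\int[n]_x ((EFin \o s k) x * (h x ^+ 2)%:E) = \int[nu]_x (EFin \o s k) x)%E.
  by under [in RHS]eq_fun do rewrite suf.
have indic r : measurable_fun [set: T] (fun x => (r * \1_(s k @^-1` [set r]) x)%:E).
  by apply/measurable_EFinP; exact: measurable_funM.
transitivity (\int[nu]_x
   (\sum_(y \in range (s k)) (y * \1_(s k @^-1` [set y]) x)%:E))%E; last first.
  by apply: eq_integral => t tE; rewrite /= fimfunE -fsumEFin.
rewrite ge0_integral_fsum//; last by move=> m y Ey; exact: nnfun_muleindic_ge0.
transitivity (\int[n]_x (\sum_(y \in range (s k))
    (y * \1_(s k @^-1` [set y]) x)%:E * (h x ^+ 2)%:E))%E.
  under [RHS]eq_integral => x xE.
    rewrite -ge0_mule_fsuml => [|y]; last exact: nnfun_muleindic_ge0.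
    rewrite fsumEFin // -(fimfunE _ x); over.
  by [].
rewrite ge0_integral_fsum//; last 2 first.
- by move=> y; apply: emeasurable_funM.
- by move=> y x _; rewrite mule_ge0//; exact: nnfun_muleindic_ge0.
apply: eq_fsbigr => r rs.
under eq_integral do rewrite EFinM -muleA.
have rs' : 0 <= r by move: rs; rewrite inE => -[x _ <-].
under [RHS]eq_integral do rewrite EFinM.
rewrite [RHS]integralZl_indic_nnsfun//.
rewrite ge0_integralZl//; last 2 first.
- by apply: emeasurable_funM => //; apply/measurable_EFinP.
- by move=> x _; rewrite mule_ge0// lee_fin.
congr (_ * _)%E; rewrite integral_indic// setIT.
rewrite /nu /= /sqr_density [in RHS]integral_mkcond; apply: eq_integral => x _.
by rewrite patchE indicE; case: ifPn => _; rewrite ?mul1e ?mul0e.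
Qed.

Lemma sqr_density_ae (P : T -> Prop) : {ae n, forall x, P x} ->
  {ae sqr_density n h, forall x, P x}.
Proof.
move=> [N [mN N0 NP]]; exists N; split => //.
rewrite [LHS]/(\int[n]_(x in N) (h x ^+ 2)%:E)%E.
have := integral_abs_eq0 mN (measurable_funS measurableT (@subsetT _ _) mh2) N0.
by under eq_integral do rewrite gee0_abs ?lee_fin ?sqr_ge0//.
Qed.

(** On a set that is null for the density, [h^2] vanishes a.e.; positivity of [h] then makes the set
    null for [n]. *)
Lemma ae_sqr_density (P : T -> Prop) : {ae n, forall x, 0 < h x} ->
  {ae sqr_density n h, forall x, P x} -> {ae n, forall x, P x}.
Proof.
move=> hpos [N [mN N0 NP]].
have : (\int[n]_(x in N) `|(h x ^+ 2)%:E| = 0)%E.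
  by under eq_integral do rewrite gee0_abs ?lee_fin ?sqr_ge0//.
move/ae_eq_integral_abs => /(_ mN (measurable_funS measurableT (@subsetT _ _) mh2)).
move: hpos; apply: filterS2 => x hx Hx; apply: contrapT => /NP /Hx [] /eqP.
by rewrite sqrf_eq0 gt_eqF.
Qed.

Lemma sqr_density_L2 u : measurable_fun [set: T] u ->
  L2 (sqr_density n h) u <-> L2 n (fun x => h x * u x).
Proof.
move=> mu; rewrite !L2P//; last by apply: measurable_funM => //; exact: measurable_funPT.
rewrite integral_sqr_density; [|exact: measurable_funX|by move=> x; exact: sqr_ge0].
by under eq_integral do rewrite mulrC -exprMn.
Qed.

End density.

(** * The h-transform *)

Section measurable_aux.
Context {R : realType} {d : measure_display} {T : measurableType d}.

(** On nonnegative numbers the inverse is the power of exponent -1. Dividing by [|h|] instead of [h]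
    is harmless where [h] is positive. *)
Lemma measurable_inv_norm (f : T -> R) : measurable_fun [set: T] f ->
  measurable_fun [set: T] (fun x => `|f x|^-1).
Proof.
move=> mf; have : measurable_fun [set: T] (fun x => `|f x| `^ (-1)).
  apply: (measurableT_comp (measurable_powR (-1))) => //.
  exact: measurableT_comp.
by apply: eq_measurable_fun => x _; rewrite powR_inv1.
Qed.

Lemma Lfun1_bounded (n : {measure set T -> \bar R}) (f g : T -> R) :
  measurable_fun [set: T] f -> g \in Lfun n 1%E ->
  (forall x, `|f x| <= `|g x|) -> f \in Lfun n 1%E.
Proof.
move=> mf /Lfun1_integrable gi fg; apply/Lfun1_integrable.
apply: le_integrable gi => //; first exact/measurable_EFinP.
by move=> x /=; rewrite lee_fin.
Qed.

Lemma reference_meas (n : {measure set T -> \bar R}) (g : T -> R) :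
  reference_function n g -> measurable_fun [set: T] g.
Proof. by move=> /reference_L2/L2_meas. Qed.

End measurable_aux.

Section criticality.
Context {R : realType} {d : measure_display} {T : measurableType d}.
Variables (n : {measure set T -> \bar R}) (b : real_form T R).
Hypothesis hb : positivity_preserving_form n b.
Implicit Types f g u v w : T -> R.

Let ph := ppf_prehilbert hb.
Let bL := ppf_L2 hb.

Lemma dom_ext u : dom b u -> ext_dom n b u /\ ext_quad n b u (quad b u).
Proof.
move=> du; have A : approximating n b (fun=> u) u.
  split => //; last by apply: aeW => x; exact: cvg_cst.
  move=> e e0; exists 0%N => j k _ _; have -> : u \- u = cst 0.
    by apply/funext => x /=; ring.
  by rewrite (quad0 ph).
split; last by exists (fun=> u) => //; exact: cvg_cst.
by split; [exact/L2_meas/bL|exists (fun=> u)].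
Qed.

Lemma subcritical_of_dom g : reference_function n g -> (forall x, 0 <= g x) ->
  (forall u, dom b u ->
    (\int[n]_x (`|u x| * g x)%:E <= (Num.sqrt (quad b u))%:E)%E) ->
  subcritical n b.
Proof.
move=> gref g0 H; have mg := reference_meas gref; exists g => // u r [mu _].
move=> [u_ [du _ uu] qr].
apply: (@fatou_ae _ _ _ n (fun k x => `|u_ k x| * g x) _
  (fun k => Num.sqrt (quad b (u_ k)))).
- move=> k; apply: measurable_funM => //; apply: measurableT_comp => //.
  exact/L2_meas/bL.
- by apply: measurable_funM => //; exact: measurableT_comp.
- by move=> k x; rewrite mulr_ge0.
- by move=> x; rewrite mulr_ge0.
- by apply: filterS uu => x ux; apply: cvgM; [exact: cvg_norm|exact: cvg_cst].
- by move=> k; exact: H.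
- by apply: continuous_cvg => //; exact: sqrt_continuous.
Qed.

Section transform.
Variable h : {mfun T >-> R}.
Hypothesis hpos : {ae n, forall x, 0 < h x}.

Let mh : measurable_fun [set: T] h := @measurable_funPT _ _ _ _ h.

Lemma transform_divK v x : 0 < h x -> h x * (`|h x|^-1 * v x) = v x.
Proof. by move=> hx; rewrite (gtr0_norm hx) mulrA divff ?mul1r// gt_eqF. Qed.

(** The inverse of [u |-> h u], valid only where [h] is positive; stability of the domain and of the
    energy under a.e. equality absorbs the exceptional set. *)
Lemma transform_div v : dom b v ->
  let u := fun x => `|h x|^-1 * v x in
  [/\ measurable_fun [set: T] u, dom (h_transform n h b) u,
      quad b (fun x => h x * u x) = quad b v &
      {ae n, forall x, v x = h x * u x}].
Proof.
move=> dv u; have mv := L2_meas (bL dv).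
have mu : measurable_fun [set: T] u.
  by apply: measurable_funM => //; exact: measurable_inv_norm.
have mhu : measurable_fun [set: T] (fun x => h x * u x) by exact: measurable_funM.
have vE : {ae n, forall x, v x = h x * u x}.
  by apply: filterS hpos => x hx; rewrite /u transform_divK.
have dhu := ppf_dom_ae hb dv mhu vE.
split => //; last by rewrite (ppf_quad_ae hb dv mhu vE).
by split => //=; apply/sqr_density_L2 => //; exact: bL.
Qed.

Lemma transient_subcritical g0 : reference_function n g0 ->
  transient (sqr_density n h) (h_transform n h b) -> subcritical n b.
Proof.
move=> g0ref [g1 g1ref H]; have mg0 := reference_meas g0ref.
have mg1 := reference_meas g1ref.
have [_ [M gM] g0pos] := g0ref; have [_ _ g1pos] := g1ref.
(* The factor [h g1] arises from [|u| g1 h^2 = |h u| (h g1)] for positive [h] and [g1]; [g0] caps it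
   to keep [g] bounded and integrable for [n]. *)
pose g x := Num.min `|h x * g1 x| `|g0 x|.
have mg : measurable_fun [set: T] g.
  apply: measurable_minr; last exact: measurableT_comp.
  by apply: measurableT_comp => //; exact: measurable_funM.
have gge0 x : 0 <= g x by rewrite /g le_min !normr_ge0.
have gle x : `|g x| <= `|g0 x| by rewrite ger0_norm// /g ge_min lexx orbT.
apply: (@subcritical_of_dom g) => //.
  split.
  - by apply: Lfun1_bounded gle => //; case: g0ref.
  - by exists M => x; apply: le_trans (gM x).
  - move: (ae_sqr_density hpos g1pos) => {}g1pos.
    move: (aeI hpos (aeI g1pos g0pos)); apply: filterS => x [hx [g1x g0x]].
    by rewrite /g lt_min !normr_gt0 mulf_neq0 ?gt_eqF.
move=> v dv; have [mu du <- vE] := transform_div dv.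
set u := (fun x => _) in mu du vE *.
have := H _ du; rewrite -[quad (h_transform _ _ _) u]/(quad b (fun x => h x * u x)).
apply: le_trans.
have -> : (\int[sqr_density n h]_x (`|u x| * g1 x)%:E =
    \int[sqr_density n h]_x (`|u x| * `|g1 x|)%:E)%E.
  apply: ae_eq_integral => //.
  - by apply/measurable_EFinP; apply: measurable_funM => //; exact: measurableT_comp.
  - by apply/measurable_EFinP; apply: measurable_funM => //; exact: measurableT_comp.
  - by apply: filterS g1pos => x gx _; rewrite (gtr0_norm gx).
rewrite integral_sqr_density; [|by apply: measurable_funM; exact: measurableT_comp|
  by move=> x; rewrite mulr_ge0].
apply: ae_ge0_le_integral => //.
- by move=> x _; rewrite lee_fin mulr_ge0.
- apply/measurable_EFinP; apply: measurable_funM => //; apply: measurableT_comp => //.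
  exact/L2_meas/bL.
- by move=> x _; rewrite lee_fin; apply: mulr_ge0 (sqr_ge0 _); exact: mulr_ge0.
- apply/measurable_EFinP; apply: measurable_funM; last exact: measurable_funX.
  by apply: measurable_funM; exact: measurableT_comp.
- apply: filterS vE => x -> _; rewrite lee_fin.
  have -> : `|u x| * `|g1 x| * h x ^+ 2 = `|h x * u x| * `|h x * g1 x|.
    by rewrite !normrM -[h x ^+ 2]ger0_norm ?sqr_ge0// normrX; ring.
  by rewrite ler_wpM2l// /g ge_min lexx.
Qed.

Lemma subcritical_transient g : reference_function n g ->
  (forall u, dom b u ->
    (\int[n]_x (`|u x| * g x)%:E <= (Num.sqrt (quad b u))%:E)%E) ->
  transient (sqr_density n h) (h_transform n h b).
Proof.
move=> gref H; have mg := reference_meas gref; have [g1 [M gM] gpos] := gref.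
(* The first term gives [|u| g' h^2 <= |h u| |g|]; the second keeps [g'] bounded by [|g|] and
   [g' h^2] integrable. *)
pose g' x := Num.min (`|g x| * `|h x|^-1) (`|g x| * `|1 + h x ^+ 2|^-1).
have mg' : measurable_fun [set: T] g'.
  apply: measurable_minr; apply: measurable_funM.
  - exact: measurableT_comp.
  - exact: measurable_inv_norm.
  - exact: measurableT_comp.
  - by apply: measurable_inv_norm; apply: measurable_funD => //; exact: measurable_funX.
have g'0 x : 0 <= g' x by rewrite /g' le_min !mulr_ge0 ?invr_ge0.
have h1 x : 0 < 1 + h x ^+ 2 by rewrite ltr_pwDl// sqr_ge0.
have g'le x : g' x <= `|g x| * (1 + h x ^+ 2)^-1.
  by rewrite /g' (gtr0_norm (h1 x)) ge_min lexx orbT.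
exists g'.
  split.
  - apply/Lfun1_integrable/integrableP; split; first exact/measurable_EFinP.
    under eq_integral do rewrite /= ger0_norm//.
    rewrite integral_sqr_density//.
    apply: (@le_lt_trans _ _ (\int[n]_x `|(g x)%:E|)%E); last first.
      by move/Lfun1_integrable/integrableP : g1 => [].
    apply: ge0_le_integral => //.
    + by move=> x _; rewrite lee_fin mulr_ge0// sqr_ge0.
    + by apply/measurable_EFinP; apply: measurable_funM => //; exact: measurable_funX.
    + by apply: measurableT_comp => //; exact/measurable_EFinP.
    + move=> x _; rewrite lee_fin.
      apply: (@le_trans _ _ (`|g x| * (1 + h x ^+ 2)^-1 * h x ^+ 2)).
        by rewrite ler_wpM2r// sqr_ge0.
      rewrite -mulrA ler_piMr// mulrC ler_pdivrMr// mul1r.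
      by rewrite lerDr.
  - exists M => x; rewrite ger0_norm//; apply: le_trans (g'le x) _.
    apply: le_trans (gM x); rewrite ler_piMr// invf_le1// lerDl.
    exact: sqr_ge0.
  - apply: sqr_density_ae; move: (aeI hpos gpos); apply: filterS => x [hx gx].
    by rewrite /g' lt_min !mulr_gt0 ?invr_gt0 ?normr_gt0 ?gt_eqF.
move=> u [Lu du]; have := H _ du; apply: le_trans.
have mu := L2_meas Lu; have mhu : measurable_fun [set: T] (fun x => h x * u x).
  exact: measurable_funM.
rewrite integral_sqr_density//; last 2 first.
- by apply: measurable_funM => //; exact: measurableT_comp.
- by move=> x; rewrite mulr_ge0.
have -> : (\int[n]_x (`|(h x * u x)| * g x)%:E =
    \int[n]_x (`|(h x * u x)| * `|g x|)%:E)%E.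
  apply: ae_eq_integral => //.
  - by apply/measurable_EFinP; apply: measurable_funM => //; exact: measurableT_comp.
  - by apply/measurable_EFinP; apply: measurable_funM => //; exact: measurableT_comp.
  - by apply: filterS gpos => x gx _; rewrite (gtr0_norm gx).
apply: ge0_le_integral => //.
- by move=> x _; rewrite lee_fin; apply: mulr_ge0 (sqr_ge0 _); exact: mulr_ge0.
- apply/measurable_EFinP; apply: measurable_funM; last exact: measurable_funX.
  by apply: measurable_funM => //; exact: measurableT_comp.
- by apply/measurable_EFinP; apply: measurable_funM => //; exact: measurableT_comp.
- move=> x _; rewrite lee_fin.
  have h2 : h x ^+ 2 = `|h x| * `|h x| by rewrite -normrM -expr2 ger0_norm ?sqr_ge0.
  have [h0|h0] := eqVneq (h x) 0.
    by rewrite h0 expr0n /= mulr0 mul0r normr0 mul0r.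
  apply: (@le_trans _ _ (`|u x| * (`|g x| * `|h x|^-1) * h x ^+ 2)).
    rewrite ler_wpM2r ?sqr_ge0// ler_wpM2l//.
    by rewrite /g' ge_min lexx.
  rewrite h2 normrM le_eqVlt; apply/orP; left; apply/eqP.
  by field; rewrite normr_eq0.
Qed.

(** The ground state is [h] itself: functions tending to 1 are carried to functions tending to [h],
    with the same energies. *)
Lemma recurrent_critical :
  recurrent (sqr_density n h) (h_transform n h b) -> critical n b.
Proof.
move=> [_ [u_ [du cu u1] q0]].
have A : approximating n b (fun k x => h x * u_ k x) h.
  split.
  - by move=> k; have [] := du k.
  - move=> e /cu[N NP]; exists N => j k jN kN; have := NP j k jN kN.
    congr (_ < _); rewrite /quad /=; congr (b _ _); apply/funext => x /=; ring.
  - apply: filterS (ae_sqr_density hpos u1) => x ux.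
    by rewrite -[X in _ --> X]mulr1; apply: cvgM => //; exact: cvg_cst.
exists h; split => //; first by split => //; exists (fun k x => h x * u_ k x).
by exists (fun k x => h x * u_ k x).
Qed.

Lemma critical_recurrent (u_ : nat -> T -> R) : approximating n b u_ h ->
  quad b (u_ k) @[k --> \oo] --> (0 : R) ->
  recurrent (sqr_density n h) (h_transform n h b).
Proof.
move=> [du cu uh] q0.
pose v_ k x := `|h x|^-1 * u_ k x.
have vP k := transform_div (du k).
have A : approximating (sqr_density n h) (h_transform n h b) v_ (cst 1).
  split.
  - by move=> k; have [] := vP k.
  - move=> e /cu[N NP]; exists N => j k jN kN; have := NP j k jN kN.
    have [_ _ <- _] := transform_div (ph_domB ph (du j) (du k)).
    congr (_ < _); rewrite /quad /= /v_; congr (b _ _); apply/funext => x /=; ring.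
  - apply: sqr_density_ae; move: (aeI hpos uh); apply: filterS => x [hx ux].
    have -> : (cst 1 x : R) = `|h x|^-1 * h x.
      by rewrite (gtr0_norm hx) mulVf// gt_eqF.
    by apply: cvgM => //; exact: cvg_cst.
split; first by split; [exact: measurable_cst|exists v_].
exists v_ => //; apply: cvg_ext q0 => k.
by have [_ _ <- _] := vP k.
Qed.

End transform.

End criticality.

(** * Excessive functions *)

Section excessive.
Context {R : realType} {d : measure_display} {T : measurableType d}.
Variables (n : {measure set T -> \bar R}) (b : real_form T R).
Variable S : R -> (T -> R) -> T -> R.
Hypothesis hb : positivity_preserving_form n b.
Hypothesis hS : semigroup_of n b S.
Implicit Types f g u v w : T -> R.

Let ph := ppf_prehilbert hb.
Let bL := ppf_L2 hb.
Let sg := hS.1.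

Lemma ae_nondecreasing (f_ : nat -> T -> R) :
  (forall k, {ae n, forall x, f_ k x <= f_ k.+1 x}) ->
  {ae n, forall x, nondecreasing_seq (fun k => f_ k x)}.
Proof.
by move=> /ae_foralln; apply: filterS => x fx; apply/nondecreasing_seqP.
Qed.

(** Monotonicity of [S t] makes the [S t (f_ k)] increase, so their a.e. limit is a value of the
    monotone extension at [h]. Used with resolvents for (i) and with tail infima for (ii). *)
Lemma excessive_of_sequence (t : R) (h : T -> R) (f_ : nat -> T -> R) : 0 < t ->
  (forall k, L2 n (f_ k)) ->
  (forall k, {ae n, forall x, 0 <= f_ k x <= f_ k.+1 x}) ->
  {ae n, forall x, f_ k x @[k --> \oo] --> h x} ->
  {ae n, forall x, exists M, forall k, S t (f_ k) x <= M} ->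
  {ae n, forall x, forall l : R, S t (f_ k) x @[k --> \oo] --> l -> l <= h x} ->
  exists2 g, monotone_ext n (S t) (EFin \o h) g &
      {ae n, forall x, (g x <= (h x)%:E)%E}.
Proof.
move=> t0 Lf f0 fh SM Sle.
have Snd : {ae n, forall x, nondecreasing_seq (fun k => S t (f_ k) x)}.
  apply: ae_nondecreasing => k; apply: (semigroup_le hb hS) => //.
  by apply: filterS (f0 k) => x /andP[].
have Scv : {ae n, forall x, S t (f_ k) x @[k --> \oo] --> flim (fun k => S t (f_ k)) x}.
  move: (aeI Snd SM); apply: filterS => x [nd [M HM]]; apply: flim_cvg.
  by apply: nondecreasing_is_cvgn => //; exists M => _ [k _ <-].
exists (EFin \o flim (fun k => S t (f_ k))).
  exists f_; split => //.
  - move: (ae_foralln f0) fh; apply: filterS2 => x fx hx; split => //.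
    by apply/cvg_EFin => //; exact: nearW.
  - by apply: filterS Scv => x hx; apply/cvg_EFin => //; exact: nearW.
by move: Scv Sle; apply: filterS2 => x Sx; rewrite lee_fin; apply.
Qed.

(** Where [u = G_1 g] is nonpositive, so is the smaller function [G_N g] for [N >= 1]; hence [g] is
    there at most [|N G_N g - g|], which is arbitrarily small in L2. Thus [p], which is [g] on that
    set and 0 elsewhere, vanishes a.e., although [g] is positive. *)
Lemma resolvent_pos g u : reference_function n g -> resolvent_at n b 1 g u ->
  {ae n, forall x, 0 < u x}.
Proof.
move=> gref Ru; have Lg := reference_L2 gref; have [_ _ gpos] := gref.
have g0 : {ae n, forall x, 0 <= g x} by apply: filterS gpos => x; exact: ltW.
have [du _] := Ru; have mu := L2_meas (bL du); have mg := reference_meas gref.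
pose p x := if u x <= 0 then g x else 0.
have mp : measurable_fun [set: T] p.
  by apply: measurable_fun_ifT => //; exact: measurable_fun_ler.
have Lp e : 0 < e -> L2 n p /\ ip n p p <= e.
  move=> e0; have [N [w [N1 Rw We]]] := resolvent_dense hb Lg e0.
  have N0 : 0 < N by exact: lt_le_trans N1.
  have [dw Hw] := Rw; have Lw := bL dw.
  have Rw' : resolvent_at n b N g (fun x => N^-1 * w x).
    split; first exact: ph_domZ.
    move=> v dv; have := Hw _ dv; have Lv := bL dv.
    rewrite (phZl ph)// !ipZl// => H.
    have -> : N^-1 * b w v + N * (N^-1 * ip n w v) = N^-1 * (b w v + N * ip n w v) by ring.
    by rewrite H; field; rewrite gt_eqF.
  have wu := resolvent_antimono hb ltr01 N1 Lg g0 Ru Rw'.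
  have [| | H1 H2] := @L2_dominated _ _ _ n p (w \- g) mp.
  - exact: L2B.
  - move: (aeI wu gpos); apply: filterS => x [wx gx]; rewrite /p.
    case: ifPn => ux; last by rewrite normr0.
    have Ni : 0 < N^-1 by rewrite invr_gt0.
    have wx0 : w x <= 0 by rewrite -(pmulr_rle0 (w x) Ni); exact: le_trans wx ux.
    rewrite (gtr0_norm gx) /= ler0_norm; lra.
  by split => //; apply: le_trans H2 (ltW We).
have [L2p _] := Lp 1 ltr01.
have p0 : {ae n, forall x, p x = 0}.
  apply: ip_eq0_ae => //; apply/eqP; rewrite eq_le ip_ge0 andbT.
  by apply/ler_addgt0Pr => e e0; rewrite add0r; have [] := Lp _ e0.
move: (aeI p0 gpos); apply: filterS => x [px gx]; rewrite ltNge; apply/negP => ux.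
by move: px; rewrite /p ux => gx0; rewrite gx0 ltxx in gx.
Qed.

(** With [x] the integral of [u g], the resolvent equation gives [quad b u <= x] and the hypothesis
    gives [x <= sqrt (quad b u)]; so [x^2 <= x]. *)
Lemma resolvent_ip_le1 (alpha : R) g u : 0 < alpha -> reference_function n g ->
  (forall v, dom b v ->
    (\int[n]_x (`|v x| * g x)%:E <= (Num.sqrt (quad b v))%:E)%E) ->
  resolvent_at n b alpha g u -> {ae n, forall x, 0 <= u x} -> ip n u g <= 1.
Proof.
move=> a0 gref H [du Hu] u0; have Lg := reference_L2 gref; have Lu := bL du.
have := H _ du; rewrite -L2_ip_fin//; last exact: L2_abs.
rewrite (@ip_ae _ _ _ n _ u)//; last 2 first.
- exact: L2_abs.
- by apply: filterS u0 => x ux; rewrite ger0_norm.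
rewrite lee_fin => H1; have := Hu _ du; rewrite (ip_sym n g u) => H2.
have qu := ph_ge0 ph du.
have H3 : quad b u <= ip n u g.
  by rewrite -H2 lerDl mulr_ge0 ?ip_ge0// ltW.
rewrite leNgt; apply/negP => lt1.
have : ip n u g ^+ 2 <= ip n u g.
  apply: le_trans H3; rewrite -[leRHS]sqr_sqrtr// lerXn2r// nnegrE ?sqrtr_ge0//.
  by apply: le_trans (ltW lt1).
by rewrite expr2 => ?; nra.
Qed.

Lemma subcritical_excessive g : reference_function n g ->
  (forall v, dom b v ->
    (\int[n]_x (`|v x| * g x)%:E <= (Num.sqrt (quad b v))%:E)%E) ->
  exists h, Hplus n S h.
Proof.
move=> gref H; have Lg := reference_L2 gref; have [_ _ gpos] := gref.
have g0 : {ae n, forall x, 0 <= g x} by apply: filterS gpos => x; exact: ltW.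
pose al k : R := k.+1%:R^-1; have al0 k : 0 < al k by rewrite invr_gt0.
have /choice[u_ uP] : forall k, exists u, resolvent_at n b (al k) g u.
  by move=> k; exact: resolvent_exists.
have du k : dom b (u_ k) by case: (uP k).
have Lu k : L2 n (u_ k) by exact: bL.
have u0 k := resolvent_ge0 hb (al0 k) Lg g0 (uP k).
have unext k : {ae n, forall x, u_ k x <= u_ k.+1 x}.
  apply: (resolvent_antimono hb (al0 k.+1) _ Lg g0 (uP k.+1) (uP k)).
  by rewrite lef_pV2 ?posrE// ler_nat.
have und := ae_nondecreasing unext.
pose F k x := (`|u_ k x| * `|g x|)%:E.
have mF k : measurable_fun [set: T] (F k).
  apply/measurable_EFinP; apply: measurable_funM; apply: measurableT_comp => //.
  - exact/L2_meas/Lu.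
  - exact/L2_meas/Lg.
have F0 k x : (0 <= F k x)%E by rewrite lee_fin mulr_ge0.
have IF k : (\int[n]_x F k x <= 1)%E.
  rewrite -L2_ip_fin; [|exact: L2_abs|exact: L2_abs].
  rewrite lee_fin; apply: le_trans (resolvent_ip_le1 (al0 k) gref H (uP k) (u0 k)).
  rewrite (@ip_ae _ _ _ n _ (u_ k)); [| exact: L2_abs| by []|exact: L2_abs|].
    rewrite ip_sym (@ip_ae _ _ _ n _ g) ?(ip_sym n g)//; first exact: L2_abs.
    by apply: filterS gpos => x gx; rewrite gtr0_norm.
  by apply: filterS (u0 k) => x ux; rewrite ger0_norm.
(* By Fatou's lemma [L] has integral at most 1, so it is finite a.e.; since the [u_ k] increase,
   [u_ k <= L / g] is the bound that makes them converge. *)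
pose L x := limn_einf (F^~ x).
have LE x : L x = limn (einfs (F^~ x)) by rewrite /L limn_einf_lim.
have L0 x : (0 <= L x)%E.
  rewrite LE; apply: lime_ge; first exact: is_cvg_einfs.
  by apply: nearW => k; apply: le_ereal_inf_tmp => _ [j /= kj <-].
have mL : measurable_fun [set: T] L.
  exact: measurable_limn_einf.
have LI : n.-integrable [set: T] L.
  apply/integrableP; split => //; under eq_integral do rewrite gee0_abs//.
  apply: le_lt_trans (ltry 1); apply: le_trans (fatou n measurableT mF _) _ => //.
  rewrite limn_einf_lim; apply: lime_le; first exact: is_cvg_einfs.
  apply: nearW => k; apply: le_trans (IF k).
  by apply: ereal_inf_lbound; exists k => /=.
have ucv : {ae n, forall x, u_ k x @[k --> \oo] --> flim u_ x}.
  have := integrable_ae measurableT LI => Lfin.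
  move: (aeI (aeI Lfin und) (aeI gpos (ae_foralln u0))); apply: filterS.
  move=> x [[/(_ I) Lx nd] [gx ux]]; apply: flim_cvg.
  apply: nondecreasing_is_cvgn => //; exists (fine (L x) / g x) => _ [k _ <-].
  rewrite ler_pdivlMr// -lee_fin fineK// LE.
  apply: lime_ge; first exact: is_cvg_einfs.
  exists k => // j /= kj; apply: le_ereal_inf_tmp => _ [i /= ji <-].
  rewrite /F lee_fin (gtr0_norm gx) ler_pM2r// ger0_norm//.
  by apply: nd; exact: leq_trans ji.
have mh : measurable_fun [set: T] (flim u_) by apply: flim_meas => k; exact: L2_meas.
pose h : {mfun T >-> R} := HB.pack (flim u_) (isMeasurableFun.Build _ _ _ _ (flim u_) mh).
have ule : {ae n, forall x, forall k, u_ k x <= flim u_ x}.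
  move: (aeI und ucv); apply: filterS => x [nd cv] k.
  rewrite -(cvg_lim (@Rhausdorff R) cv); apply: nondecreasing_cvgn_le => //.
  by apply/cvg_ex; exists (flim u_ x).
exists h; split.
  (* As [al 0 = 1], the first term is [G_1 g], positive a.e., and [h] lies above it. *)
  have R0 : resolvent_at n b 1 g (u_ 0%N).
    by have := uP 0%N; rewrite /al invr1.
  have := resolvent_pos gref R0; move: ule; apply: filterS2 => x /(_ 0%N) le0 pos0.
  exact: lt_le_trans le0.
move=> t t0.
have Sle : {ae n, forall x, forall k, S t (u_ k) x <= expR (al k * t) * u_ k x}.
  by apply: ae_foralln => k; exact: (semigroup_resolvent_le hb hS (al0 k) t0 Lg g0 (uP k)).
apply: (@excessive_of_sequence t h u_) => //.
- by move=> k; move: (aeI (u0 k) (unext k)); apply: filterS => x [-> ->].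
- move: (aeI Sle (aeI ule (ae_foralln u0))); apply: filterS => x [Sx [ux u0x]].
  (* All [al k] are at most 1, so [expR t] dominates every exponential factor. *)
  exists (expR t * flim u_ x) => k; apply: le_trans (Sx k) _.
  apply: ler_pM; [exact: expR_ge0|exact: u0x| |exact: ux].
  by rewrite ler_expR ler_piMl ?(ltW t0)// /al invf_le1 ?ltr0n// ler1n.
- move: (aeI Sle (aeI ucv ule)); apply: filterS => x [Sx [cv _]] l Sl.
  have E1 : expR (al k * t) @[k --> \oo] --> (1 : R).
    rewrite -(@expR0 R); apply: continuous_cvg; first exact: continuous_expR.
    by rewrite -(mul0r t); apply: cvgM; [exact: cvg_invS|exact: cvg_cst].
  have E2 : expR (al k * t) * u_ k x @[k --> \oo] --> flim u_ x.
    by rewrite -[X in _ --> X]mul1r; exact: cvgM.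
  have E3 : expR (al k * t) * u_ k x + -1 * S t (u_ k) x @[k --> \oo] -->
      flim u_ x + -1 * l by apply: cvg_add E2 _; exact: cvg_cmul.
  suff : 0 <= flim u_ x + -1 * l by move=> ?; rewrite /h /=; lra.
  by apply: cvg_ge E3 _ => k; have := Sx k => ?; lra.
Qed.

(** Approximations of the ground state need not be monotone in [k]; their tail infima are, lie in L2
    by domination, and have the same limit. *)
Definition tail_inf (v_ : nat -> T -> R) k x : R := fine (einfs (fun j => (v_ j x)%:E) k).

Section tail_inf.
Variable v_ : nat -> T -> R.
Hypothesis v0 : forall k x, 0 <= v_ k x.

Lemma tail_inf_fin k x : einfs (fun j => (v_ j x)%:E) k \is a fin_num.
Proof.
rewrite ge0_fin_numE; last first.
  by apply: le_ereal_inf_tmp => _ [j /= _ <-]; rewrite lee_fin.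
apply: (@le_lt_trans _ _ (v_ k x)%:E); last exact: ltry.
by apply: ereal_inf_lbound; exists k => /=.
Qed.

Lemma tail_inf_ge0 k x : 0 <= tail_inf v_ k x.
Proof.
by rewrite -lee_fin fineK ?tail_inf_fin//; apply: le_ereal_inf_tmp => _ [j /= _ <-];
  rewrite lee_fin.
Qed.

Lemma tail_inf_le k j x : (k <= j)%N -> tail_inf v_ k x <= v_ j x.
Proof.
move=> kj; rewrite -lee_fin fineK ?tail_inf_fin//.
by apply: ereal_inf_lbound; exists j.
Qed.

Lemma tail_inf_mono k x : tail_inf v_ k x <= tail_inf v_ k.+1 x.
Proof.
rewrite -lee_fin !fineK ?tail_inf_fin//.
apply: ereal_inf_le_tmp => _ [j /= kj <-]; exists j => //=.
exact: ltnW.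
Qed.

Lemma tail_inf_cvg x (l : R) : v_ k x @[k --> \oo] --> l ->
  tail_inf v_ k x @[k --> \oo] --> l.
Proof.
move=> vl; apply: fine_cvg; apply: cvg_einfs.
by apply/cvg_EFin => //; exact: nearW.
Qed.

Lemma tail_inf_meas k : (forall j, measurable_fun [set: T] (v_ j)) ->
  measurable_fun [set: T] (tail_inf v_ k).
Proof.
move=> mv; apply: measurableT_comp => //.
by apply: measurable_fun_einfs => j; exact/measurable_EFinP.
Qed.

End tail_inf.

(** For [j >= k], positivity gives [S t (f_ k) <= S t (v_ j)], so the positive part of
    [S t (f_ k) - v_ j] is at most [|S t (v_ j) - v_ j|], whose squared norm is bounded by
    [t * quad b (v_ j) / 2]. Fatou's lemma in [j] yields [S t (f_ k) <= h]. *)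
Lemma ground_state_excessive (h : {mfun T >-> R}) (u_ : nat -> T -> R) :
  {ae n, forall x, 0 < h x} -> approximating n b u_ h ->
  quad b (u_ k) @[k --> \oo] --> (0 : R) -> Hplus n S h.
Proof.
move=> hpos [du _ uh] q0; split => // t t0.
have mh : measurable_fun [set: T] h by exact: measurable_funPT.
pose v_ k x := `|u_ k x|.
have dv k : dom b (v_ k) by have [] := ppf_abs hb (du k).
have Lv k : L2 n (v_ k) by exact: bL.
have v0 k x : 0 <= v_ k x by exact: normr_ge0.
have qv : quad b (v_ k) @[k --> \oo] --> (0 : R).
  apply: squeeze0 q0 => k; have [_ ->] := ppf_abs hb (du k).
  by rewrite andbT; exact: ph_ge0.
have vh : {ae n, forall x, v_ k x @[k --> \oo] --> h x}.
  move: (aeI hpos uh); apply: filterS => x [hx ux].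
  by rewrite -(gtr0_norm hx); exact: cvg_norm.
pose f_ := tail_inf v_.
have mf k : measurable_fun [set: T] (f_ k).
  by apply: tail_inf_meas => j; exact: L2_meas.
have fv k j x : (k <= j)%N -> f_ k x <= v_ j x by exact: tail_inf_le.
have Lf k : L2 n (f_ k).
  have [|//] := L2_dominated (mf k) (Lv k).
  by apply: aeW => x; rewrite !ger0_norm ?tail_inf_ge0//; exact: fv.
have Sle k : {ae n, forall x, S t (f_ k) x <= h x}.
  have mS := L2_meas (sg_L2 sg t0 (Lf k)).
  pose p := pos_part (S t (f_ k) \- h).
  have mp : measurable_fun [set: T] p.
    by apply: measurable_maxr => //; exact: measurable_funB.
  have [| | | |Lp p0] := @L2_fatou _ _ _ n
    (fun j => pos_part (S t (f_ k) \- v_ (j + k)%N)) p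
    (fun j => t * (quad b (v_ (j + k)%N) / 2)) 0 _ mp.
  - by move=> j; apply: measurable_maxr => //; apply: measurable_funB => //; exact: L2_meas.
  - apply: filterS vh => x vx.
    have C : S t (f_ k) x - v_ (j + k)%N x @[j --> \oo] --> S t (f_ k) x - h x.
      by apply: cvgB; [exact: cvg_cst|rewrite (cvg_shiftn k (fun j => v_ j x))].
    have -> : p x = 2^-1 * ((S t (f_ k) x - h x) + `|S t (f_ k) x - h x|).
      by rewrite /p pos_partE.
    apply: cvg_ext (cvg_cmul (c:=2^-1) (cvg_add C (cvg_norm C))) => j.
    by rewrite pos_partE.
  - move=> j; have LSv := sg_L2 sg t0 (Lv (j + k)%N).
    have := semigroup_continuity hb hS t0 (dv (j + k)%N); rewrite -lee_fin.
    apply: le_trans; rewrite (L2_quad_fin (L2B LSv (Lv _))).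
    apply: ae_ge0_le_integral => //.
    + by move=> x _; rewrite lee_fin sqr_ge0.
    + apply/measurable_EFinP; apply: measurable_funX; apply: measurable_maxr => //.
      by apply: measurable_funB => //; exact: L2_meas.
    + by move=> x _; rewrite lee_fin sqr_ge0.
    + apply/measurable_EFinP; apply: measurable_funX.
      exact: L2_meas (L2B LSv (Lv _)).
    + have := semigroup_le hb hS t0 (Lf k) (Lv (j + k)%N)
        (aeW n (fun x => fv k (j + k)%N x (leq_addl _ _))).
      apply: filterS => x Sx _; rewrite lee_fin /pos_part /=.
      case: (leP (S t (f_ k) x - v_ (j + k)%N x) 0) => H.
        by rewrite expr0n /= sqr_ge0.
      by rewrite lerXn2r ?nnegrE//; lra.
  - rewrite -(mulr0 t) -(mul0r 2^-1); apply: cvg_cmul; apply: cvgM; last exact: cvg_cst.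
    by rewrite (cvg_shiftn k (fun j => quad b (v_ j))).
  have := ip_eq0_ae Lp; have -> : ip n p p = 0 by apply/eqP; rewrite eq_le p0 ip_ge0.
  move=> /(_ erefl); apply: filterS => x /eqP; rewrite /p /pos_part /= eq_le ge_max.
  by rewrite subr_le0 => /andP[/andP[]].
apply: (@excessive_of_sequence t h f_) => //.
- by move=> k; apply: aeW => x; rewrite tail_inf_ge0// tail_inf_mono.
- by apply: filterS vh => x; exact: tail_inf_cvg.
- by apply: filterS (ae_foralln Sle) => x Sx; exists (h x).
- by apply: filterS (ae_foralln Sle) => x Sx l Sl; exact: cvg_le Sl Sx.
Qed.

Lemma subcriticality_h_transform g0 : reference_function n g0 ->
  subcritical n b <-> exists2 h, Hplus n S h & transient (sqr_density n h) (h_transform n h b).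
Proof.
move=> g0ref; split=> [[g gref H]|[h [hpos _] ht]]; last first.
  exact: (transient_subcritical hb hpos g0ref ht).
have Hd v : dom b v -> (\int[n]_x (`|v x| * g x)%:E <= (Num.sqrt (quad b v))%:E)%E.
  by move=> dv; have [? ?] := dom_ext hb dv; exact: H.
have [h hH] := subcritical_excessive gref Hd; exists h => //.
by have [hpos _] := hH; exact: (subcritical_transient hpos gref Hd).
Qed.

Lemma criticality_h_transform :
  critical n b <-> exists2 h, Hplus n S h & recurrent (sqr_density n h) (h_transform n h b).
Proof.
split=> [[phi [[mphi _] phi0 [u_ A q0]]]|[h [hpos _] hr]]; last first.
  exact: (recurrent_critical hpos hr).
pose h : {mfun T >-> R} := HB.pack phi (isMeasurableFun.Build _ _ _ _ phi mphi).
exists h; first exact: (@ground_state_excessive h u_).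
exact: (critical_recurrent hb (h := h) phi0 A q0).
Qed.

End excessive.

(** * The Schroedinger form *)

Lemma dirichlet_prehilbert (d : measure_display) (T : measurableType d)
    (R : realType) (n : {measure set T -> \bar R}) (a : real_form T R) :
  Defs.symmetric_form n a -> prehilbert a.
Proof.
by case=> _ _ _ d0 dl l s g _; split.
Qed.

(** * Positive part and absolute value in a Dirichlet form *)

Section contraction.
Context {R : realType} {d : measure_display} {T : measurableType d}.
Variables (n : {measure set T -> \bar R}) (a : real_form T R).
Hypothesis ha : dirichlet_form n a.
Implicit Types u v : T -> R.

Let ph : prehilbert a := dirichlet_prehilbert ha.1.1.

(** The unit contraction is applied to [u / M]: its upper cut at 1 is inactive, and scaling back
    leaves the positive part. *)
Lemma dirichlet_pos_part u (M : R) : 0 < M -> (forall x, u x <= M) -> dom a u ->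
  dom a (pos_part u) /\ quad a (pos_part u) <= quad a u.
Proof.
move=> M0 uM du; have [dw qw] := ha.2 _ (ph_domZ ph M^-1 du).
have E : (fun x => M * Num.min (Num.max (M^-1 * u x) 0) 1) = pos_part u.
  apply/funext => x; rewrite /pos_part.
  have Mu : M^-1 * u x <= 1 by rewrite mulrC ler_pdivrMr// mul1r.
  case: (leP (u x) 0) => ux.
    have H : M^-1 * u x <= 0 by rewrite pmulr_rle0// invr_gt0.
    by rewrite (max_r H) min_l ?mulr0.
  have H : 0 <= M^-1 * u x by rewrite mulr_ge0 ?invr_ge0// ltW.
  by rewrite (max_l H) (min_l Mu) mulrA divff ?mul1r// gt_eqF.
rewrite -E; split; first exact: ph_domZ.
rewrite quadZ//; move: qw; rewrite quadZ// => qw.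
have := ler_wpM2l (sqr_ge0 M) qw; rewrite mulrA -exprMn divff ?gt_eqF//.
by rewrite expr1n mul1r.
Qed.

Lemma dirichlet_abs u (M : R) : (forall x, `|u x| <= M) -> dom a u ->
  dom a (fun x => `|u x|) /\ quad a (fun x => `|u x|) <= quad a u.
Proof.
move=> uM du.
have [L L0 uL] : exists2 L, 0 < L & forall x, `|u x| <= L.
  by exists (`|M| + 1) => [|x]; [rewrite ltr_wpDl|
    apply: le_trans (uM x) _; apply: le_trans (ler_norm _) _; rewrite lerDl].
have le_L x : u x <= L by exact: le_trans (ler_norm _) (uL x).
have dnu : dom a (fun x => - u x).
  by have := ph_domZ ph (-1) du; congr (dom a _); apply/funext => x; rewrite mulN1r.
have [dp qp] := dirichlet_pos_part L0 le_L du.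
have [|dm _] := dirichlet_pos_part L0 _ dnu.
  by move=> x; apply: le_trans (uL x); rewrite -normrN ler_norm.
set p := pos_part u in dp qp *; set q := pos_part _ in dm *.
have absE : (fun x => `|u x|) = p \+ q.
  by apply/funext => x; rewrite /p /q !pos_partE/= normrN; field.
have uE : u = p \- q by apply/funext => x; rewrite /p /q !pos_partE/= normrN; field.
have cross : a p q <= 0.
  (* [p - t q] has positive part [p], so [quad a p <= quad a (p - t q)]; expanding and dividing by
     [t] gives the bound. *)
  have key t : 0 < t -> 2 * a p q <= t * quad a q.
    move=> t0; have dtq := ph_domZ ph t dm; have dt := ph_domB ph dp dtq.
    have E : pos_part (p \- (fun x => t * q x)) = p.
      apply/funext => x; rewrite /p /q /pos_part /=.
      case: (leP (u x) 0) => ux; case: (leP (- u x) 0) => ux'.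
      - by rewrite mulr0 subr0 maxxx.
      - by rewrite max_r// sub0r oppr_le0 mulr_ge0// ltW.
      - by rewrite mulr0 subr0 max_l// ltW.
      - by lra.
    have [|_] := dirichlet_pos_part L0 _ dt.
      move=> x /=; apply: (@le_trans _ _ (p x)).
        by rewrite gerBl; apply: mulr_ge0; [exact: ltW|exact: pos_part_ge0].
      by rewrite /p /pos_part ge_max le_L ltW.
    rewrite E quadB// quadZ// phZr// => H.
    by rewrite -(ler_pM2l t0); lra.
  have [q0|q0] := eqVneq (quad a q) 0.
    by have := key 1 ltr01; rewrite q0 mulr0 => ?; lra.
  rewrite leNgt; apply/negP => c0.
  have q1 : 0 < quad a q by rewrite lt_neqAle eq_sym q0; exact: ph_ge0.
  (* At this [t] the bound reads [2 a(p, q) <= a(p, q)], which contradicts [a(p, q) > 0]. *)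
  have := key (a p q / quad a q) (divr_gt0 c0 q1).
  by rewrite divfK ?gt_eqF// => ?; lra.
rewrite absE; split; first exact: ph_domD.
rewrite [in X in _ <= X]uE quadB// quadD//.
by lra.
Qed.

End contraction.

(** * Continuous functions with compact support *)

Section compact_support.
Context {R : realType} {E : pmetricType R}.
Implicit Types u v : E -> R.

Lemma C0P u : C0 u <-> continuous u /\ exists2 K : set E, compact K & forall x, u x != 0 -> K x.
Proof.
split=> [[cu cK]|[cu [K cK uK]]].
  by split => //; eexists; [exact: cK|move=> x ux; exact: subset_closure].
have cK' : closed K by apply: compact_closed => //; exact: (@metric_hausdorff R E).
split => //; apply: subclosed_compact cK _; first exact: closed_closure.
by rewrite closureE; apply: bigcap_inf; split.
Qed.

Lemma C0_lin (c : R) u v : C0 u -> C0 v -> C0 (fun x => c * u x + v x).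
Proof.
move=> /C0P[cu [K cK uK]] /C0P[cv [L cL vL]]; apply/C0P; split.
  by move=> x; apply: cvgD; [apply: cvgM; [exact: cvg_cst|exact: cu]|exact: cv].
exists (K `|` L); first exact: compactU.
move=> x /=; have [->|/uK] := eqVneq (u x) 0; last by left.
by rewrite mulr0 add0r => /vL; right.
Qed.

Lemma C0_0 : C0 (cst 0 : E -> R).
Proof.
apply/C0P; split; first by move=> x; exact: cvg_cst.
by exists set0; [exact: compact0|move=> x; rewrite eqxx].
Qed.

Lemma C0_norm u : C0 u -> C0 (fun x => `|u x|).
Proof.
move=> /C0P[cu [K cK uK]]; apply/C0P; split.
  by move=> x; apply: cvg_norm; exact: cu.
by exists K => // x; rewrite normr_eq0; exact: uK.
Qed.

Lemma C0_bounded u : C0 u -> exists M, forall x, `|u x| <= M.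
Proof.
move=> /C0P[cu [K cK uK]].
have /compact_bounded[M [_ HM]] : compact (u @` K).
  by apply: continuous_compact => //; exact: continuous_subspaceT.
exists (`|M| + 1) => x; have [->|ux] := eqVneq (u x) 0.
  by rewrite normr0 addr_ge0.
apply: HM; first by apply: le_lt_trans (ler_norm _) _; rewrite ltrDl.
by exists x => //; exact: uK.
Qed.

Lemma continuous_borel_meas u : continuous u -> measurable_fun [set: borel E] (u : borel E -> R).
Proof.
move=> cu; apply: (measurability _ (RGenOInfty.measurableE R)) => // _ [_ [x ->] <-].
rewrite setTI; apply: sub_sigma_algebra.
move/continuousP : cu; apply; exact: interval_open.
Qed.

Lemma C0_integrable (mu : {measure set (borel E) -> \bar R}) u v : radon mu ->
  C0 u -> C0 v -> mu.-integrable [set: borel E] (EFin \o (fun x : borel E => u x * v x)).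
Proof.
move=> rmu hu hv; have [M uM] := C0_bounded hu; have [N vN] := C0_bounded hv.
have /C0P[cu [K cK uK]] := hu; have [cv _] := hv.
have mK : measurable (K : set (borel E)).
  rewrite -[K]setCK; apply: measurableC; apply: sub_sigma_algebra.
  by apply: closed_openC; apply: compact_closed => //; exact: (@metric_hausdorff R E).
have M0 : 0 <= M by apply: le_trans (uM point).
have N0 : 0 <= N by apply: le_trans (vN point).
have muv : measurable_fun [set: borel E] (fun x : borel E => u x * v x).
  by apply: measurable_funM; exact: continuous_borel_meas.
apply/integrableP; split; first exact/measurable_EFinP.
apply: (@le_lt_trans _ _ (\int[mu]_(x in (K : set (borel E))) (M * N)%:E)%E); last first.
  by rewrite integral_cst// lte_mul_pinfty ?lee_fin ?mulr_ge0//; exact: rmu.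
rewrite [leRHS]integral_mkcond; apply: ge0_le_integral => //.
- by apply: measurableT_comp => //; exact/measurable_EFinP.
- by apply/measurable_restrict => //; rewrite ?setTI//; exact: measurable_cst.
- move=> x _; rewrite patchE; case: ifPn => xK.
    by rewrite lee_fin normrM ler_pM.
  rewrite /= lee_fin; have -> : u x = 0.
    apply/eqP; apply: contraNT xK => /uK; exact: mem_set.
  by rewrite mul0r normr0.
Qed.

End compact_support.

(** * The form on the core and its closure *)

Section schrodinger_form.
Context {R : realType} {E : pmetricType R}.
Variables (m mu : {measure set (borel E) -> \bar R}) (a : real_form (borel E) R).
Hypotheses (ha : dirichlet_form m a) (hreg : regular m a) (rmu : radon mu).
Hypothesis amu_ge0 : positive_semidefinite (schrodinger_core a mu).
Hypothesis amu_closable : closable m (schrodinger_core a mu).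

Let c := schrodinger_core a mu.
Let ph : prehilbert a := dirichlet_prehilbert ha.1.1.
Let sf := ha.1.1.

Lemma schrodinger_core_prehilbert : prehilbert c.
Proof.
split.
- by split; [exact: (ph_dom0 ph)|exact: C0_0].
- by move=> e u v [du hu] [dv hv]; split; [exact: (ph_dom_lin ph)|exact: C0_lin].
- move=> e u v w [du hu] [dv hv] [dw hw]; rewrite /c /= (ph_lin ph)//.
  have iu := C0_integrable rmu hu hw; have iv := C0_integrable rmu hv hw.
  have -> : \int[mu]_x ((e * u x + v x) * w x) =
      e * \int[mu]_x (u x * w x) + \int[mu]_x (v x * w x).
    rewrite -RintegralZl// -RintegralD//.
      by apply: eq_Rintegral => x _; ring.
    have := C0_integrable rmu (C0_lin e hu C0_0) hw.
    by congr (mu.-integrable _ _); apply/funext => x /=; congr EFin; ring.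
  ring.
- move=> u v [du _] [dv _]; rewrite /c /= (ph_sym ph)//; congr (_ - _).
  by apply: eq_Rintegral => x _; rewrite mulrC.
- exact: amu_ge0.
Qed.

Lemma schrodinger_core_L2 : dom c `<=` L2 m.
Proof. by move=> u [du _]; exact: (sform_L2 sf). Qed.

(** The integral against [mu] sees only [u^2], which the absolute value does not change, and [a]
    decreases because functions of the core are bounded. *)
Lemma schrodinger_core_abs u : dom c u ->
  dom c (fun x => `|u x|) /\ quad c (fun x => `|u x|) <= quad c u.
Proof.
move=> [du hu]; have [M uM] := C0_bounded hu.
have [da qa] := dirichlet_abs ha uM du.
split; first by split => //; exact: C0_norm.
rewrite /quad /c /= lerB//.
rewrite le_eqVlt; apply/orP; left; apply/eqP; apply: eq_Rintegral => x _.
by rewrite -normrM ger0_norm// -expr2 sqr_ge0.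
Qed.

(** The domain of [a] is dense in L2, and regularity approximates its elements by the core in a norm
    that controls that of L2. *)
Lemma schrodinger_core_dense f (e : R) : L2 m f -> 0 < e ->
  exists2 v, dom c v & ip m (v \- f) (v \- f) < e.
Proof.
move=> Hf e0; have [u_ [du uf]] := sform_dense sf Hf.
have Lu k : L2 m (u_ k) by exact: (sform_L2 sf).
have /(L2cvgP Lu Hf)/cvg0P/(_ (e / 4))[|N /(_ _ (leqnn N)) uN] := uf.
  by lra.
rewrite ger0_norm ?ip_ge0// in uN.
have [|v [dv hv] vu] := hreg.1 _ (du N) (e / 4); first by lra.
exists v => //; have Lv : L2 m v by exact: (sform_L2 sf).
have := quad_chain (@L2_prehilbert _ _ _ m) Lv (Lu N) Hf; rewrite /quad /=.
have := ph_ge0 ph (ph_domB ph dv (du N)); move: vu; rewrite /quad /=.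
by move=> *; lra.
Qed.

Lemma schrodinger_positivity_preserving g : reference_function m g ->
  positivity_preserving_form m (schrodinger m a mu).
Proof.
move=> gref; have hc := schrodinger_core_prehilbert; have cL := schrodinger_core_L2.
split.
- exact: closure_prehilbert.
- by move=> u [].
- by move=> u v; exact: closure_dom_ae.
- by move=> u v; exact: closure_quad_ae.
- by move=> u_; exact: closure_complete gref.
- by move=> u; apply: closure_abs => // v; exact: schrodinger_core_abs.
- move=> f Hf e e0; have [v dv vf] := schrodinger_core_dense Hf e0.
  by exists v => //; exact: core_sub_closure.
Qed.

End schrodinger_form.

Theorem theorem2p12 (R : realType) (E : pmetricType R)
    (E_lc : locally_compact [set: E]) (E_sep : separable E)
    (m : {measure set (borel E) -> \bar R})
    (m_radon : radon m) (m_supp : full_support m)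
    (a : real_form (borel E) R)
    (a_dirichlet : dirichlet_form m a) (a_regular : regular m a)
    (S : R -> (borel E -> R) -> (borel E -> R)) (a_S : semigroup_of m a S)
    (a_irreducible : irreducible m S) (a_transient : transient m a)
    (mu : {measure set (borel E) -> \bar R})
    (mu_radon : radon mu) (mu_smooth : smooth m a mu)
    (amu_ge0 : positive_semidefinite (schrodinger_core a mu))
    (amu_closable : closable m (schrodinger_core a mu))
    (Smu : R -> (borel E -> R) -> (borel E -> R))
    (amu_Smu : semigroup_of m (schrodinger m a mu) Smu) :
  (subcritical m (schrodinger m a mu) <->
   exists2 h, Hplus m Smu h &
     transient (sqr_density m h) (h_transform m h (schrodinger m a mu))) /\
  (critical m (schrodinger m a mu) <->
   exists2 h, Hplus m Smu h &
     recurrent (sqr_density m h) (h_transform m h (schrodinger m a mu))).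
Proof.
(* The reference function of the transient form [a] provides completeness of L2 for the closure and
   the cap for the reference function in (i). *)
have [g gref _] := a_transient.
have hb := schrodinger_positivity_preserving a_dirichlet a_regular mu_radon
  amu_ge0 amu_closable gref.
split; first exact: (subcriticality_h_transform hb amu_Smu gref).
exact: (criticality_h_transform hb amu_Smu).
Qed.
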